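(* Let $\alpha,\gamma\in(0,1]$ and $x\in(0,1)$. Consider the sparse variational Gaussian process regression posterior (SGPR) $Q_\gamma^*$ with the rescaled Brownian motion prior of regularity $\gamma$ and $m=m_n$ eigenvector inducing variables ($m_n\le n$), where $m_n\gg n^{\frac{1}{1+2\gamma}\left(\frac{2+\alpha}{1+\alpha}\right)}$. For $\delta\in(0,1)$ and a true function $f_0\in C^\alpha[0,1]$, let $q_m^\delta=q_m^\delta(f_0)=P_{f_0}(f_0(x)\in C_m^\delta(x))$ be the frequentist coverage of the $1-\delta$ credible interval $$C_m^\delta(x)=[\nu_m(x)-z_{1-\delta}\sigma_m(x),\ \nu_m(x)+z_{1-\delta}\sigma_m(x)],$$ where $z_{1-\delta}$ is defined by $P(|N(0,1)|\le z_{1-\delta})=1-\delta$. Put $p_\delta:=P(|N(0,1/2)|\le z_{1-\delta})>1-\delta$, where $N(0,1/2)$ is the normal distribution with mean zero and variance $1/2$. Then as $n\to\infty$: (i) (Undersmoothing case) if $\alpha>\gamma$, then $q_m^\delta\to p_\delta$ for all $f_0\in C^\alpha[0,1]$; (ii) (Correct smoothing case) if $\alpha=\gamma$, then for each $p\in(0,p_\delta]$ there exists $f_0\in C^\alpha[0,1]$ such that $q_m^\delta\to p$; (iii) (Oversmoothing case) if $\alpha<\gamma$, there exists $f_0\in C^\alpha[0,1]$ such that $q_m^\delta\to0$.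
   Context: Model: for each $n$, the design points are fixed, $x_i=\frac{i}{n+1/2}\in[0,1]$, $i=1,\dots,n$, and one observes $y_i=f_0(x_i)+\varepsilon_i$, $\varepsilon_i$ i.i.d. $\mathcal N(0,1)$ (noise variance $\sigma^2=1$). $P_{f_0}$ denotes the law of $\mathbf y=(y_1,\dots,y_n)^T$. $C^\alpha[0,1]=\{f:[0,1]\to\mathbb R: \sup_{s\ne t}|f(s)-f(t)|/|s-t|^\alpha<\infty\}$ for $\alpha\in(0,1]$. $a_n\gg b_n$ means $b_n/a_n\to0$. Prior: the rescaled Brownian motion prior of regularity $\gamma$ is the centred Gaussian process on $[0,1]$ with covariance kernel $k(s,t)=c_n\min(s,t)$, $c_n=(n+1/2)^{\frac{1-2\gamma}{1+2\gamma}}$. Write $\mathbf k_n(x)=(k(x,x_1),\dots,k(x,x_n))^T$ and $[\mathbf K_{nn}]_{ij}=k(x_i,x_j)$. SGPR with $m$ eigenvector inducing variables: let $\mu_1\ge\dots\ge\mu_n\ge0$ be the eigenvalues of $\mathbf K_{nn}$ with orthonormal eigenvectors $\mathbf v_1,\dots,\mathbf v_n$, and $\eta_j=1/(1+\mu_j)$. The inducing variables are $u_j=\mathbf v_j^T(f(x_1),\dots,f(x_n))^T$, $j\le m$, and the SGPR $Q_\gamma^*$ is the Gaussian process with mean and covariance $$\nu_m(x)=\mathbf k_n(x)^T\Big[\sum_{j=1}^m\eta_j\mathbf v_j\mathbf v_j^T\Big]\mathbf y,\qquad k_m(x,x')=k(x,x')-\mathbf k_n(x)^T\Big[\sum_{j=1}^m\eta_j\mathbf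 v_j\mathbf v_j^T\Big]\mathbf k_n(x'),$$ and $\sigma_m^2(x)=k_m(x,x)$. *)

(* Defs.v *)
From HB Require Import structures.
From mathcomp Require Import all_boot all_order all_algebra.
From mathcomp Require Import all_classical all_reals all_analysis.
From mathcomp Require Import measurable_realfun.
Import Order.TTheory GRing.Theory Num.Theory.
Import numFieldNormedType.Exports.

Set Implicit Arguments.
Unset Strict Implicit.
Unset Printing Implicit Defensive.

Local Open Scope classical_set_scope.
Local Open Scope ring_scope.

Section iid_law.
Context d (T : measurableType d) (R : realType).
Local Open Scope ereal_scope.

Definition cons_pair n (p : T * n.-tuple T) : n.+1.-tuple T :=
  [tuple of p.1 :: p.2].

Lemma measurable_cons_pair n : measurable_fun [set: _] (@cons_pair n).
Proof. exact: measurable_cons. Qed.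

HB.instance Definition _ n :=
  isMeasurableFun.Build _ _ _ _ (@cons_pair n) (@measurable_cons_pair n).

Fixpoint iid_law (mu : probability T R) n : probability (n.-tuple T) R :=
  match n return probability (n.-tuple T) R with
  | 0 => dirac [tuple]
  | n'.+1 => distribution (mu \x iid_law mu n') (@cons_pair n')
  end.

(* [iid_law mu n] is the n-fold product measure. *)
Lemma iid_law_rectangle (mu : probability T R) n (A : 'I_n -> set T) :
  (forall i, measurable (A i)) ->
  iid_law mu n [set t | forall i, A i (tnth t i)] = \prod_(i < n) mu (A i).
Proof.
elim: n A => [|n IHn] A mA.
  rewrite big_ord0 /= diracE mem_set//; by case.
have mB : measurable [set t : n.-tuple T | forall i, A (lift ord0 i) (tnth t i)].
  rewrite (_ : [set _ | _] =
      \bigcap_(i in [set: 'I_n]) (@tnth n T ^~ i @^-1` A (lift ord0 i))).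
    apply: fin_bigcap_measurable => // i _.
    by rewrite -[X in measurable X]setTI; exact: measurable_tnth.
  by apply/seteqP; split => t /= tA i; [move=> _; exact: tA|exact: tA].
rewrite big_ord_recl -IHn// -product_measure1E//=.
rewrite /distribution /pushforward; congr (_ _).
apply/seteqP; split => -[a t] /=.
- move=> tA; split; first exact: (tA ord0).
  by move=> i; have := tA (lift ord0 i); rewrite tnthS.
- move=> [Aa At] i; case: (unliftP ord0 i) => [j|] ->; last exact: Aa.
  by rewrite tnthS; exact: At.
Qed.

End iid_law.

Section regression.
Context (R : realType).

Definition design n (i : 'I_n) : R := i.+1%:R / (n%:R + 2^-1).

(* [normal_prob] is a measure on [measurableTypeR R], which is R with the same
   Borel sets but another measure display; the observations are in R proper. *)
Definition observation (f0 : R -> R) n (eps : n.-tuple (measurableTypeR R)) :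
  n.-tuple R := [tuple f0 (design i) + (tnth eps i : R) | i < n].

Lemma measurable_observation f0 n :
  measurable_fun [set: n.-tuple (measurableTypeR R)] (@observation f0 n).
Proof.
apply/measurable_fun_tnthP => i.
rewrite (_ : _ \o _ = fun eps => f0 (design i) + (tnth eps i : R)); last first.
  by apply/funext => eps /=; rewrite tnth_mktuple.
apply: measurable_funD => //; exact: measurable_tnth.
Qed.

HB.instance Definition _ f0 n := isMeasurableFun.Build _ _ _ _
  (@observation f0 n) (@measurable_observation f0 n).

Definition std_normal : probability (measurableTypeR R) R := normal_prob 0 1.

Definition obs_law (f0 : R -> R) n : probability (n.-tuple R) R :=
  distribution (iid_law std_normal n) (@observation f0 n).

(* Elements of C^alpha[0,1] are represented by total functions on R, whose
   values outside [0,1] are irrelevant. *)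
Definition holder01 (alpha : R) (f : R -> R) : Prop :=
  let quotients := [set r | exists s t : R,
    [/\ 0 <= s <= 1, 0 <= t <= 1, s != t &
        r = `|f s - f t| / `|s - t| `^ alpha]] in
  (ereal_sup (EFin @` quotients) < +oo)%E.

(* a_n >> b_n.  As x / 0 = 0, the quotient is only meaningful once a_n != 0. *)
Definition much_greater (a b : nat -> R) : Prop :=
  (\forall n \near \oo, a n != 0) /\ b n / a n @[n --> \oo] --> (0 : R).

End regression.

Section sgpr.
Context (R : realType) (gamma : R) (n : nat).

Definition bm_scale : R :=
  (n%:R + 2^-1) `^ ((1 - 2 * gamma) / (1 + 2 * gamma)).

Definition bm_kernel (s t : R) : R := bm_scale * Num.min s t.

Definition kvec (x : R) : 'cV[R]_n := \col_i bm_kernel x (design R i).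

Definition kmat : 'M[R]_n :=
  \matrix_(i, j) bm_kernel (design R i) (design R j).

Definition eigensystem (K : 'M[R]_n) (mu : 'I_n -> R) (v : 'I_n -> 'cV[R]_n) :
  Prop :=
  [/\ forall i j : 'I_n, (i <= j)%N -> mu j <= mu i,
      forall i, 0 <= mu i,
      forall i, K *m v i = mu i *: v i &
      forall i j, ((v i)^T *m v j) 0 0 = (i == j)%:R].

Variables (mu : 'I_n -> R) (v : 'I_n -> 'cV[R]_n) (m : nat).

Definition eta (j : 'I_n) : R := 1 / (1 + mu j).

(* Indices are shifted by one: j < m ranges over the m largest eigenvalues. *)
Definition sgpr_mx : 'M[R]_n :=
  \sum_(j < n | (j < m)%N) eta j *: (v j *m (v j)^T).

Definition sgpr_mean (y : n.-tuple R) (x : R) : R :=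
  ((kvec x)^T *m sgpr_mx *m \col_i tnth y i) 0 0.

Definition sgpr_cov (x x' : R) : R :=
  bm_kernel x x' - ((kvec x)^T *m sgpr_mx *m kvec x') 0 0.

Definition sgpr_sd (x : R) : R := Num.sqrt (sgpr_cov x x).

Definition credible_interval (z : R) (y : n.-tuple R) (x : R) : set R :=
  [set` `[sgpr_mean y x - z * sgpr_sd x, sgpr_mean y x + z * sgpr_sd x]].

Definition coverage (z x : R) (f0 : R -> R) : \bar R :=
  obs_law f0 n [set y | credible_interval z y x (f0 x)].

End sgpr.

(* [normal_prob] takes the standard deviation as its second argument. *)
Definition normal_abs_le (R : realType) (variance z : R) : \bar R :=
  normal_prob 0 (Num.sqrt variance) [set t | `|t| <= z].

(* Main.v *)
(** In the coordinates of the eigenvectors, [nu_m(x) = w . y] for a weight vector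
    [w], so the coverage is the standard normal mass of
    [[(- z sigma_m - b) / |w|, (z sigma_m - b) / |w|]], where [b = w . f0 - f0(x)] is
    the bias.  With [h = N ^ (-1 / (1 + 2 gamma))] and [N = n + 1/2],
      [sigma_m ^ 2 / h ^ (2 gamma) -> 1/2],  [|w| ^ 2 / h ^ (2 gamma) -> 1/4],
    while [b = O(h ^ alpha)], with equality of orders for [f0 = |. - x| ^ alpha].
    Comparing [alpha] with [gamma] then gives the three regimes, and in the critical
    one the limit varies continuously with the size of the cusp.

    The full weights ([m = n]) are explicit: since [min] is the Green function of the
    second difference, [(I + K)^-1 K e] is, up to an exponentially small boundary
    term, the kernel [peak q * q ^ |k - i|] with [(1 - q) ^ 2 = r q], where
    [K_ij = r min(i, j)].  The truncation to [m] eigenvectors is controlled by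
    [mu_j = r / (2 - 2 cos phi_j)] with [phi_j = (j - 1/2) pi / N], whose eigenvectors
    are [sin (phi_j k)]: a Hoelder function has coefficients of order
    [sqrt N * j ^ (- alpha)] on them, and the hypothesis on [m] makes the tails
    negligible. *)
Require Import Defs.
From mathcomp Require Import all_boot all_order all_algebra.
From mathcomp Require Import all_classical all_reals all_analysis.
From mathcomp Require Import measurable_realfun.
From mathcomp Require Import ring lra zify.
Import Order.TTheory GRing.Theory Num.Theory.
Import numFieldNormedType.Exports.
Local Open Scope classical_set_scope.
Local Open Scope ring_scope.

Set Implicit Arguments.
Unset Strict Implicit.
Unset Printing Implicit Defensive.

(** * The Brownian motion kernel matrix and its spectrum *)

(** As [r = h ^ (4 gamma)] and [N h ^ (2 gamma) = 1 / h], the kernel [q ^ |k - i|] reaches over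
    about [1 / sqrt r] nodes, a distance [h], and its boundary defect, of size [exp (- c / h)] up to
    powers of [h], is below every power of [h]. Truncation costs [r N / m] in the variance, which
    only asks for [m h -> oo]. In the bias it costs [r N ^ 2 m ^ (- 1 - alpha) = h ^ (- 2) m ^ (- 1
    - alpha)]; that this be [o (h ^ alpha)] is exactly the exponent [(2 + alpha) / (1 + alpha)]. The
    limits 1/2 and 1/4 differ because the variance is the value of the kernel at its centre, while
    [|w| ^ 2] sums its squares, that is, the kernel of ratio [q ^ 2] up to a factor. The half-width
    [z sqrt (1/2)] over the standard deviation [1/2] is [z sqrt 2], whence the normal law of
    variance 1/2. Two obstacles shape the proof. The eigensystem is an arbitrary one, to be
    identified up to signs through the simplicity of the spectrum. The point [x] is in general not a
    node, so the kernel is interpolated between two nodes. *)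

Section kernel_matrix.
Context (R : realType).
Implicit Types (g : nat -> R) (n k : nat).

(* The negated second difference at [l.+1], the node of index [l : 'I_n]. *)
Definition step2 g l : R := 2 * g l.+1 - g l - g l.+2.

(** A discrete Green identity: [min] inverts [step2] under the conditions [g 0 = 0] and
    [g n.+1 = g n]. The last two terms measure the failure of these conditions, which hold exactly
    for the waves and almost for the exponential kernel. *)
Lemma sum_minn_step2 g n k : (k <= n)%N ->
  \sum_(l < n) (minn k l.+1)%:R * step2 g l =
  g k - g 0%N - k%:R * (g n.+1 - g n).
Proof.
elim: n k => [|n IHn] k.
  by rewrite leqn0 => /eqP ->; rewrite big_ord0; ring.
rewrite leq_eqVlt => /predU1P[->|kn]; rewrite big_ord_recr /=; last first.
  by rewrite IHn// (minn_idPl (ltnW kn)) /step2; ring.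
rewrite minnn (eq_bigr (fun l : 'I_n => (minn n l.+1)%:R * step2 g l)).
  by rewrite IHn// /step2; ring.
by move=> l _; congr (_%:R * _); have := ltn_ord l; lia.
Qed.

Definition nodes n : R := n%:R + 2^-1.

Lemma nodes_gt0 n : 0 < nodes n.
Proof. by rewrite /nodes ltr_wpDl. Qed.

(** The factor [r] of the overview, the kernel scale in units of the grid. *)
Definition precision (gamma : R) n : R := bm_scale gamma n / nodes n.

Lemma bm_scale_gt0 (gamma : R) n : 0 < bm_scale gamma n.
Proof. exact/powR_gt0/nodes_gt0. Qed.

Lemma precision_gt0 (gamma : R) n : 0 < precision gamma n.
Proof. by rewrite divr_gt0// ?bm_scale_gt0// nodes_gt0. Qed.

(** Functions of the nodes live on all of [nat], so that the boundary nodes [0] and [n.+1] make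
    sense; the vector keeps the nodes [1] to [n]. *)
Definition vec g n : 'cV[R]_n := \col_i g i.+1.

Lemma kmatE (gamma : R) n (i j : 'I_n) :
  kmat gamma n i j = precision gamma n * (minn i.+1 j.+1)%:R.
Proof.
rewrite mxE /bm_kernel /design -/(nodes n) /precision.
rewrite -mulrA; congr (_ * _); rewrite minEle ler_pM2r ?invr_gt0 ?nodes_gt0//.
by rewrite ler_nat; have [ij|ij] := leqP i.+1 j.+1; rewrite mulrC.
Qed.

Lemma kmat_vec_step2 (gamma : R) g n (i : 'I_n) :
  (kmat gamma n *m \col_l step2 g l) i 0 =
  precision gamma n * (g i.+1 - g 0%N - i.+1%:R * (g n.+1 - g n)).
Proof.
rewrite -sum_minn_step2// mulr_sumr mxE; apply: eq_bigr => l _.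
by rewrite kmatE mxE mulrA.
Qed.

(** Indices start at [0], which turns [j - 1/2] into [j + 1/2]. *)
Definition freq n (j : nat) : R := (j%:R + 2^-1) * pi / nodes n.

Lemma freq_gt0 n j : 0 < freq n j.
Proof. by rewrite divr_gt0 ?nodes_gt0// mulr_gt0 ?pi_gt0// ltr_wpDl. Qed.

Lemma freq_ltpi n j : (j < n)%N -> freq n j < pi.
Proof.
move=> jn; rewrite ltr_pdivrMr ?nodes_gt0// mulrC ltr_pM2l ?pi_gt0//.
by rewrite ltrD2r ltr_nat.
Qed.

Lemma freq_lt n (i j : nat) : (i < j)%N -> freq n i < freq n j.
Proof.
move=> ij; rewrite ltr_pM2r ?invr_gt0 ?nodes_gt0// ltr_pM2r ?pi_gt0//.
by rewrite ltrD2r ltr_nat.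
Qed.

Definition wave n j (k : nat) : R := sin (freq n j * k%:R).

Lemma cos_freq_end n j : cos (freq n j * nodes n) = 0.
Proof.
rewrite /freq divfK ?gt_eqF ?nodes_gt0//.
elim: j => [|j IHj]; first by rewrite add0r mulrC cos_pihalf.
rewrite (_ : _ * pi = (j%:R + 2^-1) * pi + pi); last first.
  by rewrite -natr1; ring.
by rewrite cosDpi IHj oppr0.
Qed.

(** The nodes [n] and [n.+1] are symmetric about the position [nodes n], where the derivative of the
    sine vanishes. *)
Lemma wave_end n j : wave n j n.+1 = wave n j n.
Proof.
have e1 : freq n j * n.+1%:R = freq n j * nodes n + freq n j / 2.
  by rewrite /nodes -natr1; field.
have e2 : freq n j * n%:R = freq n j * nodes n - freq n j / 2.
  by rewrite /nodes; field.
by rewrite /wave e1 e2 !sinD !sinN !cosN cos_freq_end; ring.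
Qed.

Lemma wave_step2 n j l :
  step2 (wave n j) l = (2 - 2 * cos (freq n j)) * wave n j l.+1.
Proof.
have e1 : freq n j * l%:R = freq n j * l.+1%:R - freq n j.
  by rewrite -natr1; ring.
have e2 : freq n j * l.+2%:R = freq n j * l.+1%:R + freq n j.
  by rewrite -natr1; ring.
by rewrite /step2 /wave e1 e2 !sinD !sinN !cosN; ring.
Qed.

Definition bm_eigenvalue (gamma : R) n j : R :=
  precision gamma n / (2 - 2 * cos (freq n j)).

Lemma cos_freq_lt1 n j : (j < n)%N -> 0 < 2 - 2 * cos (freq n j).
Proof.
move=> jn; rewrite subr_gt0 gtr_pMr//.
rewrite -[ltRHS](cos0 R) ltr_cos ?in_itv/= ?lexx ?pi_ge0//.
  by rewrite freq_gt0.
by rewrite !ltW ?freq_gt0// freq_ltpi.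
Qed.

(** Both boundary terms of [kmat_vec_step2] vanish on a wave, so the kernel matrix inverts the
    second difference, whose eigenvalue is [2 - 2 cos]. *)
Lemma bm_eigenvector (gamma : R) n j : (j < n)%N ->
  kmat gamma n *m vec (wave n j) n =
  bm_eigenvalue gamma n j *: vec (wave n j) n.
Proof.
move=> jn; have c0 := cos_freq_lt1 jn.
have -> : vec (wave n j) n =
    (2 - 2 * cos (freq n j))^-1 *: \col_l step2 (wave n j) l.
  apply/colP => i; rewrite !mxE wave_step2 mulKf ?gt_eqF//.
apply/colP => i; rewrite -scalemxAr mxE kmat_vec_step2 wave_end subrr mulr0 subr0.
rewrite {2}/wave mulr0 sin0 subr0 !mxE wave_step2 /bm_eigenvalue.
by field; rewrite gt_eqF.
Qed.

Lemma bm_eigenvalue_lt (gamma : R) n (i j : nat) : (i < j < n)%N ->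
  bm_eigenvalue gamma n j < bm_eigenvalue gamma n i.
Proof.
move=> /andP[ij jn]; rewrite ltr_pM2l ?precision_gt0//.
rewrite ltf_pV2 ?posrE ?cos_freq_lt1// ?(ltn_trans ij)//.
have itv k : (k < n)%N -> freq n k \in `[0, pi].
  by move=> kn; rewrite in_itv/= !ltW ?freq_gt0 ?freq_ltpi.
by rewrite ltrD2l ltrN2 ltr_pM2l// ltr_cos ?itv ?freq_lt// (ltn_trans ij).
Qed.

(** By [sin ^ 2 = (1 - cos (2 .)) / 2] this is a sum of cosines, which telescopes after
    multiplication by [2 sin phi]. Its end value is the sine of twice [phi * nodes n], which is
    zero. *)
Lemma wave_sqr_norm n j : (j < n)%N ->
  \sum_(k < n) wave n j k.+1 ^+ 2 = nodes n / 2.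
Proof.
move=> jn; set phi := freq n j.
have s0 : sin phi != 0.
  by rewrite gt_eqF// sin_gt0_pi// freq_gt0 freq_ltpi.
have tel p : \sum_(k < p) cos (phi * k.+1%:R *+ 2) * (2 * sin phi) =
    sin (phi * (2 * p%:R + 1)) - sin phi.
  elim: p => [|p IHp]; first by rewrite big_ord0 mulr0 add0r mulr1 subrr.
  rewrite big_ord_recr/= IHp.
  rewrite (_ : phi * (2 * p.+1%:R + 1) = phi * p.+1%:R *+ 2 + phi); last first.
    by rewrite -natr1; ring.
  rewrite (_ : phi * (2 * p%:R + 1) = phi * p.+1%:R *+ 2 - phi); last first.
    by rewrite -natr1; ring.
  by rewrite !sinD !sinN !cosN; ring.
have := tel n; rewrite (_ : phi * _ = (phi * nodes n) *+ 2); last first.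
  by rewrite /nodes; field.
rewrite sin_mulr2n cos_freq_end mul0r mul0rn sub0r -mulr_suml => teln.
have {teln} : \sum_(k < n) cos (phi * k.+1%:R *+ 2) = - 2^-1.
  by apply: (mulIf (_ : 2 * sin phi != 0)); rewrite ?mulf_neq0// teln; field.
under eq_bigr do rewrite cos_mulr2n cos2sin2.
have -> : \sum_(i < n) ((1 - sin (phi * i.+1%:R) ^+ 2) *+ 2 - 1) =
    n%:R - 2 * \sum_(k < n) wave n j k.+1 ^+ 2.
  rewrite mulr_sumr -[n in n%:R]card_ord -sumr_const -sumrB.
  by apply: eq_bigr => k _; rewrite /wave -/phi; ring.
by rewrite /nodes; set S := \sum_(_ < _) _; lra.
Qed.

End kernel_matrix.

(** Strict growth forces [f i >= i] counting from the bottom and [f i <= i] counting from the top.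
    It serves to match two decreasing enumerations of the spectrum. *)
Lemma increasing_ord_id n (f : 'I_n -> 'I_n) :
  (forall i j : 'I_n, (i < j)%N -> (f i < f j)%N) -> f =1 id.
Proof.
move=> fmono.
have fge k : forall i : 'I_n, i = k :> nat -> (k <= f i)%N.
  elim: k => [//|k IHk] i ik.
  have kn : (k < n)%N by rewrite ltnW// -ik ltn_ord.
  apply: leq_ltn_trans (IHk (Ordinal kn) erefl) (fmono _ _ _).
  by rewrite ik.
have fle k : forall i : 'I_n, (i + k = n.-1)%N -> (f i + k <= n.-1)%N.
  elim: k => [|k IHk] i ik.
    by have := ltn_ord (f i); lia.
  have kn : (i.+1 < n)%N by have := ltn_ord i; lia.
  have := IHk (Ordinal kn); rewrite /= addSn -addnS => /(_ ik).
  by have := fmono i (Ordinal kn) (ltnSn _); lia.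
move=> i; apply/val_inj/eqP; rewrite eqn_leq fge//= andbT.
by have := ltn_ord i; have := fle (n.-1 - i)%N i; lia.
Qed.

(** Lagrange's identity: twice the difference of the two sides is a double sum of squares. *)
Lemma cauchy_schwarz_sum (R : realDomainType) n (x y : 'I_n -> R) :
  (\sum_j x j * y j) ^+ 2 <= (\sum_j x j ^+ 2) * (\sum_j y j ^+ 2).
Proof.
rewrite -subr_ge0 -(pmulr_lge0 _ (ltr0n R 2)).
have -> : ((\sum_j x j ^+ 2) * (\sum_j y j ^+ 2) - (\sum_j x j * y j) ^+ 2) * 2 =
    \sum_i \sum_j (x i * y j - x j * y i) ^+ 2.
  have -> : \sum_i \sum_j (x i * y j - x j * y i) ^+ 2 =
      \sum_i \sum_j (x i ^+ 2 * y j ^+ 2) + \sum_i \sum_j (x j ^+ 2 * y i ^+ 2)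
      - 2 * \sum_i \sum_j (x i * y i * (x j * y j)).
    rewrite mulr_sumr -big_split -sumrB; apply: eq_bigr => i _.
    rewrite mulr_sumr -big_split -sumrB; apply: eq_bigr => j _ /=.
    ring.
  have dl (u w : 'I_n -> R) :
      \sum_i \sum_j u i * w j = (\sum_j u j) * (\sum_j w j).
    by rewrite big_distrlr.
  by rewrite [X in _ + X - _]exchange_big/= !dl; ring.
by rewrite sumr_ge0// => i _; rewrite sumr_ge0// => j _; rewrite sqr_ge0.
Qed.

(** * Orthonormal bases of column vectors *)

Section orthonormal.
Context (R : realType) (n : nat).
Implicit Types a b : 'cV[R]_n.

Definition dot a b : R := (a^T *m b) 0 0.

Lemma dotE a b : dot a b = \sum_i a i 0 * b i 0.
Proof. by rewrite /dot mxE; apply: eq_bigr => i _; rewrite mxE. Qed.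

Lemma dotC a b : dot a b = dot b a.
Proof. by rewrite !dotE; apply: eq_bigr => i _; rewrite mulrC. Qed.

Lemma dotDr a b c : dot a (b + c) = dot a b + dot a c.
Proof. by rewrite /dot mulmxDr mxE. Qed.

Lemma dot_sumr (I : Type) (r : seq I) (P : pred I) a (F : I -> 'cV[R]_n) :
  dot a (\sum_(i <- r | P i) F i) = \sum_(i <- r | P i) dot a (F i).
Proof. by rewrite /dot mulmx_sumr summxE. Qed.

Lemma dotZr k a b : dot a (k *: b) = k * dot a b.
Proof. by rewrite /dot -scalemxAr mxE. Qed.

Lemma dotZl k a b : dot (k *: a) b = k * dot a b.
Proof. by rewrite dotC dotZr dotC. Qed.

Variable v : 'I_n -> 'cV[R]_n.
Hypothesis vON : forall i j, dot (v i) (v j) = (i == j)%:R.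

Let V : 'M[R]_n := \matrix_(i, j) v j i 0.

Let VT a j : (V^T *m a) j 0 = dot (v j) a.
Proof. by rewrite dotE mxE; apply: eq_bigr => i _; rewrite !mxE. Qed.

(** Orthonormality says [V^T V = 1]; for a square matrix the other product is then the identity too,
    which is the completeness of the family. *)
Let VVT : V *m V^T = 1%:M.
Proof.
apply: mulmx1C; apply/matrixP => i j; rewrite !mxE -vON dotE.
by apply: eq_bigr => k _; rewrite !mxE.
Qed.

Lemma parseval a b : dot a b = \sum_j dot (v j) a * dot (v j) b.
Proof.
rewrite {1}/dot -[b in LHS]mul1mx -VVT -!mulmxA mulmxA -{1}[V]trmxK -trmx_mul.
by rewrite mxE; apply: eq_bigr => j _; rewrite mxE !VT.
Qed.

Lemma orthonormal_expand a : a = \sum_j dot (v j) a *: v j.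
Proof.
rewrite -[LHS]mul1mx -VVT -mulmxA; apply/colP => i; rewrite mxE summxE.
by apply: eq_bigr => j _; rewrite VT !mxE mulrC.
Qed.

(** Parseval and Cauchy-Schwarz, uniformly in the bounded multipliers [c] and in the set of indices.
    The error terms caused by the defect [rho] are estimated with it. *)
Lemma bessel_sum_le (P : pred 'I_n) (c : 'I_n -> R) a b :
  (forall j, `|c j| <= 1) ->
  \sum_(j | P j) `|c j * dot (v j) a * dot (v j) b| <=
  Num.sqrt (dot a a) * Num.sqrt (dot b b).
Proof.
move=> c1.
apply: (@le_trans _ _ (\sum_j `|dot (v j) a| * `|dot (v j) b|)).
  rewrite [leRHS](bigID P)/= -[leLHS]addr0; apply: lerD.
    apply: ler_sum => j _; rewrite !normrM -mulrA.
    by rewrite -[leRHS]mul1r ler_wpM2r// mulr_ge0.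
  by apply: sumr_ge0 => j _; rewrite mulr_ge0.
rewrite (parseval a a) (parseval b b).
have sq c' : \sum_j dot (v j) c' * dot (v j) c' = \sum_j `|dot (v j) c'| ^+ 2.
  by apply: eq_bigr => j _; rewrite real_normK ?num_real// expr2.
rewrite !sq -sqrtrM; last by apply: sumr_ge0 => j _; rewrite sqr_ge0.
rewrite -[leLHS]ger0_norm; last by apply: sumr_ge0 => j _; rewrite mulr_ge0.
by rewrite -sqrtr_sqr ler_wsqrtr// cauchy_schwarz_sum.
Qed.

End orthonormal.

(** * Identification of an arbitrary eigensystem of the kernel matrix *)

Section bm_eigensystem.
Context (R : realType) (gamma : R) (n : nat).
Variables (mu : 'I_n -> R) (v : 'I_n -> 'cV[R]_n).
Hypothesis hmu : eigensystem (kmat gamma n) mu v.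

Lemma eigensystem_orthonormal i j : dot (v i) (v j) = (i == j)%:R.
Proof. by have [_ _ _ vv] := hmu; exact: vv. Qed.

Lemma dot_kmat j a : dot (v j) (kmat gamma n *m a) = mu j * dot (v j) a.
Proof.
have [_ _ Kv _] := hmu.
have KT : (kmat gamma n)^T = kmat gamma n.
  by apply/matrixP => i k; rewrite mxE !kmatE minnC.
rewrite dotC /dot trmx_mul KT -mulmxA Kv -scalemxAr mxE.
by congr (_ * _); exact: dotC.
Qed.

Let w k := vec (@wave R n k) n.

Let dotww (k : 'I_n) : dot (w k) (w k) = nodes R n / 2.
Proof.
by rewrite dotE -(wave_sqr_norm R (ltn_ord k)); apply: eq_bigr => i _; rewrite !mxE.
Qed.

(** The product of [v j] with [K w_k] is computed in two ways, by the symmetry of [K] and by the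
    eigenvalue equation of the wave. *)
Let eig j (k : 'I_n) : dot (v j) (w k) != 0 -> mu j = bm_eigenvalue gamma n k.
Proof.
move=> vw; apply: (mulIf vw); rewrite -dot_kmat (bm_eigenvector gamma (ltn_ord k)).
by rewrite dotZr.
Qed.

Let eig_ex (k : 'I_n) : {j | dot (v j) (w k) != 0}.
Proof.
apply: sigW; apply: contrapT => /forallNP vw0.
have := dotww k; rewrite (parseval eigensystem_orthonormal) big1.
  by apply/eqP; rewrite lt_eqF// divr_gt0// nodes_gt0.
move=> j _; have /negP := vw0 j; rewrite negbK => /eqP ->; by rewrite mul0r.
Qed.

(** Each wave [w k], being nonzero, overlaps some [v (f k)], whose eigenvalue is then the explicit
    one. As [mu] decreases and the explicit eigenvalues decrease strictly, [f] is strictly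
    increasing, hence the identity. *)
Lemma eigensystem_eigenvalue (j : 'I_n) : mu j = bm_eigenvalue gamma n j.
Proof.
have [mu_dec _ _ _] := hmu.
pose f k := sval (eig_ex k).
have fE k : mu (f k) = bm_eigenvalue gamma n k.
  by apply: eig; exact: (svalP (eig_ex k)).
suff fid : f =1 id by rewrite -{1}(fid j) fE.
apply: increasing_ord_id => i k ik; rewrite ltnNge; apply/negP => /mu_dec.
by apply/negP; rewrite -ltNge !fE bm_eigenvalue_lt// ik ltn_ord.
Qed.

(** The eigenvalues being distinct, the wave is orthogonal to all the [v j] but [v k]. The sign of
    the scaling factor is undetermined, so only its square is given. *)
Lemma eigensystem_eigenvector (k : 'I_n) :
  exists2 s : R, s ^+ 2 = nodes R n / 2 & v k = s^-1 *: w k.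
Proof.
have vw0 j : j != k -> dot (v j) (w k) = 0.
  move=> jk; apply/eqP; apply: contraTT jk => /eig.
  rewrite eigensystem_eigenvalue negbK => e; apply/eqP/val_inj.
  have [jk|kj|//] := ltngtP j k.
    have := @bm_eigenvalue_lt _ gamma n j k.
    by rewrite jk ltn_ord e ltxx => /(_ isT).
  have := @bm_eigenvalue_lt _ gamma n k j.
  by rewrite kj ltn_ord e ltxx => /(_ isT).
have s2 : dot (v k) (w k) ^+ 2 = nodes R n / 2.
  rewrite -(dotww k) [RHS](parseval eigensystem_orthonormal) (bigD1 k)//= big1 ?addr0//.
  by move=> j /vw0 ->; rewrite mul0r.
exists (dot (v k) (w k)) => //.
rewrite [X in _ *: X](orthonormal_expand eigensystem_orthonormal) (bigD1 k)//=.
rewrite big1 ?addr0 => [|j /vw0 ->]; last by rewrite scale0r.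
rewrite scalerA mulVf ?scale1r//.
by rewrite -sqrf_eq0 s2 gt_eqF// divr_gt0// nodes_gt0.
Qed.

End bm_eigensystem.

Section eigenvalue_bound.
Context (R : realType).
Implicit Types y : R.

(** Up to [pi / 4] the derivative is at least [1/2]; beyond it the sine is at least [1/2], while
    [y / 4] is less than [1/2]. *)
Lemma sin_ge_quarter y : 0 <= y <= pi / 2 -> y / 4 <= sin y.
Proof.
move=> /andP[y0 y2].
have pi4 : pi / 2 = pi / 4 *+ 2 :> R by field.
have pi40 : 0 < pi / 4 :> R by rewrite divr_gt0 ?pi_gt0.
have pi42 : pi / 4 < 1 :> R by have := pihalf_lt2 R; lra.
have cs : cos (pi / 4) ^+ 2 = 2^-1 :> R.
  by have := cos_pihalf R; rewrite pi4 cos_mulr2n; lra.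
have sn : sin (pi / 4) ^+ 2 = 2^-1 :> R.
  by rewrite sin2cos2 cs; lra.
have c2 : 2^-1 <= cos (pi / 4) :> R.
  rewrite -(ler_pXn2r (_ : (0 < 2)%N)) ?nnegrE//; first by rewrite cs; lra.
  by rewrite cos_ge0_pihalf// pi4; apply/andP; split; lra.
have s2 : 2^-1 <= sin (pi / 4) :> R.
  rewrite -(ler_pXn2r (_ : (0 < 2)%N)) ?nnegrE//; first by rewrite sn; lra.
  by rewrite sin_ge0_pi//; apply/andP; split; have := pi_gt0 R; lra.
have [->|yN0] := eqVneq y 0; first by rewrite sin0 mul0r.
have {yN0}y0 : 0 < y by rewrite lt_neqAle eq_sym yN0.
have [y4|y4] := leP y (pi / 4); last first.
  have : sin (pi / 4) < sin y by rewrite ltr_sin// in_itv/=; apply/andP; split; lra.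
  by have := pihalf_lt2 R; lra.
have := @MVT R sin cos 0 y y0 (fun x _ => is_derive_sin x).
case=> [|c]; first exact/continuous_subspaceT/continuous_sin.
rewrite in_itv/= => /andP[c0 cy]; rewrite sin0 !subr0 => ->.
have : cos (pi / 4) < cos c.
  by rewrite ltr_cos ?in_itv/=; first lra; apply/andP; split; lra.
by nra.
Qed.

(** [2 - 2 cos phi = 4 sin (phi / 2) ^ 2 >= phi ^ 2 / 16], and [phi >= (j + 1) / N] because
    [pi / 2 >= 1]. *)
Lemma bm_eigenvalue_le (gamma : R) n (j : nat) : (j < n)%N ->
  bm_eigenvalue gamma n j <=
  16 * precision gamma n * nodes R n ^+ 2 / j.+1%:R ^+ 2.
Proof.
move=> jn; have N0 := nodes_gt0 R n; set phi := freq R n j.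
have phi0 : 0 < phi by exact: freq_gt0.
have phipi : phi < pi by exact: freq_ltpi.
have phij : j.+1%:R / nodes R n <= phi.
  rewrite ler_pM2r ?invr_gt0// -natr1.
  by have := pihalf_ge1 R; have : 0 <= j%:R :> R by []; nra.
have c0 : 0 < 2 - 2 * cos phi by exact: cos_freq_lt1.
have j0 : 0 < j.+1%:R :> R by [].
have key : (j.+1%:R / nodes R n) ^+ 2 / 16 <= 2 - 2 * cos phi.
  have -> : 2 - 2 * cos phi = 4 * sin (phi / 2) ^+ 2.
    have {1}-> : phi = (phi / 2) *+ 2 by field.
    by rewrite cos_mulr2n cos2sin2; ring.
  have : phi / 2 / 4 <= sin (phi / 2).
    by rewrite sin_ge_quarter//; apply/andP; split; lra.
  have : 0 < j.+1%:R / nodes R n by rewrite divr_gt0.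
  by move: (_ / nodes R n) phij => u; nra.
rewrite /bm_eigenvalue ler_pdivrMr//.
apply: le_trans (ler_wpM2l _ key); last first.
  have P0 := precision_gt0 gamma n.
  by rewrite ltW// divr_gt0 ?exprn_gt0// mulr_gt0 ?exprn_gt0// mulr_gt0.
rewrite le_eqVlt; apply/orP; left; apply/eqP.
by move: (j.+1%:R : R) j0 => J J0; field; rewrite !gt_eqF.
Qed.

End eigenvalue_bound.

(** * The regression in eigenvector coordinates *)

Section sgpr_coordinates.
Context (R : realType) (gamma : R) (n : nat).
Variables (mu : 'I_n -> R) (v : 'I_n -> 'cV[R]_n) (m : nat) (x : R).
Hypothesis hmu : eigensystem (kmat gamma n) mu v.

Let mu0 j : 0 <= mu j. Proof. by have [_ mu0 _ _] := hmu; exact: mu0. Qed.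
Let vON := eigensystem_orthonormal hmu.

Let eta_ge0 j : 0 <= eta mu j.
Proof. by rewrite divr_ge0// addr_ge0. Qed.

Let eta_le1 j : eta mu j <= 1.
Proof. by rewrite ler_pdivrMr ?mul1r ?lerDl ?mu0// ltr_pwDl. Qed.

Let eta_norm j : `|eta mu j| <= 1.
Proof. by rewrite ger0_norm. Qed.

Let shrink j : eta mu j * (1 + mu j) = 1.
Proof. by rewrite mulrC /eta mulrCA divff ?mulr1// gt_eqF// ltr_pwDl. Qed.

Let shrink_ge0 j : 0 <= eta mu j * mu j. Proof. by rewrite mulr_ge0. Qed.

Let shrink_le1 j : eta mu j * mu j <= 1.
Proof. by have := shrink j; have := eta_ge0 j; lra. Qed.

Let shrink_le j : eta mu j * mu j <= mu j.
Proof. by rewrite ler_piMl. Qed.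

Lemma sgpr_mx_form a b : (a^T *m sgpr_mx mu v m *m b) 0 0 =
  \sum_(j < n | (j < m)%N) eta mu j * dot (v j) a * dot (v j) b.
Proof.
rewrite /sgpr_mx mulmx_sumr mulmx_suml summxE; apply: eq_bigr => j _.
rewrite -scalemxAr -scalemxAl mxE -mulrA; congr (_ * _).
by rewrite mulmxA -[_ *m b]mulmxA mxE big_ord1 -!/(dot _ _) (dotC a).
Qed.

(** The weights without truncation are [(I + K)^-1 K e]. An explicit [g] solves their equation up to
    the defect [rho], and all that follows is expressed through [g] and [rho]. *)
Variables e g rho : 'cV[R]_n.
Hypothesis kvec_e : kvec gamma n x = kmat gamma n *m e.
Hypothesis g_rho : g + kmat gamma n *m g = kmat gamma n *m e + rho.

Definition sgpr_weights : 'cV[R]_n :=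
  \sum_(j < n | (j < m)%N) (eta mu j * (mu j * dot (v j) e)) *: v j.

(** A common bound for what truncation changes in the posterior variance and in the norm of the
    weights, the shrinkage factors being majorized. *)
Definition variance_tail : R :=
  \sum_(j < n | ~~ (j < m)%N) mu j * dot (v j) e ^+ 2.

Definition bias_tail (f : 'cV[R]_n) : R :=
  \sum_(j < n | ~~ (j < m)%N) eta mu j * (mu j * dot (v j) e) * dot (v j) f.

Lemma sgpr_meanE y :
  sgpr_mean gamma mu v m y x = dot sgpr_weights (\col_i tnth y i).
Proof.
rewrite /sgpr_mean sgpr_mx_form kvec_e /sgpr_weights dotC dot_sumr.
apply: eq_bigr => j _.
by rewrite (dot_kmat hmu) dotZr (dotC _ (v j)).
Qed.

Let coord_g j : dot (v j) g =
  eta mu j * (mu j * dot (v j) e) + eta mu j * dot (v j) rho.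
Proof.
have := congr1 (dot (v j)) g_rho.
rewrite !dotDr !(dot_kmat hmu) => E.
by rewrite -mulrDr -E -[LHS]mul1r -(shrink j); ring.
Qed.

(** The weights are [g] without its defect [(I + K)^-1 rho] and without the discarded modes. *)
Lemma sgpr_weights_dot f : dot sgpr_weights f =
  dot g f - bias_tail f - \sum_j eta mu j * dot (v j) rho * dot (v j) f.
Proof.
have -> : dot sgpr_weights f = \sum_(j < n | (j < m)%N)
    eta mu j * (mu j * dot (v j) e) * dot (v j) f.
  rewrite dotC dot_sumr; apply: eq_bigr => j _.
  by rewrite dotZr (dotC f).
have -> : dot g f = \sum_j eta mu j * (mu j * dot (v j) e) * dot (v j) f +
    \sum_j eta mu j * dot (v j) rho * dot (v j) f.
  rewrite (parseval vON g f) -big_split/=; apply: eq_bigr => j _.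
  by rewrite coord_g mulrDl.
rewrite [X in X + _ - _ - _](bigID (fun j : 'I_n => (j < m)%N))/= /bias_tail.
by rewrite addrAC !addrK.
Qed.

(** With [a] the coefficient of the full weights and [b = eta * rho_j], the coefficient of [g] is
    [a + b]. A retained mode contributes [a ^ 2 - (a + b) ^ 2 = - 2 (a + b) b + b ^ 2], and a
    discarded one has the additional term [- a ^ 2]. *)
Lemma sgpr_weights_norm : `|dot sgpr_weights sgpr_weights - dot g g| <=
  variance_tail + 2 * (Num.sqrt (dot g g) * Num.sqrt (dot rho rho)) + dot rho rho.
Proof.
have vW j : dot (v j) sgpr_weights =
    if (j < m)%N then eta mu j * (mu j * dot (v j) e) else 0.
  rewrite /sgpr_weights dot_sumr big_mkcond (bigD1 j)//=.
  rewrite big1 => [|i ij]; last first.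
    by case: ifP => // _; rewrite dotZr vON eq_sym (negbTE ij) mulr0.
  by rewrite addr0; case: ifP => // _; rewrite dotZr vON eqxx mulr1.
have -> : dot sgpr_weights sgpr_weights - dot g g =
    - (\sum_(j < n | ~~ (j < m)%N) (eta mu j * (mu j * dot (v j) e)) ^+ 2)
    - 2 * (\sum_j eta mu j * dot (v j) g * dot (v j) rho)
    + \sum_j eta mu j ^+ 2 * dot (v j) rho * dot (v j) rho.
  rewrite [dot sgpr_weights _](parseval vON) (parseval vON g g).
  rewrite [in RHS]big_mkcond/= mulr_sumr -!sumrN -!big_split/=.
  by apply: eq_bigr => j _; rewrite vW coord_g; case: ifP => _ /=; ring.
apply: le_trans (ler_normD _ _) _; apply: lerD; last first.
  apply: le_trans (ler_norm_sum _ _ _) _.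
  apply: le_trans (bessel_sum_le vON predT rho rho _) _.
    by move=> j; rewrite normrX exprn_ile1.
  by rewrite -expr2 sqr_sqrtr// dotE sumr_ge0// => i _; rewrite -expr2 sqr_ge0.
apply: le_trans (ler_normB _ _) _; apply: lerD.
  rewrite normrN ger0_norm ?sumr_ge0// => [|j _]; last by rewrite sqr_ge0.
  (* [(eta mu) ^ 2 <= mu], since [eta mu] is at most [1] and at most [mu]. *)
  apply: ler_sum => j _; rewrite mulrA exprMn ler_wpM2r ?sqr_ge0//.
  by apply: le_trans (shrink_le j); rewrite expr2 ler_piMr.
rewrite normrM ger0_norm// ler_wpM2l//.
by apply: le_trans (ler_norm_sum _ _ _) _; exact: (bessel_sum_le vON predT).
Qed.

(** The prior variance is the interpolation variance plus [e^T K e]. On a retained mode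
    [mu - eta mu ^ 2 = eta mu], the coefficient of the full weights, so these modes rebuild the
    product of [e] and [g] up to [rho]. A discarded mode keeps all of [mu], an excess of
    [mu - eta mu = eta mu ^ 2]. *)
Lemma sgpr_covE :
  `|sgpr_cov gamma mu v m x x
    - (bm_kernel gamma n x x - dot e (kvec gamma n x)) - dot e g| <=
  variance_tail + Num.sqrt (dot e e) * Num.sqrt (dot rho rho).
Proof.
have -> : sgpr_cov gamma mu v m x x
    - (bm_kernel gamma n x x - dot e (kvec gamma n x)) - dot e g =
    (\sum_(j < n | ~~ (j < m)%N) (eta mu j * mu j) * (mu j * dot (v j) e ^+ 2))
    - \sum_j eta mu j * dot (v j) e * dot (v j) rho.
  rewrite /sgpr_cov sgpr_mx_form kvec_e.
  rewrite (parseval vON e (_ *m _)) (parseval vON e g).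
  have -> (b s1 s2 s3 : R) : b - s2 - (b - s1) - s3 = s1 - s2 - s3 by ring.
  rewrite [X in _ - X - _]big_mkcond [in RHS]big_mkcond/=.
  rewrite -!sumrN -!big_split/=.
  apply: eq_bigr => j _; rewrite (dot_kmat hmu) coord_g.
  have := shrink j; set et := eta mu j => sh.
  case: ifP => _ /=.
    (* The displayed factor [1 - et * (1 + mu j)] is zero by [shrink]. *)
    transitivity (dot (v j) e * mu j * dot (v j) e * (1 - et * (1 + mu j)) - et * dot (v j) e * dot (v j) rho); first by ring.
    by rewrite sh; ring.
  transitivity (dot (v j) e * mu j * dot (v j) e * (1 - et * (1 + mu j)) + et * mu j * (mu j * dot (v j) e ^+ 2) - et * dot (v j) e * dot (v j) rho); first by ring.
  by rewrite sh; ring.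
apply: le_trans (ler_normB _ _) _; apply: lerD.
  rewrite ger0_norm; last first.
    by apply: sumr_ge0 => j _; rewrite mulr_ge0// mulr_ge0 ?sqr_ge0.
  by apply: ler_sum => j _; rewrite ler_piMl// mulr_ge0 ?sqr_ge0.
by apply: le_trans (ler_norm_sum _ _ _) _; exact: (bessel_sum_le vON predT).
Qed.

Lemma remainder_dot_le f :
  `|\sum_j eta mu j * dot (v j) rho * dot (v j) f| <=
  Num.sqrt (dot rho rho) * Num.sqrt (dot f f).
Proof.
by apply: le_trans (ler_norm_sum _ _ _) _; exact: (bessel_sum_le vON predT).
Qed.

End sgpr_coordinates.

(** * The exponential equivalent kernel *)

Section exponential_kernel.
Context (R : realType).
Implicit Types (q t : R) (i k l n : nat).

(** The distance [|k - i|]: one of the two truncated subtractions is zero. *)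
Definition gap k i : nat := (k - i + (i - k))%N.

(** The inverse of the two-sided geometric series: with this factor [q ^ |k|] has total mass one
    over the integers. *)
Definition peak q : R := (1 - q) / (1 + q).

Definition laplace q i k : R := peak q * q ^+ gap k i.

(* Interpolates a point between the nodes [i] and [i.+1]: [kvec x = K e] exactly, as
   [min] is piecewise linear (lemma [kvec_two_point]). *)
Definition two_point t i k : R := (1 - t) * (k == i)%:R + t * (k == i.+1)%:R.

Definition weight q t i k : R :=
  (1 - t) * laplace q i k + t * laplace q i.+1 k.

Lemma sum_step2 (g : nat -> R) n :
  \sum_(l < n) step2 g l = g 1%N - g 0%N - (g n.+1 - g n).
Proof.
elim: n => [|n IHn]; first by rewrite big_ord0; ring.
by rewrite big_ord_recr/= IHn /step2; ring.
Qed.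

Variable q : R.
Hypothesis q01 : 0 < q < 1.

Let q0 : 0 < q. Proof. by case/andP: q01. Qed.
Let q1 : q < 1. Proof. by case/andP: q01. Qed.
Let qN0 : q != 0. Proof. by rewrite gt_eqF. Qed.
Let q1N0 : 1 + q != 0. Proof. by rewrite gt_eqF// ltr_wpDl// ltW. Qed.

Lemma peak_gt0 : 0 < peak q.
Proof. by rewrite divr_gt0 ?subr_gt0// ltr_wpDl// ltW. Qed.

Lemma laplace_gt0 i k : 0 < laplace q i k.
Proof. by rewrite mulr_gt0 ?peak_gt0 ?exprn_gt0. Qed.

(** Moving the centre by one node changes the exponent by at most one. With [weight_le],
    interpolation therefore costs only factors [q] and [q^-1], which tend to one. *)
Lemma weight_ge t i k : 0 <= t <= 1 -> q * laplace q i k <= weight q t i k.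
Proof.
have [q0' q1'] := andP q01.
move=> /andP[t0 t1]; rewrite /weight.
have h1 : q * laplace q i k <= laplace q i k.
  by rewrite ler_piMl ?ltW// laplace_gt0.
have h2 : q * laplace q i k <= laplace q i.+1 k.
  rewrite /laplace mulrCA -exprS ler_pM2l ?peak_gt0//.
  by rewrite ler_wiXn2l ?ltW// /gap; lia.
by nra.
Qed.

Lemma weight_le t i k : 0 <= t <= 1 -> weight q t i k <= q^-1 * laplace q i k.
Proof.
have [q0' q1'] := andP q01.
move=> /andP[t0 t1]; rewrite /weight.
have h1 : laplace q i k <= q^-1 * laplace q i k.
  by rewrite ler_peMl ?invf_ge1 ?ltW// laplace_gt0.
have h2 : laplace q i.+1 k <= q^-1 * laplace q i k.
  rewrite /laplace mulrCA ler_pM2l ?peak_gt0//.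
  rewrite -(ler_pM2l q0) mulVKf// -exprS.
  by rewrite ler_wiXn2l ?ltW// /gap; lia.
by nra.
Qed.

(** The sum equals [peak q * (1 - 2 t (1 - t) (1 - q))], and [t (1 - t) <= 1/4]. *)
Lemma two_point_weight t i n : 0 <= t <= 1 -> (0 < i < n)%N ->
  q * peak q <= \sum_(k < n) two_point t i k.+1 * weight q t i k.+1 <= peak q.
Proof.
have [q0' q1'] := andP q01.
move=> /andP[t0 t1] /andP[i0 iN].
have pick (F : nat -> R) j : (0 < j <= n)%N -> \sum_(k < n) (k.+1 == j)%:R * F k.+1 = F j.
  move=> /andP[j0 jn]; have j1n : (j.-1 < n)%N by lia.
  rewrite (bigD1 (Ordinal j1n))//= prednK// eqxx mul1r big1 ?addr0// => k kj.
  case: eqP => [kj'|]; last by rewrite mul0r.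
  by case/eqP: kj; apply/val_inj => /=; lia.
have -> : \sum_(k < n) two_point t i k.+1 * weight q t i k.+1 =
    (1 - t) * weight q t i i + t * weight q t i i.+1.
  rewrite -(pick (weight q t i) i) ?i0 ?(ltnW iN)//.
  rewrite -(pick (weight q t i) i.+1)// !mulr_sumr -big_split/=.
  by apply: eq_bigr => k _; rewrite /two_point; ring.
rewrite /weight /laplace.
have -> : gap i i = 0%N by rewrite /gap; lia.
have -> : gap i.+1 i.+1 = 0%N by rewrite /gap; lia.
have -> : gap i.+1 i = 1%N by rewrite /gap; lia.
have -> : gap i i.+1 = 1%N by rewrite /gap; lia.
have := peak_gt0; rewrite expr0 expr1; set c := peak q => c0.
have -> : (1 - t) * ((1 - t) * (c * 1) + t * (c * q)) +
   t * ((1 - t) * (c * q) + t * (c * 1)) =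
   c * (1 - 2 * t * (1 - t) * (1 - q)) by ring.
have tt : 0 <= t * (1 - t) <= 4^-1.
  by apply/andP; split; [nra | have := sqr_ge0 (t - 2^-1); rewrite expr2; nra].
move: (t * (1 - t)) (mulrA 2 t (1 - t)) tt => u <- /andP[u0 u4].
have uq : 0 <= u * (1 - q) <= (1 - q) / 4 by apply/andP; split; nra.
apply/andP; split; first by rewrite [q * c]mulrC ler_pM2l//; lra.
by rewrite ler_piMr ?(ltW c0)//; lra.
Qed.

(** Together with [weight_endn], this bounds the failure of the two boundary conditions by powers of
    [q] with the distances to the ends as exponents. *)
Lemma weight_end0 t i : 0 <= t <= 1 -> 0 <= weight q t i 0 <= q ^+ i.
Proof.
have [q0' q1'] := andP q01.
move=> /andP[t0 t1]; rewrite /weight /laplace.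
have -> : gap 0 i = i by rewrite /gap; lia.
have -> : gap 0 i.+1 = i.+1 by rewrite /gap; lia.
have c0 := peak_gt0; have c1 : peak q <= 1.
  by rewrite ler_pdivrMr; lra.
have qi0 : 0 < q ^+ i by rewrite exprn_gt0.
rewrite exprS; move: (peak q) (q ^+ i) c0 c1 qi0 => c p c0 c1 qi0.
have -> : (1 - t) * (c * p) + t * (c * (q * p)) = c * (1 - t * (1 - q)) * p by ring.
have h : 0 <= 1 - t * (1 - q) <= 1 by apply/andP; split; nra.
move: (1 - t * (1 - q)) h => h /andP[h0 h1].
apply/andP; split; first by rewrite !mulr_ge0 ?(ltW c0) ?(ltW qi0).
by rewrite ler_piMl ?(ltW qi0)// mulr_ile1// (ltW c0).
Qed.

Lemma weight_endn t i n : 0 <= t <= 1 -> (i < n)%N ->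
  `|weight q t i n.+1 - weight q t i n| <= q ^+ (n - i.+1).
Proof.
have [q0' q1'] := andP q01.
move=> /andP[t0 t1] iN; rewrite /weight /laplace.
have -> : gap n.+1 i = (n - i.+1).+2 by rewrite /gap; lia.
have -> : gap n i = (n - i.+1).+1 by rewrite /gap; lia.
have -> : gap n.+1 i.+1 = (n - i.+1).+1 by rewrite /gap; lia.
have -> : gap n i.+1 = (n - i.+1)%N by rewrite /gap; lia.
have c0 := peak_gt0; have c1 : peak q <= 1.
  by rewrite ler_pdivrMr; lra.
have qi0 : 0 < q ^+ (n - i.+1) by rewrite exprn_gt0.
rewrite !exprS; move: (peak q) (q ^+ _) c0 c1 qi0 => c p c0 c1 qi0.
have -> : (1 - t) * (c * (q * (q * p))) + t * (c * (q * p)) -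
  ((1 - t) * (c * (q * p)) + t * (c * p)) = - (c * (1 - q) * ((1 - t) * q + t)) * p.
  by ring.
have h1 : 0 <= c * (1 - q) by rewrite mulr_ge0 ?(ltW c0)// subr_ge0 ltW.
have h2 : c * (1 - q) <= 1 by nra.
have h3 : 0 <= (1 - t) * q + t by nra.
have h4 : (1 - t) * q + t <= 1 by nra.
rewrite normrM (gtr0_norm qi0) ler_piMl ?(ltW qi0)// normrN ger0_norm.
  by rewrite mulr_ile1.
by rewrite mulr_ge0.
Qed.

Variable r : R.
Hypothesis qr : (1 - q) ^+ 2 = r * q.

Let rE : r = (1 - q) ^+ 2 / q. Proof. by rewrite qr mulfK. Qed.

Let r_gt0 : 0 < r.
Proof. by rewrite rE divr_gt0// exprn_gt0// subr_gt0. Qed.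

(** Off the centre the sequence is geometric and [2 - q - q^-1 = - r]. At the centre, [peak] is the
    height for which [2 (1 - q) peak = r (1 - peak)]. *)
Lemma laplace_step2 i l : (0 < i)%N ->
  step2 (laplace q i) l = r * ((l.+1 == i)%:R - laplace q i l.+1).
Proof.
move=> i0; rewrite /step2 /laplace.
have [il|li|il] := ltngtP i l.+1; rewrite -?il.
- have -> : gap l.+1 i = (gap l i).+1 by rewrite /gap; lia.
  have -> : gap l.+2 i = (gap l i).+2 by rewrite /gap; lia.
  by rewrite rE /peak !exprS expr0 mulr0n; field; rewrite ?qN0 ?q1N0.
- have -> : gap l i = (gap l.+2 i).+2 by rewrite /gap; lia.
  have -> : gap l.+1 i = (gap l.+2 i).+1 by rewrite /gap; lia.
  by rewrite rE /peak !exprS expr0 mulr0n; field; rewrite ?qN0 ?q1N0.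
- have -> : gap i i = 0%N by rewrite /gap; lia.
  have -> : gap l i = 1%N by rewrite /gap il; lia.
  have -> : gap i.+1 i = 1%N by rewrite /gap; lia.
  by rewrite rE /peak expr0 expr1 mulr1n; field; rewrite ?qN0 ?q1N0.
Qed.

Lemma weight_step2 t i l : (0 < i)%N ->
  step2 (weight q t i) l = r * (two_point t i l.+1 - weight q t i l.+1).
Proof.
move=> i0; rewrite /two_point mulrBr {2}/weight.
have := laplace_step2 l i0; have := laplace_step2 l (ltn0Sn i).
rewrite /step2 /weight => e1 e2.
transitivity ((1 - t) * (2 * laplace q i l.+1 - laplace q i l - laplace q i l.+2)
  + t * (2 * laplace q i.+1 l.+1 - laplace q i.+1 l - laplace q i.+1 l.+2)).
  ring.
by rewrite e1 e2; ring.
Qed.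

(** The difference equation is summed over the nodes: its left side telescopes to boundary values
    and its right side is [r] times the missing mass. *)
Lemma sum_laplace i n : (0 < i <= n)%N ->
  \sum_(k < n) laplace q i k.+1 = 1 - (q ^+ i + q ^+ (n.+1 - i)) / (1 + q).
Proof.
move=> /andP[i0 iN]; have := sum_step2 (laplace q i) n.
rewrite (eq_bigr (fun l : 'I_n => r * ((l.+1 == i)%:R - laplace q i l.+1))).
  rewrite -mulr_sumr sumrB.
  have -> : \sum_(l < n) ((l.+1 == i)%:R : R) = 1.
    have i1n : (i.-1 < n)%N by lia.
    rewrite (bigD1 (Ordinal i1n))//= prednK// eqxx big1 ?addr0// => j ji.
    case: eqP => // ji'; case/eqP: ji; apply/val_inj => /=; lia.
  rewrite /laplace.
  have -> : gap 1 i = i.-1 by rewrite /gap; lia.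
  have -> : gap 0 i = i.-1.+1 by rewrite /gap; lia.
  have -> : gap n.+1 i = (n - i).+1 by rewrite /gap; lia.
  have -> : gap n i = (n - i)%N by rewrite /gap; lia.
  have qi : q ^+ i = q * q ^+ i.-1 by rewrite -exprS prednK.
  rewrite (subSn iN) qi; set S := \sum_(_ < _) _.
  rewrite !exprS => e.
  have {e} : 1 - S = (q * q ^+ i.-1 + q * q ^+ (n - i)) / (1 + q).
    apply: (mulfI (_ : r != 0)); first by rewrite gt_eqF.
    by rewrite e rE /peak; field; rewrite ?qN0 ?q1N0.
  by lra.
by move=> l _; exact: laplace_step2.
Qed.

Lemma sum_laplace_le1 i n : (0 < i <= n)%N -> \sum_(k < n) laplace q i k.+1 <= 1.
Proof.
by move=> /sum_laplace ->; rewrite gerBl divr_ge0// addr_ge0// ?exprn_ge0// ltW.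
Qed.

Lemma sum_laplace_ge i n : (0 < i <= n)%N ->
  1 - q ^+ i - q ^+ (n - i) <= \sum_(k < n) laplace q i k.+1.
Proof.
move=> /[dup] /andP[_ iN] /sum_laplace ->.
have a0 : 0 <= q ^+ i by rewrite ltW// exprn_gt0.
have b0 : 0 <= q ^+ (n - i) by rewrite ltW// exprn_gt0.
rewrite subSn// exprS -addrA -opprD lerD2l lerN2.
move: (q ^+ i) (q ^+ (n - i)) a0 b0 => a b a0 b0.
have [q0' q1'] := andP q01.
by rewrite ler_pdivrMr; nra.
Qed.

End exponential_kernel.

(** * Euclidean norm of the exponential weights *)

Section weight_norm.
Context (R : realType).
Variables (q t : R) (i n : nat).
Hypothesis q01 : 0 < q < 1.
Hypothesis t01 : 0 <= t <= 1.
Hypothesis iN : (0 < i <= n)%N.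

(** This is [peak q ^ 2 / peak (q ^ 2)]: the squared kernel is [s] times the kernel of ratio
    [q ^ 2], so the sum of squares becomes a total mass. *)
Let s : R := (1 - q) * (1 + q ^+ 2) / (1 + q) ^+ 3.

Let laplace_sqr k : laplace q i k ^+ 2 = s * laplace (q ^+ 2) i k.
Proof.
have [q0 q1] := andP q01.
rewrite /laplace exprMn exprAC mulrA; congr (_ * _).
have : 1 - q ^+ 2 != 0 by rewrite gt_eqF// subr_gt0 expr_lt1// ltW.
have : 1 + q ^+ 2 != 0 by rewrite gt_eqF// ltr_pwDl ?sqr_ge0.
rewrite /s /peak => h1 h2; field; rewrite h1 gt_eqF//; lra.
Qed.

Let q201 : 0 < q ^+ 2 < 1.
Proof. by have [q0 q1] := andP q01; rewrite exprn_gt0//= expr_lt1// ltW. Qed.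

Let q2r : (1 - q ^+ 2) ^+ 2 = (1 - q ^+ 2) ^+ 2 / q ^+ 2 * q ^+ 2.
Proof. by rewrite divfK// gt_eqF//; case/andP: q201. Qed.

Let s_gt0 : 0 < s.
Proof.
have [q0 q1] := andP q01; rewrite divr_gt0 ?exprn_gt0 ?mulr_gt0//; try lra.
by rewrite ltr_pwDl ?sqr_ge0.
Qed.

Lemma sum_weight_sqr_le : \sum_(k < n) weight q t i k.+1 ^+ 2 <= q ^- 2 * s.
Proof.
have [q0 q1] := andP q01.
apply: (@le_trans _ _ (q ^- 2 * s * \sum_(k < n) laplace (q ^+ 2) i k.+1)).
  rewrite mulr_sumr; apply: ler_sum => k _; rewrite -mulrA -laplace_sqr -exprVn -exprMn.
  rewrite lerXn2r ?nnegrE ?weight_le//.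
    by rewrite (le_trans _ (weight_ge q01 i k.+1 t01))// mulr_ge0 ?ltW// laplace_gt0.
  by rewrite mulr_ge0 ?invr_ge0 ?ltW// laplace_gt0.
rewrite ler_piMr ?(sum_laplace_le1 q201 q2r)//.
by rewrite mulr_ge0 ?invr_ge0 ?exprn_ge0 ?ltW.
Qed.

Lemma sum_weight_sqr_ge :
  q ^+ 2 * s * (1 - q ^+ i - q ^+ (n - i)) <= \sum_(k < n) weight q t i k.+1 ^+ 2.
Proof.
have [q0 q1] := andP q01.
apply: (@le_trans _ _ (q ^+ 2 * s * \sum_(k < n) laplace (q ^+ 2) i k.+1)).
  have qs : 0 < q ^+ 2 * s by rewrite mulr_gt0// exprn_gt0.
  rewrite ler_pM2l//.
  apply: le_trans (sum_laplace_ge q201 q2r iN).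
  have le k : (q ^+ 2) ^+ k <= q ^+ k.
    by rewrite exprAC expr2 ler_piMl ?exprn_ge0 ?exprn_ile1 ?ltW.
  by have := le i; have := le (n - i)%N; lra.
rewrite mulr_sumr; apply: ler_sum => k _; rewrite -mulrA -laplace_sqr -exprMn.
rewrite lerXn2r ?nnegrE ?weight_ge//; first by rewrite mulr_ge0 ?ltW// laplace_gt0.
by rewrite (le_trans _ (weight_ge q01 i k.+1 t01))// mulr_ge0 ?ltW// laplace_gt0.
Qed.

End weight_norm.

(** * Sine coefficients of Hoelder functions *)

Section shift.
Context (R : realType).
Implicit Types (T f : nat -> R) (B D : R).

(* Summation by parts with step [p]: the shift falls on [f], up to [2 p] boundary
   terms. *)
Lemma shift_sum_le T f n p B D : 0 <= B -> 0 <= D ->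
  (forall k, `|T k| <= 1) -> (forall k, (k < n)%N -> `|f k| <= B) ->
  (forall k, (p + k < n)%N -> `|f (p + k)%N - f k| <= D) ->
  `|\sum_(k < n) (T k - T (p + k)%N) * f k| <= 2 * p%:R * B + n%:R * D.
Proof.
move=> B0 D0 T1 fB fD.
have sumB (r : nat) (F : 'I_r -> R) C : (forall k, `|F k| <= C) -> `|\sum_k F k| <= r%:R * C.
  move=> FC; apply: le_trans (ler_norm_sum _ _ _) _.
  apply: le_trans (ler_sum _ (fun k _ => FC k)) _.
  by rewrite sumr_const card_ord mulr_natl.
(* Without overlap each term is bounded by [2 B], and there are at most [p] terms. *)
have [np|pn] := leqP n p.
  apply: (@le_trans _ _ (n%:R * (2 * B))).
    apply: sumB => k; rewrite normrM; apply: ler_pM => //; last exact: fB.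
    by apply: le_trans (ler_normB _ _) _; have := T1 k; have := T1 (p + k)%N; lra.
  rewrite mulrCA mulrA -[leLHS]addr0 lerD ?mulr_ge0// ler_wpM2r// ler_wpM2l//.
  by rewrite ler_nat.
have [r nE] : {r | n = (p + r)%N} by exists (n - p)%N; rewrite subnKC// ltnW.
rewrite nE in fB fD *.
under eq_bigr do rewrite mulrBl.
(* The shifted sum is cut so that its first [r] terms face the terms of index [p + k] of the other
   sum; the last [p] terms remain as a boundary. *)
rewrite sumrB big_split_ord/= [X in _ - X](_ : _ =
  \sum_(k < r) T (p + k)%N * f k + \sum_(k < p) T (p + (r + k))%N * f (r + k)%N); last first.
  rewrite -(big_mkord xpredT (fun k => T (p + k)%N * f k)) addnC big_mkord.
  by rewrite big_split_ord.
rewrite [X in `|X|](_ : _ = \sum_(k < p) T k * f k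
  + \sum_(k < r) T (p + k)%N * (f (p + k)%N - f k)
  - \sum_(k < p) T (p + (r + k))%N * f (r + k)%N); last first.
  rewrite opprD !addrA; congr (_ - _); rewrite -addrA; congr (_ + _).
  by rewrite -sumrB; apply: eq_bigr => k _; rewrite mulrBr.
have b (u w C : R) : `|u| <= 1 -> `|w| <= C -> `|u * w| <= C.
  by move=> u1 wC; rewrite normrM -[leRHS]mul1r ler_pM.
have h1 : `|\sum_(k < p) T k * f k| <= p%:R * B.
  by apply: sumB => k; apply: b => //; apply: fB; have := ltn_ord k; lia.
have h2 : `|\sum_(k < r) T (p + k)%N * (f (p + k)%N - f k)| <= r%:R * D.
  by apply: sumB => k; apply: b => //; apply: fD; rewrite ltn_add2l.
have h3 : `|\sum_(k < p) T (p + (r + k))%N * f (r + k)%N| <= p%:R * B.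
  by apply: sumB => k; apply: b => //; apply: fB; have := ltn_ord k; lia.
apply: le_trans (ler_normB _ _) _; apply: (@le_trans _ _ (p%:R * B + r%:R * D + p%:R * B)).
  by apply: lerD => //; apply: le_trans (ler_normD _ _) _; exact: lerD.
rewrite natrD; have : 0 <= p%:R * D by rewrite mulr_ge0.
by lra.
Qed.

(* [sin] is an eigenfunction of the second difference of step [p], with an
   eigenvalue at least [2] as soon as [cos (phi * p) <= 0]. *)
Lemma sin_shift_sum_le f (phi : R) n p B D : 0 <= B -> 0 <= D ->
  cos (phi * p%:R) <= 0 ->
  (forall k, (k < n)%N -> `|f k| <= B) ->
  (forall k, (p + k < n)%N -> `|f (p + k)%N - f k| <= D) ->
  `|\sum_(k < n) sin (phi * k.+1%:R) * f k| <= 2 * p%:R * B + n%:R * D.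
Proof.
move=> B0 D0 c0 fB fD; set S := \sum_(_ < _) _.
pose T1 k : R := sin (phi * k.+1%:R).
(* This is [T1] shifted back by [p], written through the phase since [k - p] may be negative;
   [T2 (p + k)] is [T1 k]. *)
pose T2 k : R := sin (phi * k.+1%:R - phi * p%:R).
have h1 := @shift_sum_le T1 f n p B D B0 D0 (fun k => sin_max _) fB fD.
have h2 := @shift_sum_le T2 f n p B D B0 D0 (fun k => sin_max _) fB fD.
have e : (2 - 2 * cos (phi * p%:R)) * S =
    \sum_(k < n) (T1 k - T1 (p + k)%N) * f k - \sum_(k < n) (T2 k - T2 (p + k)%N) * f k.
  rewrite /S mulr_sumr -sumrB; apply: eq_bigr => k _; rewrite /T1 /T2.
  rewrite (_ : phi * (p + k).+1%:R = phi * k.+1%:R + phi * p%:R); last first.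
    by rewrite -addnS natrD; ring.
  by rewrite addrK !sinD sinN cosN; ring.
have : `|2 - 2 * cos (phi * p%:R)| * `|S| <= 2 * (2 * p%:R * B + n%:R * D).
  rewrite -normrM e; apply: le_trans (ler_normB _ _) _; lra.
rewrite ger0_norm; last by lra.
by have := normr_ge0 S; nra.
Qed.

(** The step is the first integer beyond a quarter period. It overshoots by at most one node, a
    phase [phi < pi], so the cosine is still nonpositive there. *)
Lemma freq_shift n j : (j < n)%N ->
  exists2 p : nat, cos (freq R n j * p%:R) <= 0 &
    p%:R <= 2 * nodes R n / j.+1%:R.
Proof.
move=> jn; set phi := freq R n j.
have N0 := nodes_gt0 R n; have pi0 := pi_gt0 R.
have phi0 : 0 < phi by exact: freq_gt0.
have phipi : phi < pi by exact: freq_ltpi.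
have q0 : 0 <= pi / (2 * phi) by apply/ltW; rewrite divr_gt0// mulr_gt0.
have /andP[p1 p2] := truncn_itv q0.
move: (Num.truncn _) p1 p2 => p p1 p2.
exists p.+1.
  rewrite -[p.+1%:R]natr1 in p2 *.
  have phi20 : 0 < 2 * phi by rewrite mulr_gt0.
  move: p1 p2; rewrite ler_pdivlMr// ltr_pdivrMr// => p1 p2.
  rewrite (_ : phi * _ = (phi * (p%:R + 1) - pi / 2) + pi / 2); last by ring.
  rewrite cosDpihalf oppr_le0 sin_ge0_pi//.
  by apply/andP; split; lra.
rewrite -[p.+1%:R]natr1.
have e : pi / (2 * phi) = nodes R n / (2 * j%:R + 1).
  rewrite /phi /freq; move: (pi : R) pi0 (nodes R n) N0 => P P0 N N0'.
  have j0 : 0 <= j%:R :> R by [].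
  by field; rewrite !gt_eqF//; lra.
have j0 : 0 <= j%:R :> R by [].
have jN : j%:R + 1 <= nodes R n.
  have : j.+1%:R <= n%:R :> R by rewrite ler_nat.
  by rewrite /nodes -natr1; lra.
rewrite ler_pdivlMr; last by lra.
move: p1; rewrite e ler_pdivlMr; last by lra.
by move: (p%:R : R) => P; nra.
Qed.

End shift.

(** * Decay of the sine coefficients of a sampled function *)

Section holder.
Context (R : realType).
Implicit Types (alpha : R).

Lemma holder01P alpha (f0 : R -> R) : holder01 alpha f0 ->
  exists2 H : R, 0 <= H & forall s t, 0 <= s <= 1 -> 0 <= t <= 1 ->
    `|f0 s - f0 t| <= H * `|s - t| `^ alpha.
Proof.
rewrite /holder01 => /=; set A := [set EFin r | r in _]; move=> Moo; pose M : \bar R := ereal_sup A.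
(* The maximum with [0] makes the constant nonnegative and excludes [-oo] before [fine] is
   applied. *)
exists (fine (maxe 0%:E M)).
  by apply: fine_ge0; rewrite le_max lexx.
move=> s t s01 t01; have [->|st] := eqVneq s t.
  by rewrite subrr normr0 mulr_ge0 ?powR_ge0// fine_ge0// le_max lexx.
have st0 : 0 < `|s - t| `^ alpha by rewrite powR_gt0// normr_gt0 subr_eq0.
rewrite -ler_pdivrMr// -lee_fin fineK.
  apply: (@le_trans _ _ M); last by rewrite le_max lexx orbT.
  by apply: ereal_sup_ubound; exists (`|f0 s - f0 t| / `|s - t| `^ alpha) => //; exists s, t.
rewrite fin_real//; apply/andP; split; last by rewrite gt_max ltry Moo.
by rewrite lt_max ltNyr.
Qed.

Definition sampled (f0 : R -> R) n (k : nat) : R := f0 (k%:R / nodes R n).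

Lemma node_itv n (k : nat) : (k <= n)%N -> 0 <= k%:R / nodes R n <= 1.
Proof.
move=> kn; rewrite divr_ge0 ?(ltW (nodes_gt0 R n))//= ler_pdivrMr ?nodes_gt0// mul1r.
have : k%:R <= n%:R :> R by rewrite ler_nat.
by rewrite /nodes; lra.
Qed.

(** With a step of order [N / j], the boundary terms are of order [N / j], at most [N j ^ (- alpha)]
    as [alpha <= 1], and the [n] increments are of order [j ^ (- alpha)] each. *)
Lemma holder_wave_coef alpha (f0 : R -> R) (H B : R) n (j : nat) :
  0 < alpha <= 1 -> 0 <= H -> 0 <= B ->
  (forall s t, 0 <= s <= 1 -> 0 <= t <= 1 -> `|f0 s - f0 t| <= H * `|s - t| `^ alpha) ->
  (forall s, 0 <= s <= 1 -> `|f0 s| <= B) -> (j < n)%N ->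
  `|\sum_(k < n) wave R n j k.+1 * sampled f0 n k.+1| <=
  (4 * B + 2 * H) * nodes R n * j.+1%:R `^ (- alpha).
Proof.
move=> /andP[a0 a1] H0 B0 fH fB jn.
have N0 := nodes_gt0 R n.
have [p c0 pN] := @freq_shift R n j jn.
have Ja : 0 < j.+1%:R `^ (- alpha) :> R by rewrite powR_gt0.
have D0 : 0 <= H * (p%:R / nodes R n) `^ alpha by rewrite mulr_ge0 ?powR_ge0.
have fkB k : (k < n)%N -> `|sampled f0 n k.+1| <= B.
  by move=> kn; apply: fB; exact: node_itv.
have fkH k : (p + k < n)%N -> `|sampled f0 n (p + k).+1 - sampled f0 n k.+1| <=
    H * (p%:R / nodes R n) `^ alpha.
  move=> kn; apply: le_trans (fH _ _ (node_itv _) (node_itv _)) _ => //.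
    by rewrite (leq_ltn_trans _ kn)// leq_addl.
  by rewrite -mulrBl -addnS natrD addrK ger0_norm// divr_ge0// ltW.
apply: le_trans (sin_shift_sum_le B0 D0 c0 fkB fkH) _.
have e1 : p%:R * B <= 2 * B * nodes R n * j.+1%:R `^ (- alpha).
  have : j.+1%:R ^-1 <= j.+1%:R `^ (- alpha) :> R.
    by rewrite -powR_inv1// ler_powR ?lerN2// ler1n.
  move=> h; apply: le_trans (ler_wpM2r B0 pN) _.
  have -> : 2 * nodes R n / j.+1%:R * B = 2 * B * nodes R n * j.+1%:R^-1 by ring.
  by rewrite ler_wpM2l// mulr_ge0 ?(ltW N0)// mulr_ge0.
have e2 : (p%:R / nodes R n) `^ alpha <= 2 * j.+1%:R `^ (- alpha).
  have : p%:R / nodes R n <= 2 * j.+1%:R^-1.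
    by rewrite ler_pdivrMr// mulrAC.
  move=> /(ge0_ler_powR (ltW a0)) h; apply: le_trans (h _ _) _.
  - by rewrite nnegrE divr_ge0// ltW.
  - by rewrite nnegrE mulr_ge0.
  rewrite powRM ?invr_ge0// -(powR_inv1 (ler0n _ j.+1)) -powRrM mulN1r.
  by apply: ler_wpM2r; [exact: powR_ge0|apply: ler1_powR => //; rewrite ler1n].
have := ler_wpM2l H0 e2.
have : n%:R <= nodes R n by rewrite /nodes; lra.
move: e1 Ja D0; move: (_ `^ (- alpha)) (_ `^ alpha) => u w e1 u0 w0 nN Hw.
have : n%:R * (H * w) <= nodes R n * (H * (2 * u)) by rewrite ler_pM.
by lra.
Qed.

End holder.

Lemma sum_inv_sqr_le (R : realFieldType) (m n : nat) : (0 < m)%N ->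
  \sum_(j < n | ~~ (j < m)%N) (j.+1%:R ^+ 2)^-1 <= m%:R^-1 :> R.
Proof.
move=> m0; have m0' : 0 < m%:R :> R by rewrite ltr0n.
have [nm|mn] := leqP n m.
  rewrite big1 ?invr_ge0// => j; case/negP; exact: leq_trans (ltn_ord j) nm.
(* A telescoping majorant, by [1 / (k + 1) ^ 2 <= 1 / k - 1 / (k + 1)]. *)
suff h k : (m <= k)%N -> \sum_(j < k | ~~ (j < m)%N) (j.+1%:R ^+ 2)^-1 <=
    m%:R^-1 - k%:R^-1 :> R.
  by apply: le_trans (h n (ltnW mn)) _; rewrite gerBl invr_ge0.
elim: k => [|k IHk]; first by rewrite leqn0 => /eqP m00; rewrite m00 in m0.
rewrite leq_eqVlt => /predU1P[<-|mk].
  by rewrite subrr big1// => j; rewrite ltn_ord.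
rewrite big_mkcond big_ord_recr/= -big_mkcond/= -leqNgt.
have k0 : 0 < k%:R :> R by rewrite ltr0n (leq_trans m0).
rewrite ltnS in mk; rewrite mk; apply: le_trans (lerD (IHk mk) (lexx _)) _.
rewrite -natr1; move: (k%:R : R) k0 => K K0.
have K10 : 0 < K + 1 by lra.
rewrite -subr_ge0 [leRHS](_ : _ = (K * (K + 1) ^+ 2)^-1); last first.
  by field; rewrite !gt_eqF.
by rewrite invr_ge0 mulr_ge0 ?sqr_ge0 ?ltW.
Qed.

(** * Bounds at a fixed point *)

Section sgpr_at_point.
Context (R : realType).
Variables (gamma : R) (n : nat) (mu : 'I_n -> R) (v : 'I_n -> 'cV[R]_n).
Variables (m : nat) (x t : R) (i : nat).
Hypothesis hmu : eigensystem (kmat gamma n) mu v.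
Hypothesis t01 : 0 <= t <= 1.
Hypothesis iN : (0 < i < n)%N.
Hypothesis xE : x * nodes R n = i%:R + t.

Let N0 := nodes_gt0 R n.
Let e := vec (two_point t i) n.

Lemma dot_vec (g f : nat -> R) : dot (vec g n) (vec f n) = \sum_(k < n) g k.+1 * f k.+1.
Proof. by rewrite dotE; apply: eq_bigr => k _; rewrite !mxE. Qed.

Lemma sum_two_point (F : nat -> R) :
  \sum_(k < n) two_point t i k.+1 * F k.+1 = (1 - t) * F i + t * F i.+1.
Proof.
have /andP[i0 iN'] := iN.
have pick j : (0 < j <= n)%N -> \sum_(k < n) (k.+1 == j)%:R * F k.+1 = F j.
  move=> /andP[j0 jn]; have j1n : (j.-1 < n)%N by lia.
  rewrite (bigD1 (Ordinal j1n))//= prednK// eqxx mul1r big1 ?addr0// => k kj.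
  case: eqP => [kj'|]; last by rewrite mul0r.
  by case/eqP: kj; apply/val_inj => /=; lia.
rewrite -(pick i) ?i0 ?(ltnW iN')// -(pick i.+1)// !mulr_sumr -big_split/=.
by apply: eq_bigr => k _; rewrite /two_point; ring.
Qed.

Lemma kvecE (k : 'I_n) :
  kvec gamma n x k 0 = precision gamma n * Num.min (i%:R + t) k.+1%:R.
Proof.
rewrite mxE /bm_kernel /design -/(nodes R n) -xE /precision -mulrA; congr (_ * _).
rewrite minr_pMr ?invr_ge0 ?ltW//; congr Num.min; last by rewrite mulrC.
by rewrite mulrCA mulVf ?mulr1// gt_eqF.
Qed.

(** The kink of [min] in its first argument is at the node [k], so it is affine between [i] and
    [i.+1]. *)
Lemma min_two_point (k : nat) : Num.min (i%:R + t) k%:R =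
  (1 - t) * (minn k i)%:R + t * (minn k i.+1)%:R :> R.
Proof.
have /andP[t0 t1] := t01.
have [ki|ik] := leqP k i.
  have ki' : k%:R <= i%:R :> R by rewrite ler_nat.
  rewrite (minn_idPl (leqW ki)) min_r; [ring|lra].
rewrite (minn_idPr ik) -natr1 min_l; first by ring.
have : i.+1%:R <= k%:R :> R by rewrite ler_nat.
by rewrite -natr1; lra.
Qed.

Lemma kvec_two_point : kvec gamma n x = kmat gamma n *m e.
Proof.
apply/colP => k; rewrite kvecE min_two_point.
rewrite -(sum_two_point (fun l => (minn k.+1 l)%:R)) mulr_sumr mxE.
by apply: eq_bigr => l _; rewrite kmatE mxE -mulrA [two_point _ _ _ * _]mulrC.
Qed.

(** The middle term is the variance [r t (1 - t)] of a Brownian bridge between two neighbouring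
    nodes. *)
Lemma bm_bridge : 0 <= bm_kernel gamma n x x - dot e (kvec gamma n x) <= precision gamma n.
Proof.
have p0 := precision_gt0 gamma n.
have /andP[t0 t1] := t01.
have -> : bm_kernel gamma n x x - dot e (kvec gamma n x) =
    precision gamma n * (t * (1 - t)).
  have -> : dot e (kvec gamma n x) =
      \sum_(k < n) two_point t i k.+1 * (precision gamma n * Num.min (i%:R + t) k.+1%:R).
    by rewrite dotE; apply: eq_bigr => k _; rewrite kvecE mxE.
  rewrite (sum_two_point (fun k => precision gamma n * Num.min (i%:R + t) k%:R)).
  rewrite (_ : bm_kernel _ _ _ _ = precision gamma n * (i%:R + t)); last first.
    by rewrite /bm_kernel minxx -xE /precision -[_ / _ * _]mulrA [(nodes R n)^-1 * _]mulrC mulfK ?gt_eqF.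
  rewrite min_r; last lra.
  rewrite min_l -?natr1; last lra.
  by ring.
have tt : 0 <= t * (1 - t) <= 1 by apply/andP; split; nra.
have /andP[tt0 tt1] := tt.
by rewrite mulr_ge0 ?(ltW p0)//= ler_piMr ?(ltW p0).
Qed.

Lemma dot_two_point_le1 : dot e e <= 1.
Proof.
have /andP[t0 t1] := t01.
rewrite dot_vec (sum_two_point (two_point t i)) /two_point !eqxx.
rewrite (gtn_eqF (ltnSn i)) (ltn_eqF (ltnSn i)) !mulr1n !mulr0n !mulr0 !mulr1 addr0 add0r.
have tt : 0 <= t * (1 - t) by rewrite mulr_ge0// subr_ge0.
by lra.
Qed.

Lemma eigensystem_sup (j k : 'I_n) : v j k 0 ^+ 2 <= 2 / nodes R n.
Proof.
have [s s2 ->] := eigensystem_eigenvector hmu j.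
rewrite !mxE exprMn exprVn s2 invf_div ler_piMr ?divr_ge0 ?(ltW N0)//.
by rewrite /wave sin2cos2 gerBl sqr_ge0.
Qed.

Lemma dot_two_point_sup (j : 'I_n) : dot (v j) e ^+ 2 <= 2 / nodes R n.
Proof.
have /andP[t0 t1] := t01; have /andP[i0 iN'] := iN.
have i1n : (i.-1 < n)%N by lia.
(* The entries of [v j] are extended to [nat] by the default [0], so that [sum_two_point] applies;
   the shift by one passes from nodes to ordinals. *)
pose F (k : nat) : R := if insub k.-1 is Some k' then v j k' 0 else 0.
have F2 k : F k ^+ 2 <= 2 / nodes R n.
  rewrite /F; case: insub => [k'|]; first exact: eigensystem_sup.
  by rewrite expr0n/= divr_ge0// ltW.
have -> : dot (v j) e = \sum_(k < n) two_point t i k.+1 * F k.+1.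
  by rewrite dotE; apply: eq_bigr => k _; rewrite /F/= valK mxE mulrC.
rewrite sum_two_point; have := F2 i; have := F2 i.+1.
move: (F i) (F i.+1) (2 / _) => a b c ac bc.
(* Convexity of the square: this quantity is the gap in Jensen's inequality for [a] and [b]. *)
have : 0 <= t * (1 - t) * (a - b) ^+ 2 by rewrite mulr_ge0 ?sqr_ge0//; nra.
by nra.
Qed.

Lemma mu_le (j : 'I_n) : 0 <= mu j <=
  16 * precision gamma n * nodes R n ^+ 2 / j.+1%:R ^+ 2.
Proof.
have [_ mu0 _ _] := hmu.
by rewrite mu0/= (eigensystem_eigenvalue hmu) bm_eigenvalue_le.
Qed.

Hypothesis m0 : (0 < m)%N.

(** The factor 16 of the eigenvalue bound meets [2 / N] from the squared coefficients of [e], and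
    the inverse squares beyond [m] sum to at most [1 / m]. *)
Lemma variance_tail_le :
  variance_tail mu v m e <= 32 * precision gamma n * nodes R n / m%:R.
Proof.
have p0 := precision_gt0 gamma n.
apply: (@le_trans _ _ (\sum_(j < n | ~~ (j < m)%N)
    32 * precision gamma n * nodes R n * (j.+1%:R ^+ 2)^-1)).
  apply: ler_sum => j _; have /andP[mu0 muj] := mu_le j.
  apply: le_trans (ler_pM mu0 (sqr_ge0 _) muj (dot_two_point_sup j)) _.
  rewrite le_eqVlt; apply/orP; left; apply/eqP.
  have J0 : 0 < j.+1%:R :> R by [].
  by move: (j.+1%:R : R) J0 (nodes R n) N0 => J J0 N N0'; field; rewrite !gt_eqF.
rewrite -mulr_sumr ler_wpM2l ?sum_inv_sqr_le//.
by have [p0' N0'] := (ltW p0, ltW N0); rewrite mulr_ge0// mulr_ge0.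
Qed.

(** The coefficients of [e] and [f] each carry [sqrt (2 / N)]. The decay of those of [f] is frozen
    at its value [m ^ (- alpha)], and the eigenvalues provide the summable inverse squares. *)
Lemma bias_tail_le (alpha F : R) (f : nat -> R) : 0 < alpha -> 0 <= F ->
  (forall j, (j < n)%N -> `|\sum_(k < n) wave R n j k.+1 * f k.+1| <=
     F * nodes R n * j.+1%:R `^ (- alpha)) ->
  `|bias_tail mu v m e (vec f n)| <=
  32 * F * precision gamma n * nodes R n ^+ 2 * m%:R `^ (- alpha) / m%:R.
Proof.
have p0 := precision_gt0 gamma n.
move=> a0 F0 fF; have m0' : 0 < m%:R :> R by rewrite ltr0n.
apply: le_trans (ler_norm_sum _ _ _) _.
apply: (@le_trans _ _ (\sum_(j < n | ~~ (j < m)%N)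
    32 * F * precision gamma n * nodes R n ^+ 2 * m%:R `^ (- alpha) * (j.+1%:R ^+ 2)^-1)).
  apply: ler_sum => j; rewrite -leqNgt => mj; have /andP[mu0 muj] := mu_le j.
  have eta1 : `|eta mu j| <= 1.
    rewrite ger0_norm ?divr_ge0 ?addr_ge0//.
    by rewrite ler_pdivrMr ?mul1r ?lerDl// ltr_pwDl.
  have vf : `|dot (v j) (vec f n)| <=
      Num.sqrt (2 / nodes R n) * (F * nodes R n * m%:R `^ (- alpha)).
    have [s s2 ->] := eigensystem_eigenvector hmu j.
    rewrite dotZl normrM dot_vec; apply: ler_pM => //.
      by rewrite -sqrtr_sqr exprVn s2 invf_div.
    apply: le_trans (fF _ (ltn_ord j)) _; rewrite ler_wpM2l ?mulr_ge0 ?(ltW N0)//.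
    rewrite !powRN lef_pV2 ?posrE ?powR_gt0//.
    by rewrite ge0_ler_powR ?nnegrE ?ler_nat ?(ltW a0)// leqW.
  have ve : `|dot (v j) e| <= Num.sqrt (2 / nodes R n).
    by rewrite -sqrtr_sqr ler_wsqrtr// dot_two_point_sup.
  rewrite normrM (normrM (eta mu j)) (normrM (mu j)) (ger0_norm mu0) -mulrA.
  apply: (@le_trans _ _ (mu j * (Num.sqrt (2 / nodes R n) *
      (Num.sqrt (2 / nodes R n) * (F * nodes R n * m%:R `^ (- alpha)))))).
    rewrite -[leRHS]mul1r ler_pM ?mulr_ge0// -[leLHS]mulrA ler_wpM2l// ler_pM//.
  apply: le_trans (ler_wpM2r _ muj) _.
    by rewrite !mulr_ge0 ?sqrtr_ge0 ?powR_ge0 ?(ltW N0).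
  have S2 : Num.sqrt (2 / nodes R n) ^+ 2 = 2 / nodes R n.
    by rewrite sqr_sqrtr// divr_ge0// ltW.
  rewrite [X in _ * X]mulrA -expr2 S2.
  rewrite le_eqVlt; apply/orP; left; apply/eqP.
  have J0 : 0 < j.+1%:R :> R by [].
  move: (m%:R `^ _) (j.+1%:R : R) J0 (nodes R n) N0 => u J J0 N N0'.
  by field; rewrite !gt_eqF.
rewrite -mulr_sumr ler_wpM2l ?sum_inv_sqr_le//.
by have p0' := ltW p0; rewrite mulr_ge0 ?powR_ge0// mulr_ge0 ?sqr_ge0// mulr_ge0// mulr_ge0.
Qed.

Variable q : R.
Hypothesis q01 : 0 < q < 1.
Hypothesis qr : (1 - q) ^+ 2 = precision gamma n * q.

Let g := weight q t i.

(** The boundary terms of [sum_minn_step2] for the function [weight]. *)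
Definition remainder k : R :=
  weight q t i 0 + k%:R * (weight q t i n.+1 - weight q t i n).

(** [K (step2 g)] is computed twice: as [r (g - remainder)] by the Green identity and as
    [r K (e - g)] by the difference equation. *)
Lemma weight_remainder :
  vec g n + kmat gamma n *m vec g n = kmat gamma n *m e + vec remainder n.
Proof.
have p0 := precision_gt0 gamma n.
have /andP[i0 iN'] := iN.
have h : kmat gamma n *m (\col_l step2 g l) =
    precision gamma n *: (vec g n - vec remainder n).
  apply/colP => k; rewrite kmat_vec_step2 !mxE /remainder /g; ring.
have h2 : (\col_(l < n) step2 g l) = precision gamma n *: (e - vec g n).
  by apply/colP => k; rewrite !mxE /g (weight_step2 q01 qr).
have {h h2}/(scalerI (lt0r_neq0 p0)) h :
    precision gamma n *: (kmat gamma n *m (e - vec g n)) =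
    precision gamma n *: (vec g n - vec remainder n) by rewrite scalemxAr -h2.
have : kmat gamma n *m e - kmat gamma n *m vec g n = vec g n - vec remainder n.
  by rewrite -h mulmxBr.
move: (kmat gamma n *m e) (kmat gamma n *m vec g n) => a b ab.
by rewrite -(subrK b a) ab [RHS]addrAC subrK.
Qed.



(** The factor [sqrt n] between sup norm and Euclidean norm is majorized by [n], which is harmless
    against exponential decay. *)
Lemma remainder_norm : Num.sqrt (dot (vec remainder n) (vec remainder n)) <=
  n%:R * (q ^+ i + n%:R * q ^+ (n - i.+1)).
Proof.
have /andP[i0 iN'] := iN; have /andP[q0 q1] := q01.
have A0 : 0 <= q ^+ i by rewrite exprn_ge0 ?(ltW q0).
have B0 : 0 <= q ^+ (n - i.+1) by rewrite exprn_ge0 ?(ltW q0).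
have n1 : 1 <= n%:R :> R by rewrite ler1n (leq_ltn_trans (leq0n i)).
set S := q ^+ i + _; have S0 : 0 <= S by rewrite addr_ge0 ?mulr_ge0.
have remS k : (k <= n)%N -> `|remainder k| <= S.
  move=> kn; apply: le_trans (ler_normD _ _) _; apply: lerD.
    by have /andP[w0 w1] := weight_end0 q01 i t01; rewrite ger0_norm.
  rewrite normrM ger0_norm// ler_pM ?ler_nat//; exact: (weight_endn q01 t01).
rewrite -[leRHS]ger0_norm ?mulr_ge0// -sqrtr_sqr ler_wsqrtr// dot_vec.
apply: (@le_trans _ _ (\sum_(k < n) S ^+ 2)).
  apply: ler_sum => k _; rewrite -expr2 -real_normK ?num_real//.
  by rewrite lerXn2r ?nnegrE// remS.
rewrite sumr_const card_ord -[leLHS]mulr_natl exprMn ler_wpM2r ?sqr_ge0// expr2.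
by rewrite ler_peMl.
Qed.

End sgpr_at_point.

(** * Linear combinations of Gaussian noise *)

Section gaussian_combination.
Context (R : realType).
Local Notation leb := (@lebesgue_measure R).
Implicit Types (a c s : R) (A : set (measurableTypeR R)).

(** The Radon-Nikodym derivative agrees almost everywhere with [normal_pdf], as both integrate to
    the same value on every measurable set. *)
Lemma integral_normal_prob (m s : R) (f : measurableTypeR R -> \bar R) :
  measurable_fun setT f -> (forall x, (0 <= f x)%E) ->
  (\int[normal_prob m s]_x f x = \int[leb]_x (f x * (normal_pdf m s x)%:E))%E.
Proof.
move=> mf f0; have dom := normal_prob_dominates m s.
rewrite -(Radon_Nikodym_SigmaFinite.change_of_variables dom f0)//.
have mpdf : measurable_fun [set: measurableTypeR R] (fun x => (normal_pdf m s x)%:E).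
  apply/measurable_EFinP. exact: measurable_normal_pdf.
have intRN := Radon_Nikodym_SigmaFinite.f_integrable dom.
apply: ae_eq_integral => //.
- by apply: emeasurable_funM => //; exact: (measurable_int _ intRN).
- exact: emeasurable_funM.
apply: ae_eqe_mul2l; apply: integral_ae_eq => //.
by move=> E _ mE; rewrite -(Radon_Nikodym_SigmaFinite.f_integral dom).
Qed.

Definition affine a c (y : measurableTypeR R) : measurableTypeR R := a * y + c.

Lemma measurable_affine a c : measurable_fun setT (affine a c).
Proof.
have : measurable_fun [set: R] (fun y : R => a * y + c).
  by apply: measurable_funD => //; exact: measurable_funM.
by [].
Qed.

Definition affine_image a c : {measure set (measurableTypeR R) -> \bar R}.
Proof. refine (pushforward leb (affine a c)); exact: measurable_affine. Defined.

(** By uniqueness of Lebesgue measure it suffices to treat half-open intervals; for negative [a] the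
    preimage is closed on the other side and has the same length. *)
Lemma lebesgue_affine a c A : a != 0 -> measurable A ->
  leb A = mscale (`|a|%:nng)%R (affine_image a c) A.
Proof.
move=> a0; apply: lebesgue_measure_unique => X [[b d] _ <-] /=.
have aa0 : 0 < `|a| by rewrite normr_gt0.
rewrite /mscale/= /pushforward lebesgue_measure_itv/=.
have [apos|aneg] := ltP 0 a.
  have -> : affine a c @^-1` `]b, d]%classic = `](b - c) / a, (d - c) / a]%classic.
    apply/seteqP; split => y; rewrite /affine/= !in_itv/=.
      by rewrite ltr_pdivrMr// ler_pdivlMr// !(mulrC y) ltrBlDr lerBrDr.
    by rewrite ltr_pdivrMr// ler_pdivlMr// !(mulrC y) ltrBlDr lerBrDr.
  rewrite lebesgue_measure_itv/= !lte_fin ltr_pM2r ?invr_gt0// ltrD2r.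
  case: ifP => _; last by rewrite mule0.
  by rewrite -!EFinB -EFinM gtr0_norm// -mulrBl mulrC divfK ?gt_eqF// opprB addrA subrK.
have {}aneg : a < 0 by rewrite lt_neqAle a0.
have -> : affine a c @^-1` `]b, d]%classic = `[(d - c) / a, (b - c) / a[%classic.
  apply/seteqP; split => y; rewrite /affine/= !in_itv/=.
    by rewrite ler_ndivrMr// ltr_ndivlMr// !(mulrC y) ltrBlDr lerBrDr andbC.
  by rewrite ler_ndivrMr// ltr_ndivlMr// !(mulrC y) ltrBlDr lerBrDr andbC.
rewrite lebesgue_measure_itv/= !lte_fin ltr_nM2r ?invr_lt0// ltrD2r.
case: ifP => _; last by rewrite mule0.
rewrite -!EFinB -EFinM ltr0_norm// -mulrBl mulNr mulrC divfK ?lt_eqF//.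
by congr EFin; ring.
Qed.

Lemma integral_affine a c A (f : measurableTypeR R -> \bar R) : a != 0 ->
  measurable A -> measurable_fun A f -> (forall x, (0 <= f x)%E) ->
  (\int[leb]_(w in A) f w =
   `|a|%:E * \int[leb]_(y in affine a c @^-1` A) f (affine a c y))%E.
Proof.
move=> a0 mA mf f0.
rewrite (eq_measure_integral (mscale (`|a|%:nng)%R (affine_image a c))); last first.
  by move=> B mB _; exact: lebesgue_affine.
rewrite ge0_integral_mscale//; congr (_ * _)%E.
by rewrite ge0_integral_pushforward//; exact: measurable_affine.
Qed.

Lemma normal_prob_affine (m s a c : R) A : a != 0 -> s != 0 -> measurable A ->
  normal_prob m s (affine a c @^-1` A) = normal_prob (a * m + c) (a * s) A.
Proof.
move=> a0 s0 mA; rewrite /normal_prob (integral_affine c a0 mA)//; last first.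
- by move=> x; rewrite lee_fin normal_pdf_ge0.
- apply/measurable_EFinP; apply: measurable_funTS; exact: measurable_normal_pdf.
have mpA : measurable (affine a c @^-1` A).
  by rewrite -[X in measurable X]setTI; exact: measurable_affine.
rewrite -ge0_integralZl//.
- apply: eq_integral => y _; rewrite -EFinM !normal_pdfE ?mulf_neq0//.
  congr EFin; rewrite mulrA; congr (_ * _).
    rewrite /normal_peak (_ : (a * s) ^+ 2 * pi *+ 2 = a ^+ 2 * (s ^+ 2 * pi *+ 2)).
      by rewrite sqrtrM ?sqr_ge0// sqrtr_sqr invfM mulrA divff ?mul1r ?normr_eq0.
    by rewrite exprMn; ring.
  rewrite /normal_fun /affine; congr expR.
  by field; rewrite s0 a0.
- apply/measurable_EFinP; apply: measurable_funTS.
  by apply: measurableT_comp; [exact: measurable_normal_pdf|exact: measurable_affine].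
- by move=> x _; rewrite lee_fin normal_pdf_ge0.
Qed.

Lemma normal_pdf_shift (m s x : R) : s != 0 ->
  normal_pdf m s x = normal_pdf 0 s (x - m).
Proof. by move=> s0; rewrite !normal_pdfE// /normal_fun subr0. Qed.

(* Completing the square. *)
Lemma normal_pdfM (a s x w : R) : s != 0 ->
  let S := Num.sqrt (a ^+ 2 + s ^+ 2) in
  normal_pdf (a * x) s w * normal_pdf 0 1 x =
  normal_pdf 0 S w * normal_pdf (a * w / S ^+ 2) (s / S) x.
Proof.
move=> s0 S; have s20 : 0 < s ^+ 2 by rewrite exprn_even_gt0.
have T0 : 0 < a ^+ 2 + s ^+ 2 by rewrite ltr_wpDl// sqr_ge0.
have S0 : 0 < S by rewrite sqrtr_gt0.
have ST : S ^+ 2 = a ^+ 2 + s ^+ 2 by rewrite sqr_sqrtr// ltW.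
rewrite !normal_pdfE ?oner_eq0 ?mulf_neq0 ?invr_eq0 ?(gt_eqF S0)//.
rewrite mulrACA [RHS]mulrACA; congr (_ * _).
  have h (u : R) : 0 <= u ^+ 2 * pi *+ 2.
    by rewrite mulrn_wge0// mulr_ge0 ?sqr_ge0 ?pi_ge0.
  rewrite /normal_peak -!invfM -!sqrtrM//.
  congr (Num.sqrt _)^-1; rewrite exprMn exprVn.
  by field; rewrite gt_eqF.
rewrite /normal_fun -!expRD; congr expR.
rewrite exprMn exprVn ST; have [T TE] : exists T, T = a ^+ 2 + s ^+ 2 by exists (a ^+ 2 + s ^+ 2).
rewrite -TE in T0 *; have sE : s ^+ 2 = T - a ^+ 2 by rewrite TE; ring.
have Ta : T - a ^+ 2 != 0 by rewrite -sE gt_eqF.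
by rewrite sE; field; rewrite Ta gt_eqF.
Qed.

(** Tonelli exchanges the integrals; after completing the square the inner integrand is a normal
    density in [x], of mass one. *)
Lemma normal_prob_convolution (a s : R) A : s != 0 -> measurable A ->
  (\int[leb]_x (normal_prob (a * x) s A * (normal_pdf 0 1 x)%:E) =
   normal_prob 0 (Num.sqrt (a ^+ 2 + s ^+ 2)) A)%E.
Proof.
move=> s0 mA.
pose f (z : measurableTypeR R * measurableTypeR R) : \bar R :=
  (\1_A z.2 * (normal_pdf 0 s (z.2 - a * z.1) * normal_pdf 0 1 z.1))%:E.
have f0 z : (0 <= f z)%E by rewrite lee_fin !mulr_ge0// normal_pdf_ge0.
have mf : measurable_fun setT f.
  apply/measurable_EFinP; apply: measurable_funM.
    by apply: measurableT_comp => //.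
  apply: measurable_funM; last by apply: measurableT_comp => //; exact: measurable_normal_pdf.
  apply: measurableT_comp; first exact: measurable_normal_pdf.
  have : measurable_fun [set: measurableTypeR R * measurableTypeR R]
     (fun z => (z.2 : R) - a * (z.1 : R)).
    by apply: measurable_funB => //; apply: measurable_funM.
  by [].
transitivity (\int[leb]_x \int[leb]_w f (x, w))%E.
  apply: eq_integral => x _; rewrite /normal_prob.
  rewrite -ge0_integralZr//; first last.
  - by rewrite lee_fin normal_pdf_ge0.
  - by move=> w _; rewrite lee_fin normal_pdf_ge0.
  - by apply/measurable_EFinP; apply: measurable_funTS; exact: measurable_normal_pdf.
  rewrite [LHS]integral_mkcond; apply: eq_integral => w _.
  rewrite patchE /f/= indicE normal_pdf_shift//.
  by case: ifPn => wA; rewrite ?mul1r ?mul0r// EFinM.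
rewrite fubini_tonelli// /normal_prob [RHS]integral_mkcond.
have S0 : Num.sqrt (a ^+ 2 + s ^+ 2) != 0.
  by rewrite gt_eqF// sqrtr_gt0 ltr_wpDl ?sqr_ge0// exprn_even_gt0.
apply: eq_integral => w _; rewrite patchE.
pose S := Num.sqrt (a ^+ 2 + s ^+ 2).
transitivity (\int[leb]_x ((\1_A w * normal_pdf 0 S w)%:E *
    (normal_pdf (a * w / S ^+ 2) (s / S) x)%:E))%E.
  apply: eq_integral => x _; rewrite /f/= -EFinM; congr EFin.
  by rewrite -[RHS]mulrA -normal_pdf_shift// normal_pdfM.
rewrite ge0_integralZl//; first last.
- by rewrite lee_fin mulr_ge0// normal_pdf_ge0.
- by move=> x _; rewrite lee_fin normal_pdf_ge0.
- by apply/measurable_EFinP; exact: measurable_normal_pdf.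
rewrite integral_normal_pdf mule1 indicE.
by case: ifPn => wA; rewrite ?mul1r ?mul0r.
Qed.

Lemma normal_prob_norm (m s : R) : s != 0 -> normal_prob m s = normal_prob m `|s|.
Proof.
move=> s0; apply/funext => A; apply: eq_integral => x _; congr EFin.
by rewrite !normal_pdfE ?normr_eq0// /normal_peak /normal_fun real_normK ?num_real.
Qed.

Definition combination n (w : 'I_n -> R) (t : n.-tuple (measurableTypeR R)) :
  measurableTypeR R := \sum_(i < n) w i * (tnth t i : R).

Lemma measurable_combination n (w : 'I_n -> R) : measurable_fun setT (combination w).
Proof.
have : measurable_fun setT (fun t : n.-tuple (measurableTypeR R) =>
    \sum_(i < n) w i * (tnth t i : R)).
  apply: measurable_sum => i; apply: measurable_funM => //.
  exact: measurable_tnth.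
by [].
Qed.

Lemma combination_cons n (w : 'I_n.+1 -> R) (p : measurableTypeR R * n.-tuple (measurableTypeR R)) :
  combination w (cons_pair p) =
  affine 1 (w ord0 * p.1) (combination (fun i => w (lift ord0 i)) p.2).
Proof.
rewrite /combination big_ord_recl /affine mul1r addrC; congr (_ + _).
by apply: eq_bigr => i _; rewrite tnthS.
Qed.

(** Given the first coordinate, the combination is normal with a shifted mean by induction, and
    integrating over that coordinate is a convolution. *)
Lemma iid_normal_combination n (w : 'I_n -> R) A :
  0 < \sum_i w i ^+ 2 -> measurable A ->
  iid_law (std_normal R) n (combination w @^-1` A) =
  normal_prob 0 (Num.sqrt (\sum_i w i ^+ 2)) A.
Proof.
elim: n w A => [|n IHn] w A; first by rewrite big_ord0 ltxx.
move=> w0 mA.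
pose w' i := w (lift ord0 i); pose s := Num.sqrt (\sum_i w' i ^+ 2).
have mcomb := measurable_combination.
have pre0 : 0 <= \sum_i w' i ^+ 2 by apply: sumr_ge0 => i _; rewrite sqr_ge0.
have sumE : \sum_i w i ^+ 2 = w ord0 ^+ 2 + \sum_i w' i ^+ 2 by rewrite big_ord_recl.
rewrite /= /distribution /pushforward.
(* If the other weights vanish, the conditional law is a point mass, to which the convolution of
   densities does not apply; the combination is then affine in the first coordinate. *)
have [w'0|w'0] := eqVneq (\sum_i w' i ^+ 2) 0.
  have w'z i : w' i = 0.
    apply/eqP; rewrite -sqrf_eq0; apply/eqP.
    apply: (psumr_eq0P _ w'0) => // j _; exact: sqr_ge0.
  have w00 : w ord0 != 0 by move: w0; rewrite sumE w'0 addr0; case: eqVneq => // ->; rewrite expr0n ltxx.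
  rewrite sumE w'0 addr0 sqrtr_sqr -normal_prob_norm//.
  have -> : @cons_pair _ _ n @^-1` (combination w @^-1` A) = (affine (w ord0) 0 @^-1` A) `*` setT.
    apply/seteqP; split => -[x t]; rewrite /= combination_cons/=.
      rewrite /affine /combination big1 ?mulr0 ?add0r ?addr0// => i _.
      by rewrite -/(w' i) w'z mul0r.
    rewrite /affine /combination big1 ?mulr0 ?add0r ?addr0; first by case.
    by move=> i _; rewrite -/(w' i) w'z mul0r.
  rewrite product_measure1E//; last first.
    by rewrite -[X in measurable X]setTI; exact: measurable_affine.
  transitivity (normal_prob 0 1 (affine (w ord0) 0 @^-1` A) * 1)%E.
    by congr (_ * _)%E; exact: (probability_setT (iid_law (std_normal R) n)).
  rewrite mule1 normal_prob_affine ?oner_eq0//.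
  by rewrite mulr0 addr0 mulr1.
have s2 : s ^+ 2 = \sum_i w' i ^+ 2 by rewrite sqr_sqrtr.
have s0 : s != 0 by rewrite -sqrf_eq0 s2.
have xs x : iid_law (std_normal R) n
    (xsection (@cons_pair _ _ n @^-1` (combination w @^-1` A)) x) =
    normal_prob (w ord0 * x) s A.
  have -> : xsection (@cons_pair _ _ n @^-1` (combination w @^-1` A)) x =
      combination w' @^-1` (affine 1 (w ord0 * x) @^-1` A).
    by apply/seteqP; split => t; rewrite /xsection/= inE/= combination_cons.
  rewrite IHn.
  - rewrite normal_prob_affine ?oner_eq0//.
    by rewrite mulr0 add0r mul1r.
  - by rewrite lt_neqAle eq_sym w'0.
  - by rewrite -[X in measurable X]setTI; exact: measurable_affine.
rewrite /product_measure1.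
have mpre : measurable (@cons_pair _ _ n @^-1` (combination w @^-1` A)).
  rewrite -comp_preimage -[X in measurable X]setTI.
  by apply: (measurableT_comp (mcomb _ w) (@measurable_cons_pair _ _ n)).
rewrite integral_normal_prob.
- rewrite sumE -s2 -normal_prob_convolution//.
  by apply: eq_integral => x _; rewrite /= xs.
- exact: measurable_fun_xsection.
- by move=> x; exact: measure_ge0.
Qed.

End gaussian_combination.

(** * Gaussian mass of intervals *)

Section gaussian_interval.
Context (R : realType).
Local Notation leb := (@lebesgue_measure R).
Local Notation gauss := (std_normal R).
Local Notation pdf := (normal_pdf (0 : R) 1).
Implicit Types (a b M : R).

Definition Phi b : R := fine (gauss `]-oo, b]%classic).

Let gauss_fin (A : set (measurableTypeR R)) : measurable A -> gauss A \is a fin_num.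
Proof. by move=> mA; exact: fin_num_measure. Qed.

Let gauss_oc a b : a <= b -> gauss `]a, b]%classic = (Phi b - Phi a)%:E.
Proof.
move=> ab; have -> : Phi b - Phi a = fine (gauss `]a, b]%classic).
  apply/eqP; rewrite subr_eq addrC; apply/eqP.
  rewrite /Phi (_ : `]-oo, b]%classic = `]-oo, a] `|` `]a, b]).
    rewrite measureU//; last first.
      by apply/seteqP; split => // y [] /=; rewrite !in_itv/=; lra.
    by rewrite fineD// gauss_fin.
  by rewrite -itv_bndbnd_setU// bnd_simp.
by rewrite fineK// gauss_fin.
Qed.

Let gauss_cc a b : gauss `[a, b]%classic = gauss `]a, b]%classic.
Proof.
apply/esym; apply: integral_itv_obnd_cbnd.
by apply/measurable_EFinP; apply: measurable_funTS; exact: measurable_normal_pdf.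
Qed.

Lemma normal_prob_itv a b : a <= b -> gauss `[a, b]%classic = (Phi b - Phi a)%:E.
Proof. by move=> ab; rewrite gauss_cc gauss_oc. Qed.

Let lebesgue_itv_oc a b : a <= b -> leb `]a, b]%classic = (b - a)%:E.
Proof.
rewrite le_eqVlt => /predU1P[->|ab].
  by rewrite set_itvoc0 measure0 subrr.
by rewrite lebesgue_measure_itv/= lte_fin ab EFinB.
Qed.

Lemma Phi_diff_le a b M : a <= b -> (forall x, a < x <= b -> pdf x <= M) ->
  Phi b - Phi a <= M * (b - a).
Proof.
move=> ab pdfM; rewrite -lee_fin -gauss_oc//.
apply: (@le_trans _ _ (\int[leb]_(x in `]a, b]) M%:E)%E).
  apply: ge0_le_integral => //.
  - by move=> x _; rewrite lee_fin normal_pdf_ge0.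
  - by apply/measurable_EFinP; apply: measurable_funTS; exact: measurable_normal_pdf.
by rewrite integral_cst//= lebesgue_itv_oc// EFinM.
Qed.

Lemma Phi_diff_ge a b M : 0 <= M -> a <= b -> (forall x, a < x <= b -> M <= pdf x) ->
  M * (b - a) <= Phi b - Phi a.
Proof.
move=> M0 ab pdfM; rewrite -lee_fin -gauss_oc//.
apply: (@le_trans _ _ (\int[leb]_(x in `]a, b]) M%:E)%E); last first.
  apply: ge0_le_integral => //.
  - by apply/measurable_EFinP; apply: measurable_funTS; exact: measurable_normal_pdf.
by rewrite [X in (_ <= X)%E]integral_cst/= ?lebesgue_itv_oc// EFinM.
Qed.

Lemma Phi_le a b : a <= b -> Phi a <= Phi b.
Proof.
move=> ab; rewrite -subr_ge0; have := @Phi_diff_ge a b 0; rewrite mul0r; apply => //.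
by move=> x _; exact: normal_pdf_ge0.
Qed.

(** The bound on the density by its peak makes [Phi] Lipschitz. *)
Lemma continuous_Phi : continuous Phi.
Proof.
have pk : 0 < normal_peak 1 :> R by rewrite normal_peak_gt0.
have lip a b : `|Phi a - Phi b| <= normal_peak 1 * `|a - b|.
  wlog ab : a b / a <= b.
    by move=> H; have [/H//|/ltW/H] := leP a b; rewrite distrC (distrC a).
  rewrite distrC (distrC a) !ger0_norm ?subr_ge0 ?Phi_le//.
  by apply: Phi_diff_le => // x _; apply: normal_pdf_ub; rewrite oner_eq0.
move=> x; apply/cvgrPdist_le => e e0; near=> y.
apply: le_trans (lip _ _) _; rewrite mulrC -ler_pdivlMr//.
near: y; apply: cvgr_dist_le; first exact: cvg_id.
by rewrite divr_gt0.
Unshelve. all: by end_near. Qed.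

Lemma normal_prob_itv_cvg (lo hi : nat -> R) a b :
  (\forall n \near \oo, lo n <= hi n) ->
  lo n @[n --> \oo] --> a -> hi n @[n --> \oo] --> b ->
  gauss `[lo n, hi n]%classic @[n --> \oo] --> (Phi b - Phi a)%:E.
Proof.
move=> lohi loa hib.
have : (Phi (hi n) - Phi (lo n))%:E @[n --> \oo] --> (Phi b - Phi a)%:E.
  apply: cvg_EFin; first by near=> n.
  apply: cvgB; [apply: (cvg_comp hi Phi hib)|apply: (cvg_comp lo Phi loa)];
    exact: continuous_Phi.
apply: cvg_trans; apply: near_eq_cvg; near=> n.
by rewrite normal_prob_itv//; near: n.
Unshelve. all: by end_near. Qed.

(** From [1 + u <= exp u]. This polynomial decay is enough for an interval of bounded length that
    drifts to infinity. *)
Lemma pdf_le x : pdf x <= normal_peak 1 / (1 + x ^+ 2 / 2).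
Proof.
rewrite normal_pdfE ?oner_eq0// ler_pM2l ?normal_peak_gt0 ?oner_eq0//.
rewrite /normal_fun subr0 expr1n mulNr expRN lef_pV2 ?posrE ?expR_gt0//.
  exact: expR_ge1Dx.
by rewrite ltr_pwDl// divr_ge0// sqr_ge0.
Qed.

Lemma Phi_diff_neg_le a b : a <= b -> b <= 0 ->
  Phi b - Phi a <= normal_peak 1 / (1 + b ^+ 2 / 2) * (b - a).
Proof.
move=> ab b0; apply: Phi_diff_le => // x /andP[ax xb].
apply: le_trans (pdf_le x) _.
have h y : 0 < 1 + y ^+ 2 / 2 :> R by rewrite ltr_pwDl// divr_ge0// sqr_ge0.
rewrite ler_pM2l ?normal_peak_gt0 ?oner_eq0// lef_pV2 ?posrE ?h//.
by rewrite lerD2l ler_pM2r// -[leLHS]sqrrN -[leRHS]sqrrN lerXn2r ?nnegrE; lra.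
Qed.

Lemma Phi_diff_gt a b : a < b -> Phi a < Phi b.
Proof.
move=> ab; rewrite -subr_gt0.
(* On the interval the density is smallest at the endpoint of largest modulus, and is at least [M]
   there. *)
pose K := Num.max `|a| `|b|.
pose M := normal_peak 1 * expR (- (K ^+ 2) / 2) : R.
have M0 : 0 < M by rewrite mulr_gt0 ?expR_gt0// normal_peak_gt0// oner_eq0.
apply: lt_le_trans (Phi_diff_ge (ltW M0) (ltW ab) _); first by rewrite mulr_gt0// subr_gt0.
move=> x /andP[ax xb]; rewrite normal_pdfE ?oner_eq0// ler_pM2l ?normal_peak_gt0 ?oner_eq0//.
rewrite /normal_fun subr0 expr1n ler_expR -mulr_natl mulr1 ler_pM2r ?invr_gt0// lerN2.
rewrite -[leLHS]real_normK ?num_real// lerXn2r ?nnegrE// ?le_max ?normr_ge0//.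
have [x0|x0] := leP 0 x.
  by rewrite (ger0_norm x0) (ger0_norm (le_trans x0 xb)) xb orbT.
by rewrite (ltr0_norm x0) (ltr0_norm (lt_trans ax x0)) lerN2 (ltW ax).
Qed.

End gaussian_interval.

(** * Coverage as a Gaussian mass *)

Section coverage_gaussian.
Context (R : realType).

Lemma normal_abs_leE (s z : R) : 0 < s -> 0 <= z ->
  normal_prob 0 s [set t | `|t| <= z] = (Phi (z / s) - Phi (- (z / s)))%:E.
Proof.
move=> s0 z0; have zs0 : 0 <= z / s by rewrite divr_ge0 ?(ltW s0).
have zs : - (z / s) <= z / s by lra.
rewrite -normal_prob_itv//.
have -> : [set t : R | `|t| <= z] = `[- z, z]%classic.
  by apply/seteqP; split => t /=; rewrite in_itv/= ler_norml.
have -> : `[- (z / s), z / s]%classic = affine s 0 @^-1` `[- z, z]%classic.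
  apply/seteqP; split => t /=; rewrite /affine !in_itv/= addr0 -mulNr;
  by rewrite ler_pdivrMr// ler_pdivlMr// mulrC.
rewrite /std_normal [RHS]normal_prob_affine ?gt_eqF ?oner_eq0//.
by rewrite mulr0 addr0 mulr1.
Qed.

(** The posterior mean is [f0 x] plus the bias plus [s] times a unit combination of the noise, which
    is standard normal; covering [f0 x] is a two-sided condition on that combination. *)
Lemma coverageE (gamma : R) n (mu : 'I_n -> R) (v : 'I_n -> 'cV[R]_n) m (z x : R)
    (f0 : R -> R) (e : 'cV[R]_n) :
  eigensystem (kmat gamma n) mu v -> kvec gamma n x = kmat gamma n *m e ->
  let w := sgpr_weights mu v m e in
  let s := Num.sqrt (dot w w) in
  let b := dot w (\col_i f0 (design R i)) - f0 x in
  let sd := sgpr_sd gamma mu v m x in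
  0 < s ->
  coverage gamma mu v m z x f0 =
  std_normal R `[(- z * sd - b) / s, (z * sd - b) / s]%classic.
Proof.
move=> hmu ke w s b sd s0.
have s2 : s ^+ 2 = dot w w.
  by rewrite sqr_sqrtr// dotE sumr_ge0// => i _; rewrite -expr2 sqr_ge0.
pose w' i := w i 0 / s.
have w'1 : \sum_i w' i ^+ 2 = 1.
  rewrite /w'; under eq_bigr do rewrite exprMn exprVn.
  rewrite -mulr_suml s2 dotE (eq_bigr (fun i => w i 0 ^+ 2)).
    have : s ^+ 2 != 0 by rewrite expf_neq0// gt_eqF.
    rewrite s2 dotE (eq_bigr (fun i => w i 0 ^+ 2)); first exact: divff.
    by move=> i _; rewrite expr2.
  by move=> i _; rewrite expr2.
transitivity (iid_law (std_normal R) n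
    (combination w' @^-1` `[(- z * sd - b) / s, (z * sd - b) / s]%classic)).
  rewrite /coverage /obs_law /distribution /pushforward; congr (iid_law _ _ _).
  have key (y : R) : (y \in `[(- z * sd - b) / s, (z * sd - b) / s]) =
      (f0 x \in `[s * y + b + f0 x - z * sd, s * y + b + f0 x + z * sd]).
    rewrite !in_itv/= ler_pdivrMr// ler_pdivlMr// mulrC andbC.
    by congr (_ && _); apply/idP/idP; lra.
  have mE t : sgpr_mean gamma mu v m (observation f0 t) x =
      s * combination w' t + b + f0 x.
    rewrite (sgpr_meanE m hmu ke) -/w /b -[RHS]addrA subrK.
    have -> : \col_i tnth (observation f0 t) i =
        \col_i (tnth t i : R) + \col_i f0 (design R i).
      by apply/colP => i; rewrite !mxE tnth_mktuple addrC.
    rewrite dotDr; congr (_ + _); rewrite dotE /combination mulr_sumr.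
    by apply: eq_bigr => i _; rewrite mxE /w' mulrA mulrCA divff ?mulr1 ?gt_eqF// mulrC.
  apply/seteqP; split => t; rewrite /credible_interval /= mE -/sd.
    by rewrite -key.
  by rewrite -key.
rewrite iid_normal_combination ?w'1 ?sqrtr1 ?ltr01//.
Qed.

End coverage_gaussian.

(** * Limits and Riemann sums *)

Section null_sequences.
Context (R : realType).
Implicit Types u w c : nat -> R.

Lemma cvg0_norm_le u w : (\forall n \near \oo, `|u n| <= w n) ->
  w n @[n --> \oo] --> (0 : R) -> u n @[n --> \oo] --> (0 : R).
Proof.
move=> uw w0; apply/cvgrPdist_le => e e0; near=> n.
rewrite sub0r normrN; apply: (@le_trans _ _ (w n)); first by near: n.
by near: n; apply: cvgr_le w0 _ _.
Unshelve. all: by end_near. Qed.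

Lemma cvg0_powR u (a : R) : 0 < a -> (\forall n \near \oo, 0 < u n) ->
  u n @[n --> \oo] --> (0 : R) -> u n `^ a @[n --> \oo] --> (0 : R).
Proof.
move=> a0 upos u0; apply/cvgrPdist_le => e e0; near=> n.
have un0 : 0 < u n by near: n.
rewrite sub0r normrN ger0_norm ?powR_ge0//.
have -> : e = (e `^ a^-1) `^ a by rewrite -powRrM mulVf ?gt_eqF// powRr1// ltW.
rewrite ge0_ler_powR ?nnegrE ?powR_ge0 ?(ltW a0) ?(ltW un0)//.
by near: n; apply: cvgr_le u0 _ _; rewrite powR_gt0.
Unshelve. all: by end_near. Qed.

Lemma cvg_sub_div u w c (l : R) : (u n - w n) / c n @[n --> \oo] --> (0 : R) ->
  w n / c n @[n --> \oo] --> l -> u n / c n @[n --> \oo] --> l.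
Proof.
move=> uw wl; have : (u n - w n) / c n + w n / c n @[n --> \oo] --> l.
  by rewrite -[l]add0r; exact: cvgD uw wl.
by apply: cvg_trans; apply: near_eq_cvg; near=> n; rewrite -mulrDl subrK.
Unshelve. all: by end_near. Qed.

End null_sequences.

Section power_increments.
Context (R : realType).
Implicit Types a x y : R.

(** A ratio [u / (x + y)] in [[0, 1]] is at most its own power of exponent [a <= 1]; the two ratios
    sum to one. *)
Lemma powR_subadd a x y : 0 < a <= 1 -> 0 <= x -> 0 <= y ->
  (x + y) `^ a <= x `^ a + y `^ a.
Proof.
move=> /andP[a0 a1] x0 y0; have [xy|xy] := eqVneq (x + y) 0.
  by rewrite xy powR0 ?gt_eqF// addr_ge0// powR_ge0.
have xy0 : 0 < x + y by rewrite lt_neqAle eq_sym xy addr_ge0.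
have h u : 0 <= u -> u <= x + y -> u / (x + y) * (x + y) `^ a <= u `^ a.
  rewrite le_eqVlt => /predU1P[<- _|u0 uxy]; first by rewrite mul0r mul0r powR_ge0.
  have uz : 0 <= u / (x + y) by rewrite ltW// divr_gt0.
  have {2}-> : u = u / (x + y) * (x + y) by rewrite divfK.
  rewrite powRM ?(ltW xy0)// ler_wpM2r ?powR_ge0// ger1_powR// divr_gt0//=.
  by rewrite ler_pdivrMr// mul1r.
have := lerD (h x x0 _) (h y y0 _); rewrite -!mulrDl divff// mul1r; apply; lra.
Qed.

Lemma powR_dist_le a x y : 0 < a <= 1 -> 0 <= x -> 0 <= y ->
  `|x `^ a - y `^ a| <= `|x - y| `^ a.
Proof.
move=> a01; have /andP[a0 _] := a01.
wlog xy : x y / x <= y.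
  by move=> H x0 y0; have [/H->//|/ltW/H h] := leP x y; rewrite distrC (distrC x) h.
move=> x0 y0; rewrite distrC (distrC x) ger0_norm; last first.
  by rewrite subr_ge0 ge0_ler_powR ?nnegrE ?(ltW a0).
rewrite ger0_norm ?subr_ge0// lerBlDl.
have {1}-> : y = x + (y - x) by ring.
by rewrite powR_subadd// subr_ge0.
Qed.

End power_increments.

(** * Riemann sums for the Gamma integral *)

Section riemann_sum.
Context (R : realType) (alpha : R).
Hypothesis a01 : 0 < alpha <= 1.
Local Notation leb := (@lebesgue_measure R).

(** The integrand of [Gamma (alpha + 1)]; moments of order [alpha] of the exponential kernel are
    Riemann sums of it. *)
Definition gamma_density (s : R) : R := s `^ alpha * expR (- s).
Local Notation f := gamma_density.

Let f_ge0 s : 0 <= f s. Proof. by rewrite mulr_ge0 ?powR_ge0 ?expR_ge0. Qed.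

Lemma gamma_density_le s : 0 <= s -> f s <= 2 * expR (- (s / 2)).
Proof.
move=> s0; have /andP[a0 a1] := a01.
have sa : s `^ alpha <= 1 + s.
  have [s1|/ltW s1] := leP s 1.
    apply: (@le_trans _ _ (1 `^ alpha)); last by rewrite powR1; lra.
    by rewrite ge0_ler_powR ?nnegrE ?(ltW a0).
  by apply: (@le_trans _ _ s); [exact: ler1_powR|lra].
have e1 : 1 + s / 2 <= expR (s / 2) by exact: expR_ge1Dx.
have -> : f s = s `^ alpha * expR (- (s / 2)) * expR (- (s / 2)).
  by rewrite -mulrA -expRD; congr (_ * expR _); field.
rewrite ler_pM2r ?expR_gt0// expRN ler_pdivrMr ?expR_gt0//; lra.
Qed.

Let F (y : R) : R := parameterized_integral leb 0 y f.

Let f_int u : leb.-integrable `[0, u] (EFin \o f).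
Proof.
apply: measurable_bounded_integrable => //.
- by rewrite /= lebesgue_measure_itv/=; case: ifP => _; rewrite ?ltry// -EFinB ltry.
- apply: measurable_funTS; apply: measurable_funM; first exact: measurable_powR.
  by apply: measurableT_comp => //; exact: measurableT_comp.
exists 2; split => // M M2 s /=; rewrite in_itv/= => /andP[s0 _].
rewrite ger0_norm// (le_trans (gamma_density_le s0))// (le_trans _ (ltW M2))//.
by rewrite ler_piMr// -[leRHS]expR0 ler_expR oppr_le0 divr_ge0.
Qed.

Let F_derive (y : R) : 0 < y -> is_derive y 1 F (f y).
Proof.
move=> y0; have cf : {for y, continuous f}.
  have cp : {for y, continuous (fun s : R => s `^ alpha)}.
    apply/differentiable_continuous/derivable1_diffP; apply: derivable_powR.
    by rewrite in_itv/= y0.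
  apply: cvgM; first exact: cp.
  by apply: (cvg_comp -%R expR); [apply: (@cvgN _ R^o); exact: cvg_id|exact: continuous_expR].
have yu : y < y + 1 by rewrite ltrDl.
have [d1 d2] := @continuous_FTC1_closed R f 0 y (y + 1) yu (f_int _) y0 cf.
by split; [exact: d1|rewrite -derive1E; exact: d2].
Qed.

Let F0 : F 0 = 0.
Proof. by rewrite /F /parameterized_integral set_itv1 Rintegral_set1. Qed.

Let F_cont (b : R) : 0 <= b -> {within `[0, b], continuous F}.
Proof. by move=> b0; exact: parameterized_integral_continuous. Qed.

(** The left end [0] is included: continuity holds on the closed interval, and differentiability is
    used inside only. *)
Let F_mvt (a b : R) : 0 <= a -> a < b -> exists2 c, a < c < b & F b - F a = f c * (b - a).
Proof.
move=> a0 ab; have b0 : 0 <= b by rewrite (le_trans a0)// ltW.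
have cF : {within `[a, b], continuous F}.
  apply: continuous_subspaceW (F_cont b0) => x /=.
  by rewrite !in_itv/= => /andP[ax ->]; rewrite (le_trans a0 ax).
have dF x : x \in `]a, b[ -> is_derive x 1 F (f x).
  by rewrite in_itv/= => /andP[ax _]; apply: F_derive; lra.
have [c ci e] := @MVT R F f a b ab dF cF.
by exists c => //; move: ci; rewrite in_itv.
Qed.

Let F_le a b : 0 <= a -> a <= b -> F a <= F b.
Proof.
move=> a0; rewrite le_eqVlt => /predU1P[->//|ab].
by have [c _ e] := F_mvt a0 ab; rewrite -subr_ge0 e mulr_ge0// subr_ge0 ltW.
Qed.

Let F_neg (b : R) : b <= 0 -> F b = 0.
Proof.
rewrite le_eqVlt => /predU1P[->//|b0].
by rewrite /F /parameterized_integral set_itv_ge ?Rintegral_set0// bnd_simp -ltNge.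
Qed.

Let F_nd : nondecreasing_fun F.
Proof.
move=> a b ab; have [a0|/ltW a0] := leP 0 a; first exact: F_le.
rewrite (F_neg a0); have [b0|/ltW b0] := leP 0 b; last by rewrite F_neg.
by rewrite -F0 F_le.
Qed.

Let F_ub : has_ubound (range F).
Proof.
(* With this constant, [K (1 - exp (- d / 2))] grows from [d] to [d + 1] by at least
   [2 exp (- d / 2)], a bound of the integrand on that interval. *)
pose K : R := 4 * expR (1 / 2).
have FK (d : nat) : F d%:R <= K * (1 - expR (- (d%:R / 2))).
  elim: d => [|d IHd]; first by rewrite F0 mul0r oppr0 expR0 subrr mulr0.
  have dd : d%:R < d.+1%:R :> R by rewrite ltr_nat.
  have [c /andP[cd _] e] := F_mvt (ler0n _ d) dd.
  have fc : f c <= 2 * expR (- (d%:R / 2)).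
    apply: le_trans (gamma_density_le _) _; first exact: le_trans (ltW cd).
    by rewrite ler_pM2l// ler_expR lerN2 ler_pM2r// ltW.
  have e1 : expR (- (d%:R / 2)) = expR (1 / 2) * expR (- (d.+1%:R / 2)) :> R.
    by rewrite -expRD; congr expR; rewrite -natr1; field.
  have e2 : (1 + 1 / 2) * expR (- (d.+1%:R / 2)) <= expR (- (d%:R / 2)) :> R.
    by rewrite e1 ler_pM2r ?expR_gt0// expR_ge1Dx.
  have e3 : d.+1%:R - d%:R = 1 :> R by rewrite -natr1; ring.
  move: e; rewrite e3 mulr1 => e.
  have -> : F d.+1%:R = F d%:R + f c by rewrite -e; ring.
  have K1 : 0 < expR (1 / 2) :> R by exact: expR_gt0.
  have : f c <= K / 2 * expR (- (d.+1%:R / 2)).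
    by apply: le_trans fc _; rewrite e1 /K; lra.
  have : K / 2 * expR (- (d.+1%:R / 2)) <=
      K * (expR (- (d%:R / 2)) - expR (- (d.+1%:R / 2))).
    rewrite -mulrA ler_pM2l ?mulr_gt0//; lra.
  by lra.
exists K => _ [y _ <-].
have yn : y <= (Num.truncn `|y|).+1%:R.
  by rewrite (le_trans (ler_norm y))// ltW// truncnS_gt.
apply: le_trans (F_nd yn) _; apply: le_trans (FK _) _.
by rewrite ler_piMr ?gerBl ?expR_ge0// mulr_ge0 ?expR_ge0.
Qed.

Let F_pos : 0 < F 1.
Proof.
have [c /andP[c0 _] e] := F_mvt (lexx 0) ltr01.
have -> : F 1 = f c by move: e; rewrite F0 !subr0 mulr1.
by rewrite mulr_gt0 ?expR_gt0// powR_gt0.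
Qed.

(** The bound does not depend on [D]: the error on each cell is at most [6 e theta ^ alpha] times
    the drop of [u] across it, and these drops telescope to at most one. *)
Let riemann_error (theta : R) (D : nat) : 0 < theta <= 1 ->
  `|F (theta * D%:R) - theta * \sum_(d < D) f (theta * d.+1%:R)| <=
  6 * expR 1 * theta `^ alpha.
Proof.
move=> /andP[th0 th1]; have /andP[a0 a1] := a01.
pose E : R := expR 1.
have E0 : 0 < E by exact: expR_gt0.
have tha : theta <= theta `^ alpha by rewrite ger1_powR// th0.
pose u d : R := expR (- (theta * d%:R / 2)).
have u_step d : theta / 2 * u d.+1 <= u d - u d.+1.
  have -> : u d = expR (theta / 2) * u d.+1.
    by rewrite /u -expRD; congr expR; rewrite -natr1; field.
  have := expR_ge1Dx (theta / 2); have : 0 < u d.+1 by exact: expR_gt0.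
  by move: (u d.+1) (expR _) => p w p0 hw; nra.
suff h : `|F (theta * D%:R) - theta * \sum_(d < D) f (theta * d.+1%:R)| <=
    6 * E * theta `^ alpha * (1 - u D).
  apply: le_trans h _; rewrite ler_piMr ?gerBl ?expR_ge0//.
  by rewrite !mulr_ge0 ?powR_ge0 ?(ltW E0).
elim: D => [|D IHD].
  have -> : u 0%N = 1 by rewrite /u mulr0 mul0r oppr0 expR0.
  by rewrite big_ord0 !mulr0 F0 !subrr normr0 mulr0.
have st : theta * D%:R < theta * D.+1%:R by rewrite ltr_pM2l// ltr_nat.
have [c /andP[c1 c2] e] := F_mvt (mulr_ge0 (ltW th0) (ler0n _ D)) st.
set s := theta * D.+1%:R in c2 e *.
have sD : s - theta * D%:R = theta by rewrite /s -natr1; ring.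
rewrite sD in e.
have c0 : 0 <= c by rewrite ltW// (le_lt_trans _ c1)// mulr_ge0 ?(ltW th0).
have sc : 0 <= s - c <= theta by apply/andP; split; lra.
have s0 : 0 <= s by lra.
(* The factor [E] pays for moving within a cell, of length [theta <= 1]. *)
have ec : expR (- c) <= E * expR (- s).
  by rewrite -expRD ler_expR; case/andP: sc; lra.
have p1 : `|c `^ alpha - s `^ alpha| <= theta `^ alpha.
  apply: le_trans (powR_dist_le a01 c0 s0) _.
  rewrite ge0_ler_powR ?nnegrE ?(ltW a0) ?(ltW th0)// distrC ger0_norm; by case/andP: sc.
have p2 : `|expR (- c) - expR (- s)| <= E * expR (- s) * theta.
  rewrite ger0_norm; last by rewrite subr_ge0 ler_expR; lra.
  have es : expR (- s) = expR (- c) * expR (- (s - c)) by rewrite -expRD; congr expR; ring.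
  apply: (@le_trans _ _ (expR (- c) * (s - c))).
    rewrite es -[X in X - _]mulr1 -mulrBr ler_pM2l ?expR_gt0//.
    by have := expR_ge1Dx (- (s - c)); lra.
  by case/andP: sc => sc0 sc1; rewrite ler_pM// expR_ge0.
have us : u D.+1 = expR (- (s / 2)) by [].
have eu : expR (- s) <= u D.+1 by rewrite us ler_expR; lra.
have fs : f s <= 2 * u D.+1 by rewrite us gamma_density_le.
(* Of the constant 3, one unit comes from the increment of the power and two from that of the
   exponential. *)
have osc : `|f c - f s| <= 3 * E * theta `^ alpha * u D.+1.
  have -> : f c - f s = (c `^ alpha - s `^ alpha) * expR (- c)
      + s `^ alpha * (expR (- c) - expR (- s)) by rewrite /f; ring.
  apply: le_trans (ler_normD _ _) _; rewrite !normrM.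
  rewrite (ger0_norm (expR_ge0 _)) (ger0_norm (powR_ge0 _ _)).
  have q1 : `|c `^ alpha - s `^ alpha| * expR (- c) <= theta `^ alpha * (E * u D.+1).
    rewrite ler_pM// ?expR_ge0// (le_trans ec)// ler_pM2l//.
  have q2 : s `^ alpha * `|expR (- c) - expR (- s)| <= E * theta * (2 * u D.+1).
    apply: le_trans (ler_wpM2l (powR_ge0 _ _) p2) _.
    rewrite [leLHS](_ : _ = E * theta * f s); last by rewrite /f; ring.
    by rewrite ler_wpM2l// mulr_ge0 ?(ltW th0) ?(ltW E0).
  have q3 : E * theta * (2 * u D.+1) <= E * theta `^ alpha * (2 * u D.+1).
    by rewrite ler_wpM2r ?mulr_ge0 ?expR_ge0// ler_wpM2l// ltW.
  by lra.
rewrite big_ord_recr/= -/s.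
have -> : F s - theta * (\sum_(d < D) f (theta * d.+1%:R) + f s) =
    (F (theta * D%:R) - theta * \sum_(d < D) f (theta * d.+1%:R)) + theta * (f c - f s).
  have -> : F s = F (theta * D%:R) + f c * theta by rewrite -e addrC subrK.
  move: (F _) (f c) (f s) (\sum_(_ < _) _) => w1 w2 w3 w4; ring.
apply: le_trans (ler_normD _ _) _; rewrite normrM (gtr0_norm th0).
have := ler_wpM2l (ltW th0) osc; have := u_step D.
have Et : 0 <= 6 * E * theta `^ alpha by rewrite !mulr_ge0 ?powR_ge0 ?(ltW E0).
move=> /(ler_wpM2l Et) h1 h2.
apply: le_trans (lerD IHD h2) _.
rewrite -/s; lra.
Qed.

(** [L] is the supremum of the increasing bounded integral [F]. The uniform error bound lets the
    mesh and the number of terms vary together. *)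
Lemma riemann_sum_gamma : exists2 L : R, 0 < L &
  forall (theta : nat -> R) (D : nat -> nat),
    (\forall n \near \oo, 0 < theta n) -> theta n @[n --> \oo] --> (0 : R) ->
    (theta n * (D n)%:R) @[n --> \oo] --> +oo ->
    (theta n * \sum_(d < D n) f (theta n * d.+1%:R)) @[n --> \oo] --> L.
Proof.
have /andP[a0 a1] := a01.
have FL := nondecreasing_cvgr F_nd F_ub; set L := sup _ in FL.
exists L; first by apply: lt_le_trans F_pos _; apply: (ub_le_sup F_ub); exists 1.
move=> theta D th_pos th0 thD.
have FD : F (theta n * (D n)%:R) @[n --> \oo] --> L by exact: cvg_comp thD FL.
have th_le1 : \forall n \near \oo, theta n <= 1.
  by apply: (cvgr_le 0 th0); exact: ltr01.
have err : (F (theta n * (D n)%:R) -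
    theta n * \sum_(d < D n) f (theta n * d.+1%:R)) @[n --> \oo] --> (0 : R).
  have pw : 6 * expR 1 * theta n `^ alpha @[n --> \oo] --> (0 : R).
    rewrite -[X in _ --> X](mulr0 (6 * expR 1)); apply: cvgM; first exact: cvg_cst.
    exact: cvg0_powR.
  apply: cvg0_norm_le pw; near=> n; apply: riemann_error.
  by apply/andP; split; near: n.
have : (F (theta n * (D n)%:R) - (F (theta n * (D n)%:R) -
    theta n * \sum_(d < D n) f (theta n * d.+1%:R))) @[n --> \oo] --> L.
  by rewrite -[L]subr0; exact: cvgB FD err.
apply: cvg_trans; apply: near_eq_cvg; near=> n.
by rewrite opprB addrC subrK.
Unshelve. all: by end_near. Qed.

End riemann_sum.

(** * Asymptotics of the spread and of the bias *)

Section bandwidth.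
Context (R : realType) (gamma : R).
Hypothesis gamma_gt0 : 0 < gamma.

Let g12 : 0 < 1 + 2 * gamma. Proof. by rewrite ltr_pwDl// mulr_ge0// ltW. Qed.

Definition bandwidth n : R := nodes R n `^ (- (1 + 2 * gamma)^-1).
Local Notation h := bandwidth.
Local Notation r := (precision gamma).

Lemma bandwidth_gt0 n : 0 < h n.
Proof. by rewrite powR_gt0// nodes_gt0. Qed.

Lemma nodes_bandwidth n : nodes R n = h n `^ (- (1 + 2 * gamma)).
Proof.
rewrite -powRrM mulNr mulrN opprK mulVf ?gt_eqF// powRr1// ltW// nodes_gt0//.
Qed.

(** As a power of [N], the exponent is [(1 - 2 gamma) / (1 + 2 gamma) - 1 = - 4 gamma / (1 + 2
    gamma)]. *)
Lemma precision_bandwidth n : r n = (h n `^ (2 * gamma)) ^+ 2.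
Proof.
have N0 := nodes_gt0 R n.
rewrite -powR_mulrn ?powR_ge0// -!powRrM /precision /bm_scale -/(nodes R n).
rewrite -[X in _ / X]powRr1 ?(ltW N0)// -powRN -powRD; last by rewrite (gt_eqF N0) implybT.
by congr (_ `^ _); field; rewrite gt_eqF.
Qed.

Lemma nodes_sqrt_precision n : nodes R n * h n `^ (2 * gamma) = (h n)^-1.
Proof.
rewrite {1}nodes_bandwidth -powRD; last by rewrite (gt_eqF (bandwidth_gt0 n)) implybT.
by rewrite -powR_inv1 ?(ltW (bandwidth_gt0 n))//; congr (_ `^ _); ring.
Qed.

Lemma cvg_nodes : nodes R n @[n --> \oo] --> +oo.
Proof.
apply: (@ger_cvgy _ _ _ _ (fun n => n%:R)); last exact: cvgr_idn.
by near=> n; rewrite /nodes lerDl.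
Unshelve. all: by end_near. Qed.

Lemma cvg_bandwidth : h n @[n --> \oo] --> (0 : R).
Proof.
apply/cvgrPdist_le => e e0; near=> n.
rewrite sub0r normrN gtr0_norm ?bandwidth_gt0// /h.
have N0 := nodes_gt0 R n.
have -> : e = (e `^ (- (1 + 2 * gamma))) `^ (- (1 + 2 * gamma)^-1).
  by rewrite -powRrM mulrNN mulfV ?gt_eqF// powRr1// ltW.
rewrite !(powRN _ (_ ^-1)) lef_pV2 ?posrE ?powR_gt0//.
rewrite ge0_ler_powR ?nnegrE ?powR_ge0 ?invr_ge0 ?(ltW g12) ?(ltW N0)//.
by near: n; apply: cvgry_ge; exact: cvg_nodes.
Unshelve. all: by end_near. Qed.

Lemma near_bandwidth_le1 : \forall n \near \oo, h n <= 1.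
Proof. by apply: (cvgr_le 0 cvg_bandwidth); exact: ltr01. Qed.

Lemma cvg_bandwidth_powR a : 0 < a -> h n `^ a @[n --> \oo] --> (0 : R).
Proof.
move=> a0; apply: cvg0_powR => //; last exact: cvg_bandwidth.
by near=> n; exact: bandwidth_gt0.
Unshelve. all: by end_near. Qed.

(** The root below one of [(1 - q) ^ 2 = r q]. *)
Definition decay n : R := 1 + r n / 2 - Num.sqrt (r n + r n ^+ 2 / 4).
Local Notation q := decay.

Lemma decayE n : (1 - q n) ^+ 2 = r n * q n.
Proof.
have r0 := precision_gt0 gamma n; rewrite /decay; set s := Num.sqrt _.
have s2 : s ^+ 2 = r n + r n ^+ 2 / 4 by rewrite sqr_sqrtr//; have := sqr_ge0 (r n); lra.
apply/eqP; rewrite -subr_eq0; apply/eqP.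
transitivity (s ^+ 2 - (r n + r n ^+ 2 / 4)); first by field.
by rewrite s2 subrr.
Qed.

Lemma decay_itv n : 0 < q n < 1.
Proof.
have r0 := precision_gt0 gamma n; rewrite /decay; set s := Num.sqrt _.
have s2 : s ^+ 2 = r n + r n ^+ 2 / 4 by rewrite sqr_sqrtr//; have := sqr_ge0 (r n); lra.
have s0 : 0 <= s by exact: sqrtr_ge0.
move: (r n) r0 s2 => p p0 s2.
have h1 : s < 1 + p / 2.
  by rewrite -(@ltr_pXn2r _ 2) ?nnegrE// ?s2 ?addr_ge0 ?divr_ge0 ?(ltW p0)//; lra.
have h2 : p / 2 < s.
  by rewrite -(@ltr_pXn2r _ 2) ?nnegrE// ?s2 ?divr_ge0 ?(ltW p0)//; lra.
by apply/andP; split; lra.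
Qed.

Let w n : R := h n `^ (2 * gamma).
Let w_gt0 n : 0 < w n. Proof. by rewrite powR_gt0// bandwidth_gt0. Qed.

Lemma decay_compl n : 1 - q n = w n * Num.sqrt (q n).
Proof.
have /andP[q0 q1] := decay_itv n.
rewrite -[LHS]ger0_norm ?subr_ge0 ?(ltW q1)// -sqrtr_sqr decayE precision_bandwidth.
by rewrite sqrtrM ?sqr_ge0// sqrtr_sqr ger0_norm ?powR_ge0.
Qed.

Lemma cvg_decay : q n @[n --> \oo] --> (1 : R).
Proof.
have h1 : (1 - q n) @[n --> \oo] --> (0 : R).
  apply: (@cvg0_norm_le _ _ w); last by apply: cvg_bandwidth_powR; rewrite mulr_gt0.
  near=> n; have /andP[q0 q1] := decay_itv n.
  rewrite decay_compl ger0_norm ?mulr_ge0 ?sqrtr_ge0 ?(ltW (w_gt0 n))//.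
  rewrite ler_piMr ?(ltW (w_gt0 n))// -[leRHS]sqrtr1 ler_wsqrtr// ltW//.
have : 1 - (1 - q n) @[n --> \oo] --> (1 - 0 : R) by apply: cvgB h1; exact: cvg_cst.
rewrite subr0; apply: cvg_trans; apply: near_eq_cvg; near=> n.
by rewrite opprB addrC subrK.
Unshelve. all: by end_near. Qed.

Lemma cvg_decay_compl : (1 - q n) / w n @[n --> \oo] --> (1 : R).
Proof.
have : Num.sqrt (q n) @[n --> \oo] --> (Num.sqrt 1 : R).
  by apply: (cvg_comp q Num.sqrt cvg_decay); exact: sqrt_continuous.
rewrite sqrtr1; apply: cvg_trans; apply: near_eq_cvg; near=> n.
by rewrite decay_compl mulrC mulKf// gt_eqF.
Unshelve. all: by end_near. Qed.

Lemma cvg_peak_decay : peak (q n) / w n @[n --> \oo] --> (2^-1 : R).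
Proof.
have l : (1 - q n) / w n * (1 + q n)^-1 @[n --> \oo] --> (1 * (1 + 1)^-1 : R).
  apply: cvgM; first exact: cvg_decay_compl.
  by apply: cvgV => //; apply: cvgD; [exact: cvg_cst|exact: cvg_decay].
rewrite mul1r in l; apply: cvg_trans l; apply: near_eq_cvg; near=> n.
by rewrite /peak mulrAC.
Unshelve. all: by end_near. Qed.

Lemma near_decay_ge : \forall n \near \oo, 4^-1 <= q n.
Proof. by apply: (cvgr_ge 1 cvg_decay); lra. Qed.

(** [q ^ k <= exp (- k (1 - q))], and [k (1 - q)] is at least [c N h ^ (2 gamma) / 2 = c / (2 h)]
    once [q >= 1/4]. The exponential is bounded below by the term of degree [M > p] of its
    series. *)
Lemma decay_exp_small (p c : R) (k : nat -> nat) : 0 < c ->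
  (\forall n \near \oo, c * nodes R n <= (k n)%:R) ->
  h n `^ (- p) * q n ^+ k n @[n --> \oo] --> (0 : R).
Proof.
move=> c0 kc; pose M := (Num.truncn `|p|).+1.
have Mp : p < M%:R.
  by apply: le_lt_trans (ler_norm p) _; exact: truncnS_gt.
pose C : R := M`!%:R * (2 / c) ^+ M.
apply: (@cvg0_norm_le _ _ (fun n => C * h n `^ (M%:R - p))); last first.
  rewrite -[X in _ --> X](mulr0 C); apply: cvgM; first exact: cvg_cst.
  by apply: cvg_bandwidth_powR; rewrite subr_gt0.
near=> n; have h0 := bandwidth_gt0 n; have /andP[q0 q1] := decay_itv n.
rewrite ger0_norm ?mulr_ge0 ?powR_ge0 ?exprn_ge0 ?(ltW q0)//.
have q4 : 4^-1 <= q n by near: n; exact: near_decay_ge.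
have sq : 2^-1 <= Num.sqrt (q n).
  have -> : 2^-1 = Num.sqrt (2^-1 ^+ 2) :> R by rewrite sqrtr_sqr ger0_norm.
  by apply: ler_wsqrtr; rewrite expr2; lra.
pose y := c / 2 / h n.
have y0 : 0 < y by rewrite !divr_gt0.
have kq : y <= (k n)%:R * (1 - q n).
  have kn : c * nodes R n <= (k n)%:R by near: n.
  have : c * nodes R n * (w n / 2) <= (k n)%:R * (1 - q n).
    rewrite decay_compl ler_pM ?mulr_ge0 ?divr_ge0 ?(ltW c0) ?(ltW (nodes_gt0 R n)) ?(ltW (w_gt0 n))//.
    by rewrite ler_pM2l.
  apply: le_trans; rewrite /y -nodes_sqrt_precision -/(w n) le_eqVlt; apply/orP; left; apply/eqP.
  by field.
have qk : q n ^+ k n <= (expR y)^-1.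
  rewrite -expRN.
  apply: (@le_trans _ _ (expR (- (1 - q n)) ^+ k n)).
    rewrite lerXn2r ?nnegrE ?expR_ge0 ?(ltW q0)//.
    by have := expR_ge1Dx (- (1 - q n)); lra.
  by rewrite -expRM_natl ler_expR mulrN lerN2.
have ey : y ^+ M / M`!%:R <= expR y.
  by apply: le_trans (expR_ge1Dxn (Num.truncn `|p|) (ltW y0)); rewrite lerDr.
have F0 : 0 < M`!%:R :> R by rewrite ltr0n fact_gt0.
have yM : 0 < y ^+ M / M`!%:R by rewrite divr_gt0// exprn_gt0.
apply: (@le_trans _ _ (h n `^ (- p) * (y ^+ M / M`!%:R)^-1)).
  rewrite ler_wpM2l ?powR_ge0//; apply: le_trans qk _.
  by rewrite lef_pV2 ?posrE ?expR_gt0.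
rewrite powRD; last by rewrite (gt_eqF h0) implybT.
rewrite powR_mulrn ?(ltW h0)// le_eqVlt; apply/orP; left; apply/eqP.
have -> : (y ^+ M / M`!%:R)^-1 = C * h n ^+ M.
  rewrite /C /y invf_div -[RHS]mulrA -exprMn -exprVn; congr (_ * _ ^+ M).
  by field; rewrite !gt_eqF.
by rewrite mulrCA mulrA mulrAC -mulrA mulrCA mulrA.
Unshelve. all: by end_near. Qed.

End bandwidth.

(** * Position of the point in the grid *)

Section cell_of_point.
Context (R : realType) (gamma x : R).
Hypothesis gamma_gt0 : 0 < gamma.
Hypothesis x01 : 0 < x < 1.
Local Notation h := (bandwidth gamma).
Local Notation q := (decay gamma).

Definition cell n : nat := Num.truncn (x * nodes R n).
Definition offset n : R := x * nodes R n - (cell n)%:R.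

Lemma offsetE n : x * nodes R n = (cell n)%:R + offset n.
Proof. by rewrite /offset addrC subrK. Qed.

Lemma offset_itv n : 0 <= offset n <= 1.
Proof.
have /andP[x0 x1] := x01.
have /andP[c1 c2] : (cell n)%:R <= x * nodes R n < (cell n).+1%:R.
  by rewrite truncn_itv// mulr_ge0 ?ltW// nodes_gt0.
by rewrite /offset -natr1 in c2 *; apply/andP; split; lra.
Qed.

Lemma near_cell_ge : \forall n \near \oo, x / 2 * nodes R n <= (cell n)%:R.
Proof.
have /andP[x0 x1] := x01; near=> n.
have /andP[t0 t1] := offset_itv n; have e := offsetE n.
have : 2 / x <= nodes R n by near: n; apply: cvgry_ge; exact: cvg_nodes.
by rewrite ler_pdivrMr//; lra.
Unshelve. all: by end_near. Qed.

Lemma near_cell_lt : \forall n \near \oo, (cell n < n)%N.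
Proof.
have /andP[x0 x1] := x01; near=> n.
have /andP[t0 t1] := offset_itv n; have e := offsetE n.
rewrite -(@ltr_nat R).
have : 1 / (1 - x) <= nodes R n by near: n; apply: cvgry_ge; exact: cvg_nodes.
rewrite ler_pdivrMr; last lra.
have : nodes R n = n%:R + 2^-1 by [].
by move: (nodes R n) e => N e Nn; nra.
Unshelve. all: by end_near. Qed.

Lemma near_cell : \forall n \near \oo, (0 < cell n < n)%N.
Proof.
have /andP[x0 x1] := x01; near=> n.
apply/andP; split; last by near: n; exact: near_cell_lt.
rewrite -(@ltr_nat R); apply: (@lt_le_trans _ _ (x / 2 * nodes R n)).
  by rewrite mulr_gt0 ?nodes_gt0// divr_gt0.
by near: n; exact: near_cell_ge.
Unshelve. all: by end_near. Qed.

Lemma near_cell_co : \forall n \near \oo,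
  (1 - x) / 2 * nodes R n <= (n - (cell n).+1)%:R.
Proof.
have /andP[x0 x1] := x01; near=> n.
have cn : (cell n < n)%N by near: n; exact: near_cell_lt.
have /andP[t0 t1] := offset_itv n; have e := offsetE n.
have : 3 / (1 - x) <= nodes R n by near: n; apply: cvgry_ge; exact: cvg_nodes.
rewrite ler_pdivrMr; last lra.
rewrite natrB// -natr1.
have : nodes R n = n%:R + 2^-1 by [].
by move: (nodes R n) e => N e Nn; nra.
Unshelve. all: by end_near. Qed.

(** The sup bound of [remainder]; it also bounds the missing mass of the weights. *)
Definition boundary n : R := q n ^+ cell n + n%:R * q n ^+ (n - (cell n).+1).

Lemma boundary_ge0 n : 0 <= boundary n.
Proof.
have /andP[q0 q1] := decay_itv gamma n.
by rewrite addr_ge0 ?mulr_ge0 ?exprn_ge0 ?(ltW q0).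
Qed.

(** The factor [n <= N = h ^ (- (1 + 2 gamma))] only changes the power of [h]. *)
Lemma boundary_small p : h n `^ (- p) * boundary n @[n --> \oo] --> (0 : R).
Proof.
have /andP[x0 x1] := x01.
have c1 : 0 < x / 2 by rewrite divr_gt0.
have c2 : 0 < (1 - x) / 2 by rewrite divr_gt0// subr_gt0.
have s1 := decay_exp_small gamma_gt0 p c1 near_cell_ge.
have s2 := decay_exp_small gamma_gt0 (p + (1 + 2 * gamma)) c2 near_cell_co.
have sD : h n `^ (- p) * q n ^+ cell n + h n `^ (- (p + (1 + 2 * gamma))) *
    q n ^+ (n - (cell n).+1) @[n --> \oo] --> (0 : R).
  by rewrite -[X in _ --> X](addr0 0); exact: cvgD s1 s2.
apply: (cvg0_norm_le _ sD); near=> n.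
have /andP[q0 q1] := decay_itv gamma n; have h0 := bandwidth_gt0 gamma n.
rewrite ger0_norm ?mulr_ge0 ?powR_ge0 ?boundary_ge0//.
rewrite /boundary mulrDr lerD2l mulrA ler_wpM2r ?exprn_ge0 ?(ltW q0)//.
rewrite opprD powRD; last by rewrite (gt_eqF h0) implybT.
rewrite ler_wpM2l ?powR_ge0// -nodes_bandwidth//.
by rewrite /nodes lerDl.
Unshelve. all: by end_near. Qed.

Lemma remainder_small p :
  h n `^ (- p) * (n%:R * boundary n) @[n --> \oo] --> (0 : R).
Proof.
apply: (cvg0_norm_le _ (boundary_small (p + (1 + 2 * gamma)))); near=> n.
have h0 := bandwidth_gt0 gamma n.
rewrite ger0_norm ?mulr_ge0 ?powR_ge0 ?boundary_ge0//.
rewrite mulrA ler_wpM2r ?boundary_ge0// opprD powRD; last by rewrite (gt_eqF h0) implybT.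
rewrite ler_wpM2l ?powR_ge0// -nodes_bandwidth//.
by rewrite /nodes lerDl.
Unshelve. all: by end_near. Qed.

End cell_of_point.

(** * Limits of the posterior variance and of the norm of the weights *)

Section spread_limits.
Context (R : realType) (gamma x : R) (m : nat -> nat).
Variables (mu : forall n, 'I_n -> R) (v : forall n, 'I_n -> 'cV[R]_n).
Hypothesis gamma_gt0 : 0 < gamma.
Hypothesis x01 : 0 < x < 1.
Hypothesis hmu : forall n, eigensystem (kmat gamma n) (@mu n) (@v n).
Hypothesis m_gt0 : \forall n \near \oo, (0 < m n)%N.
Hypothesis m_large : (bandwidth gamma n)^-1 / (m n)%:R @[n --> \oo] --> (0 : R).
Local Notation h := (bandwidth gamma).
Local Notation q := (decay gamma).
Local Notation cell := (cell x).
Local Notation offset := (offset x).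

Let w n : R := h n `^ (2 * gamma).
Let w_gt0 n : 0 < w n. Proof. by rewrite powR_gt0// bandwidth_gt0. Qed.
Let w_neq0 n : w n != 0. Proof. by rewrite gt_eqF. Qed.
Let w_cvg : w n @[n --> \oo] --> (0 : R).
Proof. by apply: cvg_bandwidth_powR => //; rewrite mulr_gt0. Qed.

Let wV n : h n `^ (- (2 * gamma)) = (w n)^-1. Proof. by rewrite powRN. Qed.

Definition point_vec n := vec (two_point (offset n) (cell n)) n.
Definition point_weight n (k : nat) : R := weight (q n) (offset n) (cell n) k.
Definition rem_vec n := vec (remainder n (offset n) (cell n) (q n)) n.
Local Notation e := point_vec.
Local Notation g := point_weight.

Let W n := sgpr_weights (@mu n) (@v n) (m n) (e n).
Let vtail n := variance_tail (@mu n) (@v n) (m n) (e n).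

Lemma near_rem_norm : \forall n \near \oo,
  Num.sqrt (dot (rem_vec n) (rem_vec n)) <= n%:R * boundary gamma x n.
Proof.
near=> n; apply: remainder_norm.
- exact: offset_itv.
- by near: n; exact: near_cell.
- exact: decay_itv.
Unshelve. all: by end_near. Qed.

Lemma point_rem n : (0 < cell n < n)%N ->
  vec (g n) n + kmat gamma n *m vec (g n) n = kmat gamma n *m e n + rem_vec n.
Proof. by move=> cn; apply: weight_remainder => //; [exact: decay_itv|exact: decayE]. Qed.

Lemma point_kvec n : (0 < cell n < n)%N -> kvec gamma n x = kmat gamma n *m e n.
Proof.
by move=> cn; apply: kvec_two_point => //; [exact: offset_itv|exact: offsetE].
Qed.

Lemma cvg_rem_scaled p : h n `^ (- p) * Num.sqrt (dot (rem_vec n) (rem_vec n))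
  @[n --> \oo] --> (0 : R).
Proof.
apply: (cvg0_norm_le _ (remainder_small gamma_gt0 x01 p)); near=> n.
rewrite ger0_norm ?mulr_ge0 ?powR_ge0 ?sqrtr_ge0// ler_wpM2l ?powR_ge0//.
by near: n; exact: near_rem_norm.
Unshelve. all: by end_near. Qed.

Let cvg_vtail : vtail n / w n @[n --> \oo] --> (0 : R).
Proof.
have l : 32 * ((h n)^-1 / (m n)%:R) @[n --> \oo] --> (0 : R).
  by rewrite -[X in _ --> X](mulr0 32); apply: cvgM; [exact: cvg_cst|exact: m_large].
apply: (cvg0_norm_le _ l); near=> n.
have cn : (0 < cell n < n)%N by near: n; exact: near_cell.
have mn : (0 < m n)%N by near: n.
rewrite ger0_norm; last first.
  rewrite divr_ge0 ?(ltW (w_gt0 n))// sumr_ge0// => j _.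
  by have [_ mu0 _ _] := hmu n; rewrite mulr_ge0 ?sqr_ge0.
rewrite ler_pdivrMr//.
apply: le_trans (variance_tail_le (hmu n) (offset_itv x01 n) cn mn) _.
rewrite -(nodes_sqrt_precision gamma_gt0) -/(w n) precision_bandwidth// -/(w n).
rewrite le_eqVlt; apply/orP; left; apply/eqP.
by field; rewrite pnatr_eq0 -lt0n.
Unshelve. all: by end_near. Qed.

Let s n : R := (1 - q n) * (1 + q n ^+ 2) / (1 + q n) ^+ 3.

Let cvg_q2 : q n ^+ 2 @[n --> \oo] --> (1 : R).
Proof.
have -> : (1 : R) = 1 * 1 by rewrite mulr1.
by under eq_fun do rewrite expr2; apply: cvgM; exact: cvg_decay.
Qed.

Let cvg_1q : 1 + q n @[n --> \oo] --> (2 : R).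
Proof. by apply: cvgD; [exact: cvg_cst|exact: cvg_decay]. Qed.

(** [(1 - q) / w] tends to [1] and [(1 + q ^ 2) / (1 + q) ^ 3] to [2 / 8]. *)
Let cvg_s : s n / w n @[n --> \oo] --> (4^-1 : R).
Proof.
have l : ((1 - q n) / w n) * ((1 + q n ^+ 2) * ((1 + q n) ^+ 3)^-1) @[n --> \oo]
    --> (1 * ((1 + 1) * (2 ^+ 3)^-1) : R).
  apply: cvgM; first exact: cvg_decay_compl.
  apply: cvgM; first by apply: cvgD; [exact: cvg_cst|exact: cvg_q2].
  apply: cvgV; first by rewrite expf_neq0.
  by rewrite !exprS expr0; under eq_fun do rewrite !exprS expr0;
    do 3 (apply: cvgM; first exact: cvg_1q); exact: cvg_cst.
have -> : (4^-1 : R) = 1 * ((1 + 1) * (2 ^+ 3)^-1) by field.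
apply: cvg_trans l; apply: near_eq_cvg; near=> n.
by rewrite /s mulrACA [(w n)^-1 * _]mulrC mulrA.
Unshelve. all: by end_near. Qed.

Lemma boundary_cvg0 : boundary gamma x n @[n --> \oo] --> (0 : R).
Proof.
have := boundary_small gamma_gt0 x01 0; rewrite oppr0.
by under eq_fun do rewrite powRr0 mul1r.
Qed.

Let cvg_gg : dot (vec (g n) n) (vec (g n) n) / w n @[n --> \oo] --> (4^-1 : R).
Proof.
have lo : q n ^+ 2 * (s n / w n) * (1 - boundary gamma x n) @[n --> \oo] --> (4^-1 : R).
  have -> : (4^-1 : R) = 1 * 4^-1 * (1 - 0) by rewrite subr0 mul1r mulr1.
  apply: cvgM; first by apply: cvgM; [exact: cvg_q2|exact: cvg_s].
  by apply: cvgB; [exact: cvg_cst|exact: boundary_cvg0].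
have hi : q n ^- 2 * (s n / w n) @[n --> \oo] --> (4^-1 : R).
  have -> : (4^-1 : R) = 1^-1 * 4^-1 by rewrite invr1 mul1r.
  apply: cvgM; last exact: cvg_s.
  by apply: cvgV; [exact: oner_neq0|exact: cvg_q2].
apply: (squeeze_cvgr _ lo hi); near=> n.
have cn : (0 < cell n < n)%N by near: n; exact: near_cell.
have /andP[c0 cn'] := cn.
have cn2 : (0 < cell n <= n)%N by rewrite c0 ltnW.
have q01 := decay_itv gamma n; have /andP[q0 q1] := q01.
have -> : dot (vec (g n) n) (vec (g n) n) = \sum_(k < n) g n k.+1 ^+ 2.
  by rewrite dot_vec; apply: eq_bigr => k _; rewrite expr2.
have s0 : 0 <= s n.
  have qq := sqr_ge0 (q n).
  by apply: divr_ge0; [apply: mulr_ge0; lra|apply: exprn_ge0; lra].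
apply/andP; split.
  rewrite mulrA mulrAC ler_pM2r ?invr_gt0//.
  apply: le_trans (sum_weight_sqr_ge q01 (offset_itv x01 n) cn2).
  apply: ler_wpM2l; first by rewrite mulr_ge0 ?sqr_ge0.
  have n1 : 1 <= n%:R :> R by rewrite ler1n (leq_ltn_trans (leq0n (cell n))).
  have : q n ^+ (n - cell n) <= n%:R * q n ^+ (n - (cell n).+1).
    apply: (@le_trans _ _ (q n ^+ (n - (cell n).+1))).
      by rewrite ler_wiXn2l ?(ltW q0) ?(ltW q1)// leq_sub2l.
    by rewrite ler_peMl ?exprn_ge0 ?(ltW q0).
  by rewrite /boundary; lra.
rewrite mulrA ler_pM2r ?invr_gt0//.
exact: (sum_weight_sqr_le q01 (offset_itv x01 n) cn2).
Unshelve. all: by end_near. Qed.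

Let cvg_rho : Num.sqrt (dot (rem_vec n) (rem_vec n)) / w n @[n --> \oo] --> (0 : R).
Proof.
have := cvg_rem_scaled (2 * gamma); apply: cvg_trans; apply: near_eq_cvg; near=> n.
by rewrite wV mulrC.
Unshelve. all: by end_near. Qed.

Let near_small (u : nat -> R) (l : R) : u n / w n @[n --> \oo] --> l ->
  \forall n \near \oo, u n <= 1.
Proof.
move=> ul; have u0 : u n @[n --> \oo] --> (0 : R).
  have : u n / w n * w n @[n --> \oo] --> (l * 0 : R) by apply: cvgM => //.
  rewrite mulr0; apply: cvg_trans; apply: near_eq_cvg; near=> n.
  by rewrite divfK.
by apply: (cvgr_le 0 u0); exact: ltr01.
Unshelve. all: by end_near. Qed.

Lemma cvg_sgpr_weights_norm : dot (W n) (W n) / w n @[n --> \oo] --> (4^-1 : R).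
Proof.
have d0 : (dot (W n) (W n) - dot (vec (g n) n) (vec (g n) n)) / w n @[n --> \oo] --> (0 : R).
  (* Once both norms are at most one, the two error terms in [rho] add up to at most three times its
     norm. *)
  have l : vtail n / w n + 3 * (Num.sqrt (dot (rem_vec n) (rem_vec n)) / w n)
      @[n --> \oo] --> (0 : R).
    rewrite -[X in _ --> X](addr0 0) -[X in _ --> _ + X](mulr0 3); apply: cvgD => //.
    by apply: cvgM; [exact: cvg_cst|exact: cvg_rho].
  apply: (cvg0_norm_le _ l); near=> n.
  have cn : (0 < cell n < n)%N by near: n; exact: near_cell.
  rewrite normrM normfV (gtr0_norm (w_gt0 n)) mulrA -mulrDl ler_pM2r ?invr_gt0//.
  apply: le_trans (sgpr_weights_norm (m n) (hmu n) (point_rem cn)) _.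
  rewrite -addrA lerD2l.
  have gg1 : Num.sqrt (dot (vec (g n) n) (vec (g n) n)) <= 1.
    rewrite -[leRHS]sqrtr1 ler_wsqrtr//; near: n; exact: near_small cvg_gg.
  set rho := Num.sqrt (dot (rem_vec n) (rem_vec n)).
  have rho1 : rho <= 1 by rewrite /rho; near: n; exact: near_small cvg_rho.
  have rho0 : 0 <= rho by exact: sqrtr_ge0.
  have -> : dot (rem_vec n) (rem_vec n) = rho ^+ 2.
    by rewrite sqr_sqrtr// dotE sumr_ge0// => i _; rewrite -expr2 sqr_ge0.
  have gg0 := sqrtr_ge0 (dot (vec (g n) n) (vec (g n) n)).
  move: (Num.sqrt (dot (vec _ _) _)) gg0 gg1 => G G0 G1; rewrite expr2; nra.
exact: cvg_sub_div d0 cvg_gg.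
Unshelve. all: by end_near. Qed.

Lemma cvg_sgpr_cov : sgpr_cov gamma (@mu n) (@v n) (m n) x x / w n
  @[n --> \oo] --> (2^-1 : R).
Proof.
have cvg_eg : dot (e n) (vec (g n) n) / w n @[n --> \oo] --> (2^-1 : R).
  have lo : q n * (peak (q n) / w n) @[n --> \oo] --> (2^-1 : R).
    by rewrite -[X in _ --> X]mul1r; apply: cvgM; [exact: cvg_decay|exact: cvg_peak_decay].
  apply: (squeeze_cvgr _ lo (cvg_peak_decay gamma_gt0)); near=> n.
  have cn : (0 < cell n < n)%N by near: n; exact: near_cell.
  rewrite mulrA !ler_pM2r ?invr_gt0// dot_vec.
  exact: (two_point_weight (decay_itv gamma n) (offset_itv x01 n) cn).
have d0 : (sgpr_cov gamma (@mu n) (@v n) (m n) x x - dot (e n) (vec (g n) n)) / w n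
    @[n --> \oo] --> (0 : R).
  (* The first term is the bridge variance [r = w ^ 2] divided by [w]. *)
  have l : w n + (vtail n / w n + Num.sqrt (dot (rem_vec n) (rem_vec n)) / w n)
      @[n --> \oo] --> (0 : R).
    rewrite -[X in _ --> X](addr0 0); apply: cvgD => //.
    by rewrite -[X in _ --> X](addr0 0); apply: cvgD.
  apply: (cvg0_norm_le _ l); near=> n.
  have cn : (0 < cell n < n)%N by near: n; exact: near_cell.
  rewrite normrM normfV (gtr0_norm (w_gt0 n)) ler_pdivrMr// -(mulrDl (vtail n)) (mulrDl (w n)) divfK//.
  rewrite -expr2 -precision_bandwidth//.
  have /andP[b0 b1] := bm_bridge gamma (offset_itv x01 n) cn (offsetE x n).
  have := sgpr_covE (m n) (hmu n) (point_kvec cn) (point_rem cn).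
  have e1 : Num.sqrt (dot (e n) (e n)) <= 1.
    by rewrite -[leRHS]sqrtr1 ler_wsqrtr// (dot_two_point_le1 (offset_itv x01 n) cn).
  have rho0 := sqrtr_ge0 (dot (rem_vec n) (rem_vec n)).
  have er := ler_wpM2r rho0 e1; rewrite mul1r in er.
  rewrite -/(vtail n) -/(e n) in b0 b1 *; rewrite !ler_norml => /andP[h1 h2].
  by apply/andP; split; lra.
exact: cvg_sub_div d0 cvg_eg.
Unshelve. all: by end_near. Qed.

End spread_limits.

(** * Absolute moment of order [alpha] of the weights *)

Section absolute_moment.
Context (R : realType) (gamma alpha x : R).
Hypothesis gamma_gt0 : 0 < gamma.
Hypothesis a01 : 0 < alpha <= 1.
Hypothesis x01 : 0 < x < 1.
Local Notation h := (bandwidth gamma).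
Local Notation q := (decay gamma).
Local Notation cell := (cell x).
Local Notation offset := (offset x).
Local Notation f := (gamma_density alpha).

Let w n : R := h n `^ (2 * gamma).
Let w_gt0 n : 0 < w n. Proof. by rewrite powR_gt0// bandwidth_gt0. Qed.

Lemma sum_gap (F : nat -> R) i n : (0 < i <= n)%N ->
  \sum_(k < n) F (gap k.+1 i) =
  F 0%N + \sum_(d < i.-1) F d.+1 + \sum_(d < n - i) F d.+1.
Proof.
move=> /andP[i0 iN]; have base j : \sum_(k < j) F (gap k.+1 j) = \sum_(d < j) F d.
  elim: j => [|j IHj]; first by rewrite !big_ord0.
  rewrite [LHS]big_ord_recl [RHS]big_ord_recr/= addrC -IHj; congr (_ + _).
  by congr F; rewrite /gap; lia.
have -> : n = (i + (n - i))%N by lia.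
rewrite big_split_ord/= base addKn; congr (_ + _); last first.
  by apply: eq_bigr => k _; congr F; rewrite /gap; lia.
by rewrite -[in LHS](prednK i0) big_ord_recl.
Qed.

(** With [theta = - ln q], the limit follows from [1 - q <= - ln q <= (1 - q) / q]. *)
Lemma decay_expR : exists2 theta : nat -> R,
  (forall n, 0 < theta n /\ q n = expR (- theta n)) &
  theta n / w n @[n --> \oo] --> (1 : R).
Proof.
exists (fun n => - ln (q n)).
  move=> n; have /andP[q0 q1] := decay_itv gamma n.
  by rewrite oppr_gt0 opprK lnK ?posrE// -ln1 ltr_ln ?posrE.
have hi : (1 - q n) / w n * (q n)^-1 @[n --> \oo] --> (1 * 1^-1 : R).
  apply: cvgM; first exact: cvg_decay_compl.
  by apply: cvgV; [exact: oner_neq0|exact: cvg_decay].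
rewrite invr1 mulr1 in hi.
apply: (squeeze_cvgr _ (cvg_decay_compl gamma_gt0) hi); near=> n.
have /andP[q0 q1] := decay_itv gamma n.
have lq : expR (ln (q n)) = q n by rewrite lnK.
have wi : 0 < (w n)^-1 by rewrite invr_gt0.
apply/andP; split.
  rewrite (ler_pM2r wi); have := expR_ge1Dx (ln (q n)); rewrite lq.
  by lra.
rewrite mulrAC (ler_pM2r wi) ler_pdivlMr//.
have := expR_ge1Dx (- ln (q n)); rewrite expRN lq => e.
have : (1 - ln (q n)) * q n <= 1 by rewrite -ler_pdivlMr// mul1r.
by lra.
Unshelve. all: by end_near. Qed.

(** Up to a constant it bounds the kernel bias of every Hoelder function, and it is that bias for
    the cusp at [x]. *)
Definition abs_moment n : R := \sum_(k < n)
  weight (q n) (offset n) (cell n) k.+1 * `|k.+1%:R / nodes R n - x| `^ alpha.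

(** [U] has its centre at a node and exact geometric weights; [V] restores the interpolated weights,
    and [abs_moment] the true distances to [x]. The factor [w] turns grid steps into bandwidths, as
    [1 / N = h w]. *)
Let U n : R := w n `^ alpha *
  \sum_(k < n) laplace (q n) (cell n) k.+1 * (gap k.+1 (cell n))%:R `^ alpha.

Let V n : R := w n `^ alpha * \sum_(k < n)
  weight (q n) (offset n) (cell n) k.+1 * (gap k.+1 (cell n))%:R `^ alpha.

Lemma cvg_laplace_moment : exists2 L : R, 0 < L & U n @[n --> \oo] --> L.
Proof.
have /andP[a0 a1] := a01; have /andP[x0 x1] := x01.
have [theta thq thw] := decay_expR.
have [L L0 HL] := riemann_sum_gamma a01.
exists L => //.
have w0 : w n @[n --> \oo] --> (0 : R).
  by apply: cvg_bandwidth_powR => //; rewrite mulr_gt0.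
have th0 : theta n @[n --> \oo] --> (0 : R).
  have : theta n / w n * w n @[n --> \oo] --> (1 * 0 : R) by apply: cvgM.
  rewrite mulr0; apply: cvg_trans; apply: near_eq_cvg; near=> n.
  by rewrite divfK// gt_eqF.
have th_pos : \forall n \near \oo, 0 < theta n by near=> n; case: (thq n).
(* [theta N] is of order [1 / h], so a number of nodes proportional to [N] exhausts the integral. *)
have div (c : R) (D : nat -> nat) : 0 < c ->
    (\forall n \near \oo, c * nodes R n <= (D n)%:R) ->
    theta n * (D n)%:R @[n --> \oo] --> +oo.
  move=> c0 cD; apply/cvgryPge => A; near=> n.
  have h0 := bandwidth_gt0 gamma n.
  have [t0 _] := thq n.
  have tw : 2^-1 <= theta n / w n by near: n; apply: (cvgr_ge 1 thw); lra.
  have hA : h n <= c / 2 / (1 + `|A|).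
    near: n; apply: (cvgr_le 0 (cvg_bandwidth gamma_gt0)).
    by rewrite !divr_gt0// ltr_pwDl.
  have A1 : 0 < 1 + `|A| by rewrite ltr_pwDl.
  apply: (@le_trans _ _ (1 + `|A|)); first by have := ler_norm A; lra.
  apply: (@le_trans _ _ (theta n * (c * nodes R n))); last first.
    by rewrite ler_wpM2l ?(ltW t0)//; near: n.
  have e : theta n * (c * nodes R n) = theta n / w n * c * (h n)^-1.
    rewrite -(nodes_sqrt_precision gamma_gt0) -/(w n).
    by field; rewrite gt_eqF.
  rewrite e ler_pdivlMr// mulrC -ler_pdivlMr//.
  by apply: le_trans hA _; rewrite ler_pM2r ?invr_gt0// mulrC ler_pM2r.
have near_c := near_cell x01.
have X1 : theta n * \sum_(d < (cell n).-1) f (theta n * d.+1%:R) @[n --> \oo] --> L.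
  apply: HL => //; apply: (div (x / 4)); first by rewrite divr_gt0.
  near=> n; have c1 : x / 2 * nodes R n <= (cell n)%:R by near: n; exact: near_cell_ge.
  have c2 : (0 < cell n < n)%N by near: n.
  have c3 : (cell n)%:R = (cell n).-1%:R + 1 :> R by rewrite natr1 prednK//; case/andP: c2.
  have : 4 / x <= nodes R n by near: n; apply: cvgry_ge; exact: cvg_nodes.
  by rewrite ler_pdivrMr// => c4; lra.
have X2 : theta n * \sum_(d < n - cell n) f (theta n * d.+1%:R) @[n --> \oo] --> L.
  apply: HL => //; apply: (div ((1 - x) / 2)); first by rewrite divr_gt0// subr_gt0.
  near=> n; have : (1 - x) / 2 * nodes R n <= (n - (cell n).+1)%:R by near: n; exact: near_cell_co.
  by move=> /le_trans; apply; rewrite ler_nat leq_sub2l.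
have wt : w n / theta n @[n --> \oo] --> (1 : R).
  have : (theta n / w n)^-1 @[n --> \oo] --> (1^-1 : R) by apply: cvgV => //; exact: oner_neq0.
  by rewrite invr1; under eq_fun do rewrite invf_div.
have wta : (w n / theta n) `^ alpha @[n --> \oo] --> (1 : R).
  have cp : {for (1 : R), continuous (fun s : R => s `^ alpha)}.
    apply/differentiable_continuous/derivable1_diffP; apply: derivable_powR.
    by rewrite in_itv/= ltr01.
  have := cvg_comp _ _ wt cp; rewrite powR1; exact.
(* Each side of the centre contributes [L], and [peak / w] tends to [1/2]; the other factors replace
   [theta] by [w]. *)
have lim : (w n / theta n) `^ alpha * (peak (q n) / w n * (w n / theta n)) *
    (theta n * \sum_(d < (cell n).-1) f (theta n * d.+1%:R) +
     theta n * \sum_(d < n - cell n) f (theta n * d.+1%:R)) @[n --> \oo] -->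
    (1 * (2^-1 * 1) * (L + L) : R).
  apply: cvgM; last exact: cvgD.
  by apply: cvgM => //; apply: cvgM => //; exact: cvg_peak_decay.
have <- : 1 * (2^-1 * 1) * (L + L) = L by field.
apply: cvg_trans lim; apply: near_eq_cvg; near=> n.
have /andP[c0 cn] : (0 < cell n < n)%N by near: n.
have [t0 qE] := thq n.
rewrite /U; pose F d : R := peak (q n) * (q n ^+ d * d%:R `^ alpha).
rewrite (eq_bigr (fun k : 'I_n => F (gap k.+1 (cell n)))); last first.
  by move=> k _; rewrite /F /laplace mulrA.
rewrite sum_gap ?c0 ?(ltnW cn)// {1}/F powR0 ?gt_eqF// !mulr0 add0r.
have key D : theta n * \sum_(d < D) f (theta n * d.+1%:R) =
    theta n * theta n `^ alpha / peak (q n) * \sum_(d < D) F d.+1.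
  rewrite !mulr_sumr; apply: eq_bigr => d _; rewrite /F /f.
  have pk : peak (q n) != 0 by rewrite gt_eqF// peak_gt0// decay_itv.
  have qd : q n ^+ d.+1 = expR (- (theta n * d.+1%:R)).
    by rewrite {1}qE -expRM_natl; congr expR; ring.
  by rewrite powRM ?(ltW t0)// qd; field; exact: pk.
rewrite !key -mulrDr.
have pk : peak (q n) != 0 by rewrite gt_eqF// peak_gt0// decay_itv.
have ta : theta n `^ alpha != 0 by rewrite gt_eqF// powR_gt0.
have wn0 : w n != 0 by rewrite gt_eqF.
have tV : (theta n)^-1 `^ alpha = (theta n `^ alpha)^-1.
  by rewrite -powR_inv1 ?(ltW t0)// -powRrM mulN1r powRN.
have tV0 : 0 <= (theta n)^-1 by rewrite invr_ge0 ltW.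
rewrite (powRM alpha (ltW (w_gt0 n)) tV0) tV.
move: (\sum_(_ < _) _ + _) => Z.
by field; rewrite ?ta ?pk ?wn0 ?gt_eqF.
Unshelve. all: by end_near. Qed.

Lemma cvg_abs_moment : exists2 L : R, 0 < L &
  abs_moment n / h n `^ alpha @[n --> \oo] --> L.
Proof.
have /andP[a0 a1] := a01.
have [L L0 UL] := cvg_laplace_moment; exists L => //.
have VL : V n @[n --> \oo] --> L.
  have lo : q n * U n @[n --> \oo] --> (1 * L : R).
    by apply: cvgM => //; exact: cvg_decay.
  have hi : (q n)^-1 * U n @[n --> \oo] --> (1^-1 * L : R).
    by apply: cvgM => //; apply: cvgV; [exact: oner_neq0|exact: cvg_decay].
  rewrite invr1 !mul1r in lo hi.
  apply: (squeeze_cvgr _ lo hi); near=> n.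
  have q01 := decay_itv gamma n; have t01 := offset_itv x01 n.
  rewrite /U /V mulrCA [(q n)^-1 * _]mulrCA !ler_wpM2l ?powR_ge0//= !mulr_sumr.
    by apply: ler_sum => k _; rewrite mulrA ler_wpM2r ?powR_ge0// weight_le.
  by apply: ler_sum => k _; rewrite mulrA ler_wpM2r ?powR_ge0// weight_ge.
have wa : w n `^ alpha @[n --> \oo] --> (0 : R).
  apply: cvg0_powR => //; first by near=> n.
  by apply: cvg_bandwidth_powR => //; rewrite mulr_gt0.
(* Replacing [x] by its cell changes each distance by at most one grid step, hence its [alpha]-th
   power by at most one in these units. The weights have mass at most one, so the relative error is
   at most [w ^ alpha]. *)
apply: (@cvg_sub_div _ abs_moment (fun n => h n `^ alpha * V n) (fun n => h n `^ alpha)).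
  apply: (cvg0_norm_le _ wa); near=> n.
  have h0 := bandwidth_gt0 gamma n; have N0 := nodes_gt0 R n.
  have /andP[c0 cn] : (0 < cell n < n)%N by near: n; exact: near_cell.
  have q01 := decay_itv gamma n; have t01 := offset_itv x01 n.
  have /andP[t0 t1] := t01.
  have ha : 0 < h n `^ alpha by rewrite powR_gt0.
  pose d (k : nat) : R := `|k%:R - (cell n)%:R - offset n|.
  have d0 k : 0 <= d k by exact: normr_ge0.
  have SE : abs_moment n = h n `^ alpha * w n `^ alpha * \sum_(k < n)
      weight (q n) (offset n) (cell n) k.+1 * d k.+1 `^ alpha.
    rewrite mulr_sumr; apply: eq_bigr => k _; rewrite mulrCA; congr (_ * _).
    rewrite -!powRM ?(ltW h0) ?(ltW (w_gt0 n)) ?mulr_ge0 ?(ltW h0) ?(ltW (w_gt0 n))//.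
    congr (_ `^ _).
    have hw : h n * w n = (nodes R n)^-1.
      have := nodes_sqrt_precision gamma_gt0 n; rewrite -/(w n) => e.
      apply: (mulfI (lt0r_neq0 N0)); rewrite mulrCA e divff ?gt_eqF// divff// gt_eqF//.
    have NV : 0 < (nodes R n)^-1 by rewrite invr_gt0.
    rewrite hw /d -[X in _ = X * _](gtr0_norm NV) -normrM; congr `|_|.
    apply: (mulfI (lt0r_neq0 N0)); rewrite mulVKf ?lt0r_neq0//.
    have -> : nodes R n * (k.+1%:R / nodes R n - x) = k.+1%:R - x * nodes R n.
      by field; exact: lt0r_neq0.
    by rewrite (offsetE x n); ring.
  pose A : R := \sum_(k < n) weight (q n) (offset n) (cell n) k.+1 * d k.+1 `^ alpha.
  pose B : R := \sum_(k < n)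
    weight (q n) (offset n) (cell n) k.+1 * (gap k.+1 (cell n))%:R `^ alpha.
  have -> : (abs_moment n - h n `^ alpha * V n) / h n `^ alpha = w n `^ alpha * (A - B).
    have -> : V n = w n `^ alpha * B by [].
    rewrite SE -/A; move: A B (w n `^ alpha) (h n `^ alpha) ha => A B wa' ha' ha0.
    by field; rewrite gt_eqF.
  rewrite normrM (ger0_norm (powR_ge0 _ _)) ler_piMr ?powR_ge0// /A /B -sumrB.
  have wpos k : 0 <= weight (q n) (offset n) (cell n) k.
    by rewrite (le_trans _ (weight_ge q01 _ _ t01))// mulr_ge0 ?(ltW (laplace_gt0 q01 _ _)) ?(ltW (proj1 (andP q01))).
  have sw : \sum_(k < n) weight (q n) (offset n) (cell n) k.+1 <= 1.
    rewrite /weight big_split/=.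
    rewrite -[X in X + _]mulr_sumr -[X in _ + X]mulr_sumr.
    have cn1 : (0 < cell n <= n)%N by rewrite c0 ltnW.
    have t10 : 0 <= 1 - offset n by rewrite subr_ge0.
    have l1 := ler_wpM2l t10 (sum_laplace_le1 q01 (decayE gamma n) cn1).
    have l2 := ler_wpM2l t0 (sum_laplace_le1 q01 (decayE gamma n) (cn : (0 < (cell n).+1 <= n)%N)).
    by apply: le_trans (lerD l1 l2) _; rewrite (mulr1 (1 - _)) (mulr1 (offset n)) subrK.
  apply: le_trans (ler_norm_sum _ _ _) _; apply: le_trans sw.
  apply: ler_sum => k _; rewrite -mulrBr normrM (ger0_norm (wpos _)) ler_piMr//.
  apply: le_trans (powR_dist_le a01 _ _) _ => //.
  apply: (@le_trans _ _ (1 `^ alpha)); last by rewrite powR1.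
  rewrite ge0_ler_powR ?nnegrE ?(ltW a0)//.
  have -> : (gap k.+1 (cell n))%:R = `|k.+1%:R - (cell n)%:R| :> R.
    rewrite /gap; have [kc|ck] := leqP k.+1 (cell n).
      have -> : (k.+1 - cell n = 0)%N by apply/eqP; rewrite subn_eq0.
      by rewrite add0n natrB// distrC ger0_norm// subr_ge0 ler_nat.
    have -> : (cell n - k.+1 = 0)%N by apply/eqP; rewrite subn_eq0 ltnW.
    by rewrite addn0 natrB ?(ltnW ck)// ger0_norm// subr_ge0 ler_nat ltnW.
  apply: le_trans (ler_dist_dist _ _) _.
  by rewrite /d addrAC subrr add0r normrN ger0_norm.
have := VL; apply: cvg_trans; apply: near_eq_cvg; near=> n.
by rewrite mulrC mulKf// gt_eqF// powR_gt0// bandwidth_gt0.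
Unshelve. all: by end_near. Qed.

End absolute_moment.

Lemma convex_combination_dist (R : realFieldType) (t a b y c : R) : 0 <= t <= 1 ->
  `|a - y| <= c -> `|b - y| <= c -> `|(1 - t) * a + t * b - y| <= c.
Proof.
move=> /andP[t0 t1] ac bc; have t10 : 0 <= 1 - t by rewrite subr_ge0.
have -> : (1 - t) * a + t * b - y = (1 - t) * (a - y) + t * (b - y) by ring.
apply: le_trans (ler_normD _ _) _; rewrite !normrM (ger0_norm t0) (ger0_norm t10).
have -> : c = (1 - t) * c + t * c by ring.
by apply: lerD; rewrite ler_wpM2l.
Qed.

(** * Comparison of the bias with its kernel version *)

Section bias_limits.
Context (R : realType) (gamma alpha x : R) (m : nat -> nat).
Variables (mu : forall n, 'I_n -> R) (v : forall n, 'I_n -> 'cV[R]_n).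
Hypothesis gamma_gt0 : 0 < gamma.
Hypothesis a01 : 0 < alpha <= 1.
Hypothesis x01 : 0 < x < 1.
Hypothesis hmu : forall n, eigensystem (kmat gamma n) (@mu n) (@v n).
Hypothesis m_gt0 : \forall n \near \oo, (0 < m n)%N.
Local Notation h := (bandwidth gamma).
Local Notation q := (decay gamma).
Local Notation cell := (cell x).
Local Notation offset := (offset x).
Hypothesis m_large :
  h n `^ (- ((2 + alpha) / (1 + alpha))) / (m n)%:R @[n --> \oo] --> (0 : R).
Local Notation e := (point_vec x).
Local Notation g := (point_weight gamma x).
Local Notation rem := (rem_vec gamma x).

Let W n := sgpr_weights (@mu n) (@v n) (m n) (e n).

Definition sgpr_bias (f0 : R -> R) n : R :=
  dot (W n) (\col_i f0 (design R i)) - f0 x.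

Definition kernel_bias (f0 : R -> R) n : R :=
  \sum_(k < n) g n k.+1 * (sampled f0 n k.+1 - f0 x).

Let alpha1 : 0 < 1 + alpha. Proof. by have /andP[a0 _] := a01; lra. Qed.

(** The weaker growth that suffices for the spread, as [(2 + alpha) / (1 + alpha) >= 1] and [h <= 1]
    eventually. *)
Lemma bandwidth_large : (h n)^-1 / (m n)%:R @[n --> \oo] --> (0 : R).
Proof.
apply: (cvg0_norm_le _ m_large); near=> n.
have h0 := bandwidth_gt0 gamma n; have /andP[a0 a1] := a01.
have h1 : h n <= 1 by near: n; exact: near_bandwidth_le1.
rewrite ger0_norm ?mulr_ge0 ?invr_ge0 ?(ltW h0)// ler_wpM2r ?invr_ge0//.
have : h n `^ ((2 + alpha) / (1 + alpha)) <= h n `^ 1.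
  apply: ger_powR; first by rewrite h0.
  by rewrite ler_pdivlMr// mul1r; lra.
have hk : 0 < h n `^ ((2 + alpha) / (1 + alpha)) by rewrite powR_gt0.
by rewrite (powRr1 (ltW h0)) powRN lef_pV2.
Unshelve. all: by end_near. Qed.

Lemma sum_point_weight n : (0 < cell n < n)%N ->
  `|\sum_(k < n) g n k.+1 - 1| <= boundary gamma x n.
Proof.
move=> /andP[c0 cn]; have q01 := decay_itv gamma n; have /andP[q0 q1] := q01.
have /andP[t0 t1] := offset_itv x01 n.
have cn1 : (0 < cell n <= n)%N by rewrite c0 ltnW.
have cn2 : (0 < (cell n).+1 <= n)%N by [].
have n1 : 1 <= n%:R :> R by rewrite ler1n (leq_ltn_trans (leq0n (cell n))).
have -> : \sum_(k < n) g n k.+1 = (1 - offset n) * \sum_(k < n) laplace (q n) (cell n) k.+1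
    + offset n * \sum_(k < n) laplace (q n) (cell n).+1 k.+1.
  by rewrite [X in X + _]mulr_sumr [X in _ + X]mulr_sumr -big_split.
have u1 := sum_laplace_le1 q01 (decayE gamma n) cn1.
have u2 := sum_laplace_le1 q01 (decayE gamma n) cn2.
have l1 := sum_laplace_ge q01 (decayE gamma n) cn1.
have l2 := sum_laplace_ge q01 (decayE gamma n) cn2.
have b1 : q n ^+ (n - cell n) <= q n ^+ (n - (cell n).+1).
  by rewrite ler_wiXn2l ?(ltW q0) ?(ltW q1)// leq_sub2l.
have b2 : q n ^+ (cell n).+1 <= q n ^+ cell n.
  by rewrite ler_wiXn2l ?(ltW q0) ?(ltW q1).
have b3 : q n ^+ (n - (cell n).+1) <= n%:R * q n ^+ (n - (cell n).+1).
  by rewrite ler_peMl ?exprn_ge0 ?(ltW q0).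
have r1 : 0 <= q n ^+ (cell n) by rewrite exprn_ge0 ?(ltW q0).
have r2 : 0 <= q n ^+ (n - (cell n).+1) by rewrite exprn_ge0 ?(ltW q0).
rewrite /boundary; apply: convex_combination_dist; first exact: offset_itv.
  by rewrite ler_norml; apply/andP; split; lra.
by rewrite ler_norml; apply/andP; split; lra.
Qed.

Lemma holder01_bounded (f0 : R -> R) : holder01 alpha f0 ->
  exists2 B : R, 0 <= B & forall s, 0 <= s <= 1 -> `|f0 s| <= B.
Proof.
move=> /holder01P[H H0 fH]; exists (`|f0 0| + H); first by rewrite addr_ge0.
move=> s s01; have z01 : 0 <= (0 : R) <= 1 by rewrite lexx ler01.
have -> : f0 s = f0 0 + (f0 s - f0 0) by ring.
apply: le_trans (ler_normD _ _) _; rewrite lerD2l; apply: le_trans (fH _ _ s01 z01) _.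
have /andP[s0 s1] := s01; have /andP[a0 _] := a01.
rewrite ler_piMr// subr0 ger0_norm//; apply: (@le_trans _ _ (1 `^ alpha)); last by rewrite powR1.
by rewrite ge0_ler_powR ?nnegrE ?(ltW a0).
Qed.

(** Three errors separate the two biases: the missing mass of the weights times [f0 x], the
    discarded modes, and the boundary defect. *)
Lemma cvg_bias_kernel (f0 : R -> R) : holder01 alpha f0 ->
  (sgpr_bias f0 n - kernel_bias f0 n) / h n `^ alpha @[n --> \oo] --> (0 : R).
Proof.
move=> fh; have [B B0 fB] := holder01_bounded fh; have [H H0 fH] := holder01P fh.
have /andP[a0 a1] := a01.
pose C := 4 * B + 2 * H.
have C0 : 0 <= C by rewrite /C; lra.
have l1 : B * (h n `^ (- alpha) * boundary gamma x n) @[n --> \oo] --> (B * 0 : R).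
  by apply: cvgM; [exact: cvg_cst|exact: boundary_small].
(* The discarded modes: [h ^ (- 2) m ^ (- 1 - alpha) / h ^ alpha] is the power [1 + alpha] of the
   ratio in [m_large]. *)
have l2 : 32 * C * (h n `^ (- ((2 + alpha) / (1 + alpha))) / (m n)%:R) `^ (1 + alpha)
    @[n --> \oo] --> (32 * C * 0 : R).
  apply: cvgM; first exact: cvg_cst.
  apply: cvg0_powR => //; near=> n.
  have mn : (0 < m n)%N by near: n.
  by rewrite divr_gt0 ?ltr0n// powR_gt0// bandwidth_gt0.
(* The additional power [1 + 2 gamma] absorbs a factor [N], from the bound [N B] on the norm of the
   sampled function. *)
have l3 : B * (h n `^ (- (alpha + (1 + 2 * gamma))) * Num.sqrt (dot (rem n) (rem n)))
    @[n --> \oo] --> (B * 0 : R).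
  by apply: cvgM; [exact: cvg_cst|exact: cvg_rem_scaled].
have l : B * (h n `^ (- alpha) * boundary gamma x n)
  + 32 * C * (h n `^ (- ((2 + alpha) / (1 + alpha))) / (m n)%:R) `^ (1 + alpha)
  + B * (h n `^ (- (alpha + (1 + 2 * gamma))) * Num.sqrt (dot (rem n) (rem n)))
    @[n --> \oo] --> (0 : R).
  rewrite -[X in _ --> X](_ : B * 0 + 32 * C * 0 + B * 0 = 0); last by rewrite !mulr0 !addr0.
  by apply: cvgD l3; exact: cvgD l1 l2.
apply: (cvg0_norm_le _ l); near=> n.
have cn : (0 < cell n < n)%N by near: n; exact: near_cell.
have mn : (0 < m n)%N by near: n.
have h0 := bandwidth_gt0 gamma n; have N0 := nodes_gt0 R n.
have ha : 0 < h n `^ alpha by rewrite powR_gt0.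
have fE : \col_i f0 (design R i) = vec (sampled f0 n) n.
  by apply/colP => i; rewrite !mxE.
have x01' : 0 <= x <= 1 by have /andP[x0 x1] := x01; rewrite !ltW.
have -> : sgpr_bias f0 n - kernel_bias f0 n =
    f0 x * (\sum_(k < n) g n k.+1 - 1)
    - bias_tail (@mu n) (@v n) (m n) (e n) (vec (sampled f0 n) n)
    - \sum_j eta (@mu n) j * dot (@v n j) (rem n) * dot (@v n j) (vec (sampled f0 n) n).
  rewrite /sgpr_bias fE (sgpr_weights_dot (m n) (hmu n) (point_rem gamma cn)) dot_vec.
  have -> : kernel_bias f0 n = \sum_(k < n) g n k.+1 * sampled f0 n k.+1
      - f0 x * \sum_(k < n) g n k.+1.
    by rewrite mulr_sumr -sumrB; apply: eq_bigr => k _; rewrite mulrBr [f0 x * _]mulrC.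
  by ring.
rewrite normrM normfV (gtr0_norm ha) ler_pdivrMr//.
apply: le_trans (ler_normB _ _) _.
rewrite mulrDl; apply: lerD.
  apply: le_trans (ler_normB _ _) _; rewrite mulrDl; apply: lerD.
    rewrite normrM (_ : B * _ * _ = B * boundary gamma x n); last first.
      by rewrite powRN; move: (h n `^ alpha) ha => ha' hg; field; rewrite gt_eqF.
    by rewrite ler_pM ?normr_ge0 ?fB// sum_point_weight.
  have wc j : (j < n)%N -> `|\sum_(k < n) wave R n j k.+1 * sampled f0 n k.+1| <=
      C * nodes R n * j.+1%:R `^ (- alpha).
    by move=> jn; apply: holder_wave_coef.
  apply: le_trans (bias_tail_le (hmu n) (offset_itv x01 n) cn mn a0 C0 wc) _.
  rewrite precision_bandwidth//.
  have M0 : 0 < (m n)%:R :> R by rewrite ltr0n.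
  rewrite le_eqVlt; apply/orP; left; apply/eqP.
  have -> : (h n `^ (- ((2 + alpha) / (1 + alpha))) / (m n)%:R) `^ (1 + alpha) =
      (h n)^-1 ^+ 2 * (h n `^ alpha)^-1 * ((m n)%:R `^ (- alpha) / (m n)%:R).
    rewrite powRM ?powR_ge0 ?invr_ge0// -powRrM mulNr divfK ?gt_eqF//.
    rewrite -[_^-1 `^ _](_ : (m n)%:R `^ (- (1 + alpha)) = _); last first.
      by rewrite -mulN1r powRrM powR_inv1.
    rewrite (opprD 2 alpha) (opprD 1 alpha) powRD; last by rewrite (gt_eqF h0) implybT.
    rewrite [(m n)%:R `^ _]powRD; last by rewrite (gt_eqF M0) implybT.
    rewrite powR_inv1 ?ler0n// !(powRN (h n)) powR_mulrn ?(ltW h0)// exprVn.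
    by congr (_ * _); rewrite mulrC.
  have hw := nodes_sqrt_precision gamma_gt0 n.
  have -> : 32 * C * (h n `^ (2 * gamma)) ^+ 2 * nodes R n ^+ 2 * (m n)%:R `^ (- alpha) / (m n)%:R =
      32 * C * (nodes R n * h n `^ (2 * gamma)) ^+ 2 * ((m n)%:R `^ (- alpha) / (m n)%:R) by ring.
  rewrite hw; move: (_ / (m n)%:R) (h n `^ alpha) ha => Z ha' hg.
  by field; rewrite !gt_eqF.
apply: le_trans (remainder_dot_le (hmu n) _ _) _.
have ff : Num.sqrt (dot (vec (sampled f0 n) n) (vec (sampled f0 n) n)) <= nodes R n * B.
  have n0 : 0 < n%:R :> R by rewrite ltr0n (leq_ltn_trans (leq0n (cell n))) //; case/andP: cn.
  have n1 : 1 <= n%:R :> R by rewrite ler1n -(@ltr0n R).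
  rewrite -[leRHS]ger0_norm ?mulr_ge0 ?(ltW N0)// -sqrtr_sqr ler_wsqrtr// dot_vec.
  apply: (@le_trans _ _ (\sum_(k < n) B ^+ 2)).
    apply: ler_sum => k _; rewrite -expr2 -[leLHS]real_normK ?num_real//.
    by rewrite lerXn2r ?nnegrE// fB// node_itv.
  rewrite sumr_const card_ord -[leLHS]mulr_natl exprMn ler_wpM2r ?sqr_ge0//.
  have : n%:R <= nodes R n by rewrite /nodes lerDl.
  by move: (n%:R) n1 (nodes R n) => a b c d; nra.
rewrite [leLHS]mulrC; apply: le_trans (ler_wpM2r (sqrtr_ge0 _) ff) _.
rewrite opprD powRD; last by rewrite (gt_eqF h0) implybT.
rewrite -nodes_bandwidth// powRN le_eqVlt; apply/orP; left; apply/eqP.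
move: (h n `^ alpha) ha => ha' hg; field; exact: lt0r_neq0.
Unshelve. all: by end_near. Qed.

Lemma holder01_kernel_bias (f0 : R -> R) : holder01 alpha f0 ->
  exists2 H : R, 0 <= H & forall n, `|kernel_bias f0 n| <= H * abs_moment gamma alpha x n.
Proof.
move=> /holder01P[H H0 fH]; exists H => // n.
have x01' : 0 <= x <= 1 by have /andP[x0 x1] := x01; rewrite !ltW.
have q01 := decay_itv gamma n; have /andP[q0 q1] := q01.
apply: le_trans (ler_norm_sum _ _ _) _; rewrite mulr_sumr; apply: ler_sum => k _.
have g0 : 0 <= g n k.+1.
  apply: le_trans (weight_ge q01 (cell n) k.+1 (offset_itv x01 n)).
  by rewrite mulr_ge0 ?(ltW q0)// ltW// laplace_gt0.
rewrite normrM (ger0_norm g0) mulrCA ler_wpM2l//.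
by apply: fH => //; exact: node_itv.
Qed.

(** Every increment of the cusp from [x] has the same sign, so the Hoelder bound is attained without
    cancellation. *)
Lemma kernel_bias_cusp (a : R) n :
  kernel_bias (fun t => a * `|t - x| `^ alpha) n = a * abs_moment gamma alpha x n.
Proof.
have /andP[a0 _] := a01.
rewrite mulr_sumr; apply: eq_bigr => k _.
by rewrite /sampled subrr normr0 powR0 ?gt_eqF// mulr0 subr0 mulrCA.
Qed.

Lemma holder01_cusp (a : R) : holder01 alpha (fun t => a * `|t - x| `^ alpha).
Proof.
rewrite /holder01 /=; apply: (@le_lt_trans _ _ `|a|%:E); last by rewrite ltry.
apply: ge_ereal_sup => _ [_ [s [t [s01 t01 st ->]]] <-]; rewrite lee_fin.
have st0 : 0 < `|s - t| `^ alpha by rewrite powR_gt0// normr_gt0 subr_eq0.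
rewrite ler_pdivrMr// -mulrBr normrM ler_wpM2l//.
apply: le_trans (powR_dist_le a01 _ _) _ => //.
have /andP[a0 _] := a01; rewrite ge0_ler_powR ?nnegrE ?(ltW a0)//.
by apply: le_trans (ler_dist_dist _ _) _; rewrite opprB addrA subrK.
Qed.

End bias_limits.

(** * Limits of the coverage *)

Section coverage_limits.
Context (R : realType) (gamma x z : R) (m : nat -> nat).
Variables (mu : forall n, 'I_n -> R) (v : forall n, 'I_n -> 'cV[R]_n).
Hypothesis gamma_gt0 : 0 < gamma.
Hypothesis x01 : 0 < x < 1.
Hypothesis z_gt0 : 0 < z.
Hypothesis hmu : forall n, eigensystem (kmat gamma n) (@mu n) (@v n).
Hypothesis m_gt0 : \forall n \near \oo, (0 < m n)%N.
Hypothesis m_large : (bandwidth gamma n)^-1 / (m n)%:R @[n --> \oo] --> (0 : R).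
Local Notation h := (bandwidth gamma).
Local Notation bias := (sgpr_bias x m mu v).

Let W n := sgpr_weights (@mu n) (@v n) (m n) (point_vec x n).
Let ha n : R := h n `^ gamma.
Let ha_gt0 n : 0 < ha n. Proof. by rewrite powR_gt0// bandwidth_gt0. Qed.
Let haE n : h n `^ (2 * gamma) = ha n ^+ 2.
Proof. by rewrite mulrC powRrM powR_mulrn ?powR_ge0. Qed.

Let sd n : R := sgpr_sd gamma (@mu n) (@v n) (m n) x / ha n.
Let sw n : R := Num.sqrt (dot (W n) (W n)) / ha n.

Let sqrt_ratio (u : R) n : Num.sqrt u / ha n = Num.sqrt (u / h n `^ (2 * gamma)).
Proof.
rewrite haE [u / _]mulrC sqrtrM ?invr_ge0 ?sqr_ge0// -exprVn sqrtr_sqr mulrC.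
by rewrite ger0_norm// invr_ge0 ltW.
Qed.

Let cvg_sw : sw n @[n --> \oo] --> (2^-1 : R).
Proof.
have -> : 2^-1 = Num.sqrt 4^-1 :> R.
  have -> : 4^-1 = 2^-1 ^+ 2 :> R by rewrite expr2; field.
  by rewrite sqrtr_sqr ger0_norm.
rewrite /sw; under eq_fun do rewrite sqrt_ratio.
apply: (cvg_comp _ Num.sqrt (cvg_sgpr_weights_norm gamma_gt0 x01 hmu m_gt0 m_large)).
exact: sqrt_continuous.
Qed.

Let cvg_sd : sd n @[n --> \oo] --> (Num.sqrt (1 / 2) : R).
Proof.
rewrite /sd /sgpr_sd; under eq_fun do rewrite sqrt_ratio.
rewrite mul1r; apply: (cvg_comp _ Num.sqrt (cvg_sgpr_cov gamma_gt0 x01 hmu m_gt0 m_large)).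
exact: sqrt_continuous.
Qed.

Let lo f0 n : R := (- z * sd n - bias f0 n / ha n) / sw n.
Let hi f0 n : R := (z * sd n - bias f0 n / ha n) / sw n.

Let near_sw : \forall n \near \oo, 4^-1 <= sw n <= 1.
Proof.
near=> n; apply/andP; split; near: n.
  by apply: (cvgr_ge _ cvg_sw); lra.
by apply: (cvgr_le _ cvg_sw); lra.
Unshelve. all: by end_near. Qed.

Let sd_ge0 n : 0 <= sd n.
Proof. by rewrite divr_ge0 ?sqrtr_ge0// ltW. Qed.

Let lo_hi f0 : \forall n \near \oo, lo f0 n <= hi f0 n.
Proof.
near=> n; have /andP[s0 _] : 4^-1 <= sw n <= 1 by near: n.
have sw0 : 0 < sw n by lra.
rewrite /lo /hi ler_pM2r ?invr_gt0// lerD2r mulNr.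
by have := mulr_ge0 (ltW z_gt0) (sd_ge0 n); lra.
Unshelve. all: by end_near. Qed.

Let near_coverage f0 : \forall n \near \oo,
  coverage gamma (@mu n) (@v n) (m n) z x f0 =
  std_normal R `[lo f0 n, hi f0 n]%classic.
Proof.
near=> n; have /andP[s0 _] : 4^-1 <= sw n <= 1 by near: n.
have cn : (0 < cell x n < n)%N by near: n; exact: near_cell.
have sw0 : 0 < sw n by lra.
have w0 : 0 < Num.sqrt (dot (W n) (W n)).
  by rewrite -(divfK (lt0r_neq0 (ha_gt0 n)) (Num.sqrt _)) mulr_gt0.
rewrite (coverageE z f0 (hmu n) (point_kvec gamma x01 cn) w0).
have hn0 : ha n != 0 by rewrite gt_eqF.
have rescale (y s b : R) : (y * s - b) / Num.sqrt (dot (W n) (W n)) =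
    (y * (s / ha n) - b / ha n) / (Num.sqrt (dot (W n) (W n)) / ha n).
  rewrite [y * (s / _)]mulrA -mulrBl invf_div mulrA divfK//.
rewrite !rescale //.
Unshelve. all: by end_near. Qed.

(* With [h ^ gamma] as unit, the posterior standard deviation tends to [sqrt (1/2)],
   the standard deviation of the posterior mean to [1/2], and the bias to [beta]. *)
Definition limit_coverage (beta : R) : R :=
  Phi (z / Num.sqrt (1 / 2) - 2 * beta) - Phi (- (z / Num.sqrt (1 / 2)) - 2 * beta).

Lemma coverage_cvg f0 (beta : R) : bias f0 n / ha n @[n --> \oo] --> beta ->
  coverage gamma (@mu n) (@v n) (m n) z x f0 @[n --> \oo] --> (limit_coverage beta)%:E.
Proof.
(* A half-width [z sqrt (1/2)] over a standard deviation [1/2] equals the half-width [z] over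
   [sqrt (1/2)]: the origin of the variance [1/2] in the limit. *)
move=> bb; have c2 : z / Num.sqrt (1 / 2) = z * Num.sqrt (1 / 2) / 2^-1.
  have s0 : 0 < Num.sqrt (1 / 2) :> R by rewrite sqrtr_gt0 divr_gt0.
  have s2 : Num.sqrt (1 / 2) ^+ 2 = 1 / 2 :> R by rewrite sqr_sqrtr// divr_ge0.
  apply: (mulIf (lt0r_neq0 s0)); rewrite divfK ?gt_eqF//.
  transitivity (z * Num.sqrt (1 / 2) ^+ 2 * 2); first by rewrite s2; field.
  by rewrite invrK expr2; ring.
have lol : lo f0 n @[n --> \oo] --> (- (z / Num.sqrt (1 / 2)) - 2 * beta : R).
  have -> : - (z / Num.sqrt (1 / 2)) - 2 * beta = (- z * Num.sqrt (1 / 2) - beta) / 2^-1.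
    by rewrite c2; field.
  apply: cvgM; last by apply: cvgV => //; rewrite invr_eq0.
  by apply: cvgB => //; apply: cvgM => //; exact: cvg_cst.
have hil : hi f0 n @[n --> \oo] --> (z / Num.sqrt (1 / 2) - 2 * beta : R).
  have -> : z / Num.sqrt (1 / 2) - 2 * beta = (z * Num.sqrt (1 / 2) - beta) / 2^-1.
    by rewrite c2; field.
  apply: cvgM; last by apply: cvgV => //; rewrite invr_eq0.
  by apply: cvgB => //; apply: cvgM => //; exact: cvg_cst.
have := normal_prob_itv_cvg (lo_hi f0) lol hil.
apply: cvg_trans; apply: near_eq_cvg; near=> n; apply/esym; near: n.
exact: near_coverage.
Unshelve. all: by end_near. Qed.

(** The standardized interval keeps a bounded length while its upper end tends to minus infinity. *)
Lemma coverage_cvg0 f0 : bias f0 n / ha n @[n --> \oo] --> +oo ->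
  coverage gamma (@mu n) (@v n) (m n) z x f0 @[n --> \oo] --> (0%:E : \bar R).
Proof.
move=> boo; have pk : 0 < normal_peak 1 :> R by rewrite normal_peak_gt0// oner_neq0.
have P0 : (Phi (hi f0 n) - Phi (lo f0 n)) @[n --> \oo] --> (0 : R).
  apply/cvgrPdist_le => eps eps0; near=> n.
  have lh : lo f0 n <= hi f0 n by near: n; exact: lo_hi.
  rewrite sub0r normrN ger0_norm ?subr_ge0 ?Phi_le//.
  have /andP[s0 s1] : 4^-1 <= sw n <= 1 by near: n; exact: near_sw.
  have sw0 : 0 < sw n by lra.
  have sd1 : sd n <= 1.
    near: n; apply: (cvgr_le _ cvg_sd).
    by rewrite -[ltRHS]sqrtr1 ltr_sqrt//; lra.
  pose y := bias f0 n / ha n - z.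
  (* The summand [1] gives [y >= 1]; the other one makes the mass bound [8 z normal_peak / y] at
     most [eps]. *)
  have yb : 1 + 8 * z * normal_peak 1 / eps <= y.
    rewrite lerBrDr; near: n; move/cvgryPge : boo; exact.
  have y1 : 1 <= y.
    apply: le_trans yb; rewrite lerDl divr_ge0 ?(ltW eps0)// mulr_ge0 ?(ltW pk)//.
    by rewrite mulr_ge0 ?(ltW z_gt0).
  have zs : 0 <= z * sd n <= z by rewrite mulr_ge0 ?(ltW z_gt0)//= ler_piMr ?(ltW z_gt0).
  have /andP[zs0 zs1] := zs.
  have hy : hi f0 n <= - y.
    rewrite /hi ler_pdivrMr// /y; have : y * sw n <= y by rewrite ler_piMr//; lra.
    by rewrite /y; lra.
  (* The length is [2 z sd / sw], with [sd <= 1] and [sw >= 1/4]. *)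
  have hl : hi f0 n - lo f0 n <= 8 * z.
    rewrite /hi /lo -mulrBl ler_pdivrMr//; nra.
  apply: le_trans (Phi_diff_neg_le lh _) _; first lra.
  have yy : y <= 1 + hi f0 n ^+ 2 / 2 by rewrite expr2; nra.
  have y0 : 0 < y by lra.
  apply: (@le_trans _ _ (normal_peak 1 / y * (8 * z))).
    rewrite ler_pM ?subr_ge0// ?divr_ge0 ?(ltW pk)//.
      by rewrite (le_trans (ltW y0)).
    by rewrite ler_pM2l// lef_pV2 ?posrE// (lt_le_trans y0).
  rewrite mulrAC ler_pdivrMr//.
  have : 8 * z * normal_peak 1 / eps <= y by lra.
  by rewrite ler_pdivrMr// => t; rewrite mulrC [eps * _]mulrC.
have : (Phi (hi f0 n) - Phi (lo f0 n))%:E @[n --> \oo] --> (0%:E : \bar R).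
  by apply: cvg_EFin P0; near=> n.
apply: cvg_trans; apply: near_eq_cvg; near=> n.
have lh : lo f0 n <= hi f0 n by near: n; exact: lo_hi.
rewrite -normal_prob_itv//; apply/esym; near: n; exact: near_coverage.
Unshelve. all: by end_near. Qed.

Lemma limit_coverage_ivt p : 0 < p -> p <= limit_coverage 0 ->
  exists2 beta : R, 0 <= beta & limit_coverage beta = p.
Proof.
move=> p0 pK; have pk : 0 < normal_peak 1 :> R by rewrite normal_peak_gt0// oner_neq0.
set c := z / Num.sqrt (1 / 2) in pK *.
have c0 : 0 < c by rewrite divr_gt0// sqrtr_gt0 divr_gt0.
(* At the shift [b1] the limit interval is [[- y - 2 c, - y]], of mass at most
   [2 c normal_peak / y = p]; the intermediate value theorem then applies between [0] and [b1]. *)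
pose y := 2 * c * normal_peak 1 / p.
have y0 : 0 < y by rewrite divr_gt0// mulr_gt0// mulr_gt0.
pose b1 := (y + c) / 2.
have b10 : 0 <= b1 by rewrite /b1; lra.
have Kb1 : limit_coverage b1 <= p.
  rewrite /limit_coverage -/c.
  have e1 : c - 2 * b1 = - y by rewrite /b1; field.
  have e2 : - c - 2 * b1 = - y - 2 * c by rewrite /b1; field.
  rewrite e1 e2; apply: le_trans (Phi_diff_neg_le _ _) _; [lra|lra|].
  have -> : - y - (- y - 2 * c) = 2 * c by ring.
  rewrite sqrrN.
  apply: (@le_trans _ _ (normal_peak 1 / y * (2 * c))).
    rewrite ler_pM2r; last lra.
    rewrite ler_pM2l// lef_pV2 ?posrE//; have := sqr_ge0 (y - 1); rewrite !expr2; nra.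
  by rewrite mulrAC ler_pdivrMr// [p * _]mulrC /y divfK ?gt_eqF// mulrC.
have contK : {within `[0, b1], continuous limit_coverage}.
  apply: continuous_subspaceT => b; rewrite /limit_coverage.
  apply: cvgB.
    apply: (cvg_comp (fun b => c - 2 * b) (@Phi R)); last exact: continuous_Phi.
    by apply: cvgB; [exact: cvg_cst|apply: cvgM; [exact: cvg_cst|exact: cvg_id]].
  apply: (cvg_comp (fun b => - c - 2 * b) (@Phi R)); last exact: continuous_Phi.
  by apply: cvgB; [exact: cvg_cst|apply: cvgM; [exact: cvg_cst|exact: cvg_id]].
have [|b bi Kb] := @IVT R limit_coverage 0 b1 p b10 contK.
  by rewrite ge_min le_max Kb1 pK orbT.
by exists b => //; move: bi; rewrite in_itv/= => /andP[].
Qed.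

End coverage_limits.

(** * The growth hypothesis in terms of the bandwidth *)

Section inducing_variables.
Context (R : realType) (gamma alpha : R) (m : nat -> nat).
Hypothesis gamma_gt0 : 0 < gamma.
Hypothesis a01 : 0 < alpha <= 1.
Hypothesis hm : much_greater (fun n => (m n)%:R : R)
  (fun n => n%:R `^ (1 / (1 + 2 * gamma) * ((2 + alpha) / (1 + alpha)))).

Lemma near_inducing_gt0 : \forall n \near \oo, (0 < m n)%N.
Proof.
near=> n; rewrite lt0n -(pnatr_eq0 R); near: n; exact: hm.1.
Unshelve. all: by end_near. Qed.

Lemma inducing_large :
  bandwidth gamma n `^ (- ((2 + alpha) / (1 + alpha))) / (m n)%:R
    @[n --> \oo] --> (0 : R).
Proof.
have [_ l0] := hm; move: l0.
set E := 1 / (1 + 2 * gamma) * ((2 + alpha) / (1 + alpha)) => l0.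
have /andP[a0 _] := a01; have g0 := gamma_gt0.
have g1 : 0 < 1 + 2 * gamma by lra.
have a1 : 0 < 1 + alpha by lra.
have E0 : 0 <= E.
  by rewrite mulr_ge0// divr_ge0//; lra.
have hE n : bandwidth gamma n `^ (- ((2 + alpha) / (1 + alpha))) = nodes R n `^ E.
  rewrite /bandwidth -powRrM; congr (_ `^ _); rewrite /E.
  by field; rewrite !gt_eqF.
(* [N <= 2 n] for [n >= 1], so passing from [n] to [N] costs a factor [2 ^ E]. *)
apply: (@cvg0_norm_le _ _ (fun n => 2 `^ E * (n%:R `^ E / (m n)%:R))); last first.
  by rewrite -(mulr0 (2 `^ E)); apply: cvgM => //; exact: cvg_cst.
near=> n; have n1 : (1 <= n)%N by near: n; exists 1%N.
rewrite hE ger0_norm ?divr_ge0 ?powR_ge0// mulrA ler_wpM2r ?invr_ge0//.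
rewrite -powRM// ge0_ler_powR ?nnegrE// ?(ltW (nodes_gt0 R n)) ?mulr_ge0//.
rewrite /nodes; have : 1 <= n%:R :> R by rewrite ler1n.
lra.
Unshelve. all: by end_near. Qed.

End inducing_variables.

Section credibility.
Context (R : realType).

Lemma normal_abs_le1 (z : R) : 0 <= z -> normal_abs_le 1 z = (Phi z - Phi (- z))%:E.
Proof. by move=> z0; rewrite /normal_abs_le sqrtr1 normal_abs_leE// divr1. Qed.

Lemma normal_abs_le_half (z : R) : 0 <= z ->
  normal_abs_le (1 / 2) z = (limit_coverage z 0)%:E.
Proof.
move=> z0; rewrite /normal_abs_le normal_abs_leE ?sqrtr_gt0 ?divr_gt0//.
by rewrite /limit_coverage mulr0 !subr0.
Qed.

(** The quantile is known only through its mass, which would be zero for [z <= 0]. *)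
Lemma quantile_gt0 (c z : R) : 0 < c -> normal_abs_le 1 z = c%:E -> 0 < z.
Proof.
move=> c0 hz; rewrite ltNge; apply/negP; rewrite le_eqVlt => /orP[/eqP z0|z0].
  move: hz; rewrite z0 normal_abs_le1// oppr0 subrr => -[] e.
  by rewrite -e ltxx in c0.
move: hz; rewrite /normal_abs_le (_ : [set t | _] = set0) ?measure0; last first.
  apply/seteqP; split => t //= tz; have := le_lt_trans tz z0.
  by rewrite normr_lt0.
by move=> -[] e; rewrite -e ltxx in c0.
Qed.

Lemma credibility_lt (c z : R) : 0 < c -> normal_abs_le 1 z = c%:E ->
  (c%:E < normal_abs_le (1 / 2) z)%E.
Proof.
move=> c0 hz; have z0 := quantile_gt0 c0 hz.
rewrite -hz normal_abs_le_half ?normal_abs_le1 ?(ltW z0)// lte_fin /limit_coverage.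
rewrite mulr0 !subr0.
have s0 : 0 < Num.sqrt (1 / 2) :> R by rewrite sqrtr_gt0 divr_gt0.
have s1 : Num.sqrt (1 / 2) < 1 :> R by rewrite -[ltRHS]sqrtr1 ltr_sqrt//; lra.
have zs : z < z / Num.sqrt (1 / 2) by rewrite ltr_pdivlMr// gtr_pMr.
by apply: ltrB; apply: Phi_diff_gt; rewrite ?ltrN2.
Qed.

End credibility.

Theorem theorem3p6 (R : realType) (alpha gamma x delta z : R) (m : nat -> nat)
    (mu : forall n, 'I_n -> R) (v : forall n, 'I_n -> 'cV[R]_n)
    (halpha : 0 < alpha <= 1) (hgamma : 0 < gamma <= 1) (hx : 0 < x < 1)
    (hdelta : 0 < delta < 1)
    (hz : normal_abs_le 1 z = (1 - delta)%:E)
    (hmu : forall n, eigensystem (kmat gamma n) (@mu n) (@v n))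
    (hmn : forall n, (m n <= n)%N)
    (hm : much_greater (fun n => (m n)%:R : R)
            (fun n => n%:R `^ (1 / (1 + 2 * gamma) *
                               ((2 + alpha) / (1 + alpha))))) :
  let p_delta := normal_abs_le (1 / 2) z in
  let q f0 n := coverage gamma (@mu n) (@v n) (m n) z x f0 in
  [/\ ((1 - delta)%:E < p_delta)%E,
      (gamma < alpha -> forall f0, holder01 alpha f0 ->
         q f0 n @[n --> \oo] --> p_delta),
      (alpha = gamma -> forall p : R, 0 < p -> (p%:E <= p_delta)%E ->
         exists2 f0, holder01 alpha f0 & q f0 n @[n --> \oo] --> p%:E) &
      (alpha < gamma ->
         exists2 f0, holder01 alpha f0 & q f0 n @[n --> \oo] --> 0%:E)].
Proof.
have /andP[d0 d1] := hdelta; have c0 : 0 < 1 - delta by lra.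
have /andP[g0 _] := hgamma; have /andP[a0 _] := halpha.
have z0 := quantile_gt0 c0 hz.
have m_gt0 := near_inducing_gt0 hm.
have m_large := inducing_large g0 halpha hm.
have m_large1 := bandwidth_large g0 halpha m_large.
have h0 n := bandwidth_gt0 gamma n.
have [L L0 momentL] := cvg_abs_moment g0 halpha hx.
set h := bandwidth gamma in h0 m_large m_large1 momentL.
have bias0 f0 : holder01 alpha f0 ->
    (sgpr_bias x m mu v f0 n - kernel_bias gamma x f0 n) / h n `^ alpha
      @[n --> \oo] --> (0 : R).
  by move=> f0a; exact: (cvg_bias_kernel g0 halpha hx hmu m_gt0 m_large f0a).
have cusp a : sgpr_bias x m mu v (fun t => a * `|t - x| `^ alpha) n / h n `^ alpha
    @[n --> \oo] --> a * L.
  apply: cvg_sub_div; first exact/bias0/holder01_cusp.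
  under eq_fun do rewrite kernel_bias_cusp// -mulrA.
  by apply: cvgM => //; exact: cvg_cst.
move=> p_delta q; split.
- exact: credibility_lt.
- move=> ga f0 f0a; rewrite /p_delta normal_abs_le_half ?(ltW z0)//.
  apply: (coverage_cvg g0 hx z0 hmu m_gt0 m_large1).
  have [H H0 biasH] := holder01_kernel_bias gamma hx f0a.
  (* The bias is at most [B h ^ alpha] with [B] convergent, so dividing by [h ^ gamma] leaves the
     null factor [h ^ (alpha - gamma)]. *)
  pose B n := `|(sgpr_bias x m mu v f0 n - kernel_bias gamma x f0 n) / h n `^ alpha|
    + H * (abs_moment gamma alpha x n / h n `^ alpha).
  have B0 : B n * h n `^ (alpha - gamma) @[n --> \oo] --> (0 : R).
    have hB : B n @[n --> \oo] --> `|0 : R| + H * L.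
      apply: cvgD; first by apply: cvg_norm; exact: bias0.
      by apply: cvgM => //; exact: cvg_cst.
    rewrite -(mulr0 (`|0 : R| + H * L)); apply: cvgM => //.
    by apply: cvg_bandwidth_powR; rewrite // subr_gt0.
  apply: cvg0_norm_le B0; near=> n.
  have ha : 0 < h n `^ alpha by exact/powR_gt0/h0.
  have hg : 0 < h n `^ gamma by exact/powR_gt0/h0.
  rewrite powRB ?(ltW (h0 n))//; last by rewrite gt_eqF// implybT.
  rewrite normrM normfV (gtr0_norm hg) mulrA ler_pM2r ?invr_gt0//.
  rewrite /B normrM normfV (gtr0_norm ha) mulrA -mulrDl divfK ?gt_eqF//.
  rewrite -lerBlDr; apply: le_trans (lerB_dist _ _).
  by rewrite lerB// biasH.
- move=> ag p p0; rewrite /p_delta normal_abs_le_half ?(ltW z0)// lee_fin => pp.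
  have [beta _ <-] := limit_coverage_ivt z0 p0 pp.
  (* The scaled bias of the cusp of amplitude [a] tends to [a L]; dividing by [L] makes the limit
     [beta]. *)
  exists (fun t => beta / L * `|t - x| `^ alpha); first exact: holder01_cusp.
  apply: (coverage_cvg g0 hx z0 hmu m_gt0 m_large1).
  by have := cusp (beta / L); rewrite divfK ?gt_eqF// ag.
- move=> ag; exists (fun t => 1 * `|t - x| `^ alpha); first exact: holder01_cusp.
  apply: (coverage_cvg0 g0 hx z0 hmu m_gt0 m_large1).
  (* The scaled bias is [(bias / h ^ alpha) / h ^ (gamma - alpha)], with a numerator eventually
     above [L / 2] and a denominator tending to zero. *)
  have gap0 : h n `^ (gamma - alpha) @[n --> \oo] --> (0 : R).
    by apply: cvg_bandwidth_powR; rewrite // subr_gt0.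
  apply/cvgryPge => A.
  pose M := `|A| + 1.
  have M0 : 0 < M by rewrite /M ltr_wpDl.
  near=> n.
  have ha : 0 < h n `^ alpha by exact/powR_gt0/h0.
  have hg : 0 < h n `^ gamma by exact/powR_gt0/h0.
  have c2 : L / 2 <= sgpr_bias x m mu v (fun t => 1 * `|t - x| `^ alpha) n / h n `^ alpha.
    by near: n; apply: (cvgr_ge _ (cusp 1)); rewrite mul1r; lra.
  have : h n `^ (gamma - alpha) <= L / 2 / M.
    by near: n; apply: (cvgr_le _ gap0); rewrite !divr_gt0.
  rewrite powRB ?(ltW (h0 n))//; last by rewrite gt_eqF// implybT.
  rewrite ler_pdivlMr// mulrAC ler_pdivrMr// => c1; rewrite ler_pdivlMr//.
  move: c2; rewrite ler_pdivlMr//; apply: le_trans.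
  apply: le_trans (_ : M * h n `^ gamma <= _).
    by rewrite ler_pM2r// /M (le_trans (ler_norm _))// lerDl.
  by rewrite mulrC.
Unshelve. all: by end_near. Qed.
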